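(* Let $f\in\mathcal{S}^*_S$, and let $H_{2,1}(F_{f^{-1}}/2)=\Gamma_1\Gamma_3-\Gamma_2^2$, where $\Gamma_1,\Gamma_2,\Gamma_3$ are the first three logarithmic coefficients of the inverse function $f^{-1}$. Then $$|H_{2,1}(F_{f^{-1}}/2)|\leq \frac14 .$$ The inequality is sharp, with extremal function $h_1(z)=\dfrac{z}{1-z^2}=z+z^3+z^5+\cdots$, $z\in\mathbb{D}$; that is, $h_1\in\mathcal{S}^*_S$ and $|H_{2,1}(F_{h_1^{-1}}/2)|=\frac14$.
   Context: Let $\mathbb{D}=\{z\in\mathbb{C}:|z|<1\}$, and let $\mathcal{A}$ be the class of holomorphic functions $f$ on $\mathbb{D}$ with $f(0)=0$ and $f'(0)=1$, so that $f(z)=z+\sum_{n=2}^\infty a_nz^n$. The class $\mathcal{S}^*_S$ of functions starlike with respect to symmetric points consists of all $f\in\mathcal{A}$ such that $$\mathrm{Re}\left(\frac{zf'(z)}{f(z)-f(-z)}\right)>0,\qquad z\in\mathbb{D},$$ where the quotient at $z=0$ is understood as its limit $1/2$. Such functions are univalent. For such $f$, let $F=f^{-1}$ be its inverse function, defined and holomorphic in a neighborhood of the origin (one may take $|w|<1/4$), with $F(w)=w+\sum_{n\ge2}A_nw^n$. The logarithmic coefficients $\Gamma_n=\Gamma_n(F)$ of the inverse function are defined by $$\log\left(\frac{F(w)}{w}\right)=2\sum_{n=1}^\infty \Gamma_n w^n\quad\text{near } w=0,\qquad \log 1:=0.$$ The second Hankel determinant of these coefficients is $$H_{2,1}(F_{f^{-1}}/2)=\begin{vmatrix}\Gamma_1&\Gamma_2\\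 \Gamma_2&\Gamma_3\end{vmatrix}=\Gamma_1\Gamma_3-\Gamma_2^2 .$$ *)

(* Defs.v *)
From Stdlib Require Import Reals.
From Coquelicot Require Import Coquelicot.

Open Scope C_scope.

(* Complex differentiability at every point of the open disk |z| < r. *)
Definition holomorphic_on_disk (r : R) (f : C -> C) : Prop :=
  forall z : C, (Cmod z < r)%R ->
    ex_derive (K := C_AbsRing) (V := C_NormedModule) f z.

Definition class_A (f : C -> C) : Prop :=
  holomorphic_on_disk 1 f /\ f 0 = 0 /\ C_derive f 0 = 1.

(* At z = 0 the quotient stands for its limit 1/2, so the condition holds there
   automatically and only z <> 0 has to be considered. *)
Definition starlike_symmetric (f : C -> C) : Prop :=
  class_A f /\
  forall z : C, (Cmod z < 1)%R -> z <> 0 ->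
    f z - f (- z) <> 0 /\
    (0 < Re (z * C_derive f z / (f z - f (- z)))%C)%R.

(* F is the inverse of f (restricted to the unit disk), defined and holomorphic
   on some disk around the origin; values of F outside it are irrelevant. *)
Definition inverse_near_0 (f F : C -> C) : Prop :=
  exists r : R, (0 < r)%R /\
    holomorphic_on_disk r F /\
    (forall w : C, (Cmod w < r)%R -> (Cmod (F w) < 1)%R /\ f (F w) = w) /\
    (forall z : C, (Cmod z < 1)%R -> (Cmod (f z) < r)%R -> F (f z) = z).

Definition Cexp (z : C) : C :=
  ((exp (Re z) * cos (Im z))%R, (exp (Re z) * sin (Im z))%R).

(* L is the holomorphic branch of log (F w / w) on the disk |w| < r that
   vanishes at the origin, where F w / w is extended by its limit 1. *)
Definition log_quotient_branch (r : R) (F L : C -> C) : Prop :=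
  holomorphic_on_disk r L /\ L 0 = 0 /\
  forall w : C, (Cmod w < r)%R -> w <> 0 -> Cexp (L w) = F w / w.

(* log (F w / w) = 2 * sum_{n >= 1} Gamma_n w^n near w = 0; the value Gamma 0
   is not used. *)
Definition log_coefficients (F : C -> C) (Gamma : nat -> C) : Prop :=
  exists (r : R) (L : C -> C), (0 < r)%R /\
    log_quotient_branch r F L /\
    forall w : C, (Cmod w < r)%R ->
      exists s : C,
        is_series (K := C_AbsRing) (V := C_NormedModule)
          (fun n : nat => Gamma (S n) * w ^ S n) s /\
        L w = 2 * s.

(* H_{2,1}: the determinant with rows (Gamma_1, Gamma_2), (Gamma_2, Gamma_3). *)
Definition hankel_2_1 (Gamma : nat -> C) : C :=
  Gamma 1%nat * Gamma 3%nat - Gamma 2%nat ^ 2.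

Definition h1 (z : C) : C := z / (1 - z ^ 2).

(* Main.v *)
Require Import Defs.
From Stdlib Require Import Reals Lra Lia Psatz Classical ClassicalChoice.
From Coquelicot Require Import Coquelicot.

(** Write k(z) = f(z)/z and G(z) = (f(z) - f(-z))/(2z).  The hypothesis on f says
    that f'/G has positive real part, so W = (f' - G)/(f' + G) maps the unit disk
    into itself and vanishes at 0.  Comparing coefficients in
    W (f' + G) = f' - G expresses the coefficients a_2, a_3, a_4 of f through the
    coefficients b_1, b_2, b_3 of W ([starlike_symmetric_coefs]); comparing
    coefficients in e^L k(w e^L) = 1, where L(w) = log (F(w)/w), expresses
    Gamma_1, Gamma_2, Gamma_3 through a_2, a_3, a_4 ([inverse_log_coefs]).
    Together ([hankel_schwarz]) the determinant becomes a quarter of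
    b_1 b_3/2 - 3/2 b_1^2 b_2 - b_2^2 + b_1^4/12.

    With x = |b_1| and y = |b_2| the coefficients of a self-map of the disk
    vanishing at 0 satisfy y <= 1 - x^2 and |b_3| <= 1 - x^2 - y^2/(1 + x)
    ([schwarz_coef_bounds]).  The triangle inequality then bounds the modulus of
    the bracket by an expression that increases with y and equals
    1 - 11/12 x^4 at y = 1 - x^2 ([schwarz_functional_bound]), which gives 1/4.
    The two bounds follow from averaging W(rho e^it) e^-it Q(t) S(t)^* over a
    circle, Q and S being trigonometric polynomials of degree two: the average
    involves b_1, b_2, b_3 only, and it is at most the average of
    (|Q|^2 + |S|^2)/2 ([toeplitz_contraction]).  A good choice of Q and S does
    the rest, and rho tends to 1.

    For h1 the map W is z^2, so b_1 = b_3 = 0, b_2 = 1 and the bracket is -1.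
    The inverse of h1 is 2w/(1 + sqrt (1 + 4w^2)), and log (F(w)/w) is given by
    the principal logarithm, because 1 + sqrt (1 + 4w^2) has positive real part.

    All this presupposes that a complex differentiable function has a
    differentiable derivative and a Taylor expansion.  Goursat's theorem for
    rectangles ([goursat]) is proved by repeated quadrisection.  The exponential
    turns a rectangle of height 2 pi into an annulus, the integrals along the
    horizontal sides cancel, and so the mean of a function over a circle about 0
    does not depend on the radius.  The mean being continuous in the radius, one
    circle on which differentiability is not known does no harm
    ([circle_mean]); hence z (f(z) - f(a))/(z - a) may be averaged, and this is
    Cauchy's formula ([cauchy_formula]).  Coefficients are compared through
    expansions up to O(z^4) ([jet3]), for which sums, products and compositions
    are elementary. *)

Open Scope C_scope.

(** * Complex differentiability and continuity *)

Definition is_Cderive (f : C -> C) (z l : C) : Prop :=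
  is_derive (K := C_AbsRing) (V := C_NormedModule) f z l.
Definition ex_Cderive (f : C -> C) (z : C) : Prop := exists l, is_Cderive f z l.

Lemma is_Cderive_eps (f : C -> C) (z l : C) :
  is_Cderive f z l <->
  forall eps : R, (0 < eps)%R -> exists d : R, (0 < d)%R /\
    forall w, (Cmod (w - z) < d)%R ->
      (Cmod (f w - f z - l * (w - z)) <= eps * Cmod (w - z))%R.
Proof.
  split.
  - intros [_ H] eps Heps.
    destruct (H z (fun P HP => HP) (mkposreal eps Heps)) as [d Hd].
    exists d; split; [apply cond_pos|].
    intros w Hw. specialize (Hd w Hw).
    rewrite (Cmult_comm l).
    exact Hd.
  - intros H; split; [apply is_linear_scal_l|].
    intros x Hx. apply (is_filter_lim_locally_unique (V := AbsRing_NormedModule C_AbsRing)) in Hx. subst x.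
    intros [eps Heps]. destruct (H eps Heps) as [d [Hd H']].
    exists (mkposreal d Hd). intros w Hw. specialize (H' w Hw).
    rewrite (Cmult_comm l) in H'. exact H'.
Qed.

(** The complex numbers carry two uniform structures, that of the absolute value
    and that of a product of two lines.  Differentiability depends on the norm
    only, which is the same for both. *)
Lemma is_Cderive_AbsRing (f : C -> C) (z l : C) :
  is_Cderive f z l <->
  is_derive (K := C_AbsRing) (V := AbsRing_NormedModule C_AbsRing) f z l.
Proof. split; intros [[L1 L2 L3] H]; (split; [split; assumption|exact H]). Qed.

Lemma is_Cderive_plus (f g : C -> C) (z df dg : C) :
  is_Cderive f z df -> is_Cderive g z dg ->
  is_Cderive (fun w => f w + g w) z (df + dg).
Proof. intros; now apply (is_derive_plus (K := C_AbsRing) (V := C_NormedModule)). Qed.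

Lemma is_Cderive_minus (f g : C -> C) (z df dg : C) :
  is_Cderive f z df -> is_Cderive g z dg ->
  is_Cderive (fun w => f w - g w) z (df - dg).
Proof. intros; now apply (is_derive_minus (K := C_AbsRing) (V := C_NormedModule)). Qed.

Lemma is_Cderive_opp (f : C -> C) (z df : C) :
  is_Cderive f z df -> is_Cderive (fun w => - f w) z (- df).
Proof. intros; now apply (is_derive_opp (K := C_AbsRing) (V := C_NormedModule)). Qed.

Lemma is_Cderive_const (c z : C) : is_Cderive (fun _ => c) z 0.
Proof. apply (is_derive_const (K := C_AbsRing) (V := C_NormedModule)). Qed.

Lemma is_Cderive_id (z : C) : is_Cderive (fun w => w) z 1.
Proof.
  apply is_Cderive_eps; intros eps He; exists 1%R; split; [lra|]; intros w _.
  replace (w - z - 1 * (w - z)) with (RtoC 0) by ring.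
  rewrite Cmod_0. apply Rmult_le_pos; [lra|apply Cmod_ge_0].
Qed.

Lemma is_Cderive_bounded (f : C -> C) (z l : C) :
  is_Cderive f z l ->
  exists d : R, (0 < d)%R /\ forall w, (Cmod (w - z) < d)%R ->
      (Cmod (f w - f z) <= (Cmod l + 1) * Cmod (w - z))%R.
Proof.
  intros H. rewrite is_Cderive_eps in H. destruct (H 1%R Rlt_0_1) as [d [Hd Hw]].
  exists d; split; auto. intros w Hwd. specialize (Hw w Hwd).
  replace (f w - f z) with ((f w - f z - l * (w - z)) + l * (w - z)) by ring.
  eapply Rle_trans; [apply Cmod_triangle|]. rewrite Cmod_mult. lra.
Qed.

Definition Ccont (f : C -> C) (z : C) : Prop :=
  forall eps : R, (0 < eps)%R -> exists d : R, (0 < d)%R /\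
    forall w, (Cmod (w - z) < d)%R -> (Cmod (f w - f z) < eps)%R.

Lemma is_Cderive_cont (f : C -> C) (z l : C) : is_Cderive f z l -> Ccont f z.
Proof.
  intros H eps He. destruct (is_Cderive_bounded _ _ _ H) as [d [Hd Hw]].
  pose proof (Cmod_ge_0 l).
  exists (Rmin d (eps / (Cmod l + 1))); split.
  - apply Rmin_pos; auto. apply Rdiv_lt_0_compat; lra.
  - intros w H1.
    eapply Rle_lt_trans; [apply Hw; eapply Rlt_le_trans; [exact H1|apply Rmin_l]|].
    assert (Cmod (w - z) < eps / (Cmod l + 1))%R by (eapply Rlt_le_trans; [exact H1|apply Rmin_r]).
    replace eps with ((Cmod l + 1) * (eps / (Cmod l + 1)))%R by (field; lra).
    apply Rmult_lt_compat_l; lra.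
Qed.

Lemma ex_Cderive_cont (f : C -> C) (z : C) : ex_Cderive f z -> Ccont f z.
Proof. intros [l H]. eapply is_Cderive_cont; eauto. Qed.

Lemma is_Cderive_mult (f g : C -> C) (z df dg : C) :
  is_Cderive f z df -> is_Cderive g z dg ->
  is_Cderive (fun w => f w * g w) z (df * g z + f z * dg).
Proof.
  intros Hf Hg.
  rewrite is_Cderive_AbsRing in *.
  exact (is_derive_mult (K := C_AbsRing) f g z df dg Hf Hg Cmult_comm).
Qed.

Lemma is_Cderive_comp (f g : C -> C) (z df dg : C) :
  is_Cderive f (g z) df -> is_Cderive g z dg ->
  is_Cderive (fun w => f (g w)) z (dg * df).
Proof.
  intros Hf Hg.
  rewrite is_Cderive_AbsRing in Hg.
  exact (is_derive_comp (K := C_AbsRing) (V := C_NormedModule) f g z df dg Hf Hg).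
Qed.

Lemma Cmod_sub_ge (a b : C) : (Cmod a - Cmod b <= Cmod (a - b))%R.
Proof.
  pose proof (Cmod_triangle (a - b) b) as H.
  replace (a - b + b) with a in H by ring. lra.
Qed.

Lemma Cmod_sub_sym (a b : C) : Cmod (a - b) = Cmod (b - a).
Proof. rewrite <- Cmod_opp. f_equal. ring. Qed.

Lemma is_Cderive_Cinv (u : C) : u <> 0 -> is_Cderive Cinv u (- / (u * u)).
Proof.
  intros Hu. apply is_Cderive_eps. intros eps He.
  assert (Hm : (0 < Cmod u)%R) by now apply Cmod_gt_0.
  set (m := Cmod u) in *.
  assert (Hm3 : (0 < m * m * m)%R) by (repeat apply Rmult_lt_0_compat; auto).
  exists (Rmin (m / 2) (eps * (m * m * m) / 2)); split.
  { apply Rmin_pos; [lra|]. apply Rdiv_lt_0_compat; [|lra]. now apply Rmult_lt_0_compat. }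
  intros w Hw.
  assert (A1 : (Cmod (w - u) < m / 2)%R) by (eapply Rlt_le_trans; [exact Hw|apply Rmin_l]).
  assert (A2 : (Cmod (w - u) < eps * (m * m * m) / 2)%R) by (eapply Rlt_le_trans; [exact Hw|apply Rmin_r]).
  assert (Hwm : (m / 2 <= Cmod w)%R).
  { pose proof (Cmod_sub_ge u w). rewrite Cmod_sub_sym in H. fold m in H. lra. }
  assert (Hw0 : w <> 0) by (apply Cmod_gt_0; lra).
  replace (/ w - / u - - / (u * u) * (w - u)) with ((w - u) * ((w - u) / (u * u * w)))
    by (field; auto).
  assert (u * u * w <> 0) by (repeat apply Cmult_neq_0; auto).
  rewrite Cmod_mult, Cmod_div, !Cmod_mult by auto. fold m.
  rewrite Rmult_comm. apply Rmult_le_compat_r; [apply Cmod_ge_0|].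
  assert (0 < m * m * Cmod w)%R by (repeat apply Rmult_lt_0_compat; lra).
  apply Rmult_le_reg_r with (m * m * Cmod w)%R; auto.
  unfold Rdiv. rewrite Rmult_assoc, Rinv_l, Rmult_1_r by lra.
  apply Rle_trans with (eps * (m * m * m) / 2)%R; [lra|].
  replace (eps * (m * m * m) / 2)%R with (eps * (m * m * (m / 2)))%R by field.
  repeat (apply Rmult_le_compat_l; [nra|]). exact Hwm.
Qed.

Lemma is_Cderive_inv (f : C -> C) (z df : C) :
  f z <> 0 -> is_Cderive f z df ->
  is_Cderive (fun w => / f w) z (- df / (f z * f z)).
Proof.
  intros H0 H.
  pose proof (is_Cderive_comp Cinv f z _ df (is_Cderive_Cinv _ H0) H) as H1.
  replace (- df / (f z * f z)) with (df * - / (f z * f z)); [exact H1|field; auto].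
Qed.

Lemma is_Cderive_div (f g : C -> C) (z df dg : C) :
  g z <> 0 -> is_Cderive f z df -> is_Cderive g z dg ->
  is_Cderive (fun w => f w / g w) z ((df * g z - f z * dg) / (g z * g z)).
Proof.
  intros H0 Hf Hg.
  pose proof (is_Cderive_mult f (fun w => / g w) z _ _ Hf (is_Cderive_inv g z dg H0 Hg)) as H1.
  replace ((df * g z - f z * dg) / (g z * g z)) with (df * / g z + f z * (- dg / (g z * g z)));
    [exact H1|field; auto].
Qed.

(** * Curves in the complex plane and their integrals *)

(** Continuity is required of the two components because integrals are taken
    component by component; [ccont_eps] is the metric form. *)
Definition ccont (h : R -> C) (t : R) : Prop :=
  continuous (fun t => fst (h t)) t /\ continuous (fun t => snd (h t)) t.

Lemma ccont_const (c : C) t : ccont (fun _ => c) t.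
Proof. split; apply continuous_const. Qed.

Lemma ccont_RtoC (f : R -> R) t : continuous f t -> ccont (fun t => RtoC (f t)) t.
Proof. split; simpl; auto. apply continuous_const. Qed.

Lemma ccont_plus (f g : R -> C) t :
  ccont f t -> ccont g t -> ccont (fun t => f t + g t) t.
Proof. intros [H1 H2] [H3 H4]; split; simpl; now apply (continuous_plus (V := R_NormedModule)). Qed.

Lemma ccont_opp (f : R -> C) t : ccont f t -> ccont (fun t => - f t) t.
Proof. intros [H1 H2]; split; simpl; now apply (continuous_opp (V := R_NormedModule)). Qed.

Lemma ccont_minus (f g : R -> C) t :
  ccont f t -> ccont g t -> ccont (fun t => f t - g t) t.
Proof. intros; apply ccont_plus; auto; now apply ccont_opp. Qed.

Lemma ccont_mult (f g : R -> C) t :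
  ccont f t -> ccont g t -> ccont (fun t => f t * g t) t.
Proof.
  intros [H1 H2] [H3 H4]; split; simpl.
  - apply (continuous_minus (V := R_NormedModule)); now apply (continuous_mult (K := R_AbsRing)).
  - apply (continuous_plus (V := R_NormedModule)); now apply (continuous_mult (K := R_AbsRing)).
Qed.

Lemma ccont_conj (f : R -> C) t : ccont f t -> ccont (fun t => Cconj (f t)) t.
Proof. intros [H1 H2]; split; simpl; auto. now apply (continuous_opp (V := R_NormedModule)). Qed.

Lemma continuous_eps (f : R -> R) (t : R) :
  (forall eps, (0 < eps)%R -> exists d, (0 < d)%R /\ forall s, (Rabs (s - t) < d)%R -> (Rabs (f s - f t) < eps)%R) ->
  continuous f t.
Proof.
  intros H. apply continuity_pt_filterlim. intros eps He.
  destruct (H eps He) as [d [Hd H']]. exists d; split; auto.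
  intros x [_ Hx]. apply H', Hx.
Qed.

Lemma eps_continuous (f : R -> R) (t : R) :
  continuous f t ->
  (forall eps, (0 < eps)%R -> exists d, (0 < d)%R /\ forall s, (Rabs (s - t) < d)%R -> (Rabs (f s - f t) < eps)%R).
Proof.
  intros H eps He. apply continuity_pt_filterlim in H.
  destruct (H eps He) as [d [Hd H']]. exists d; split; auto.
  intros x Hx. destruct (Req_dec t x) as [<-|Hn].
  - now rewrite Rminus_diag, Rabs_R0.
  - apply H'. split; auto. split; auto. exact I.
Qed.

Lemma Cmod_le_sum (z : C) : (Cmod z <= Rabs (fst z) + Rabs (snd z))%R.
Proof.
  destruct z as [x y]; simpl.
  replace (x, y) with (RtoC x + Ci * RtoC y) by (unfold RtoC, Ci, Cplus, Cmult; simpl; f_equal; ring).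
  eapply Rle_trans; [apply Cmod_triangle|].
  rewrite Cmod_mult, !Cmod_R, Cmod_Ci. lra.
Qed.

Lemma Cmod_fst (z : C) : (Rabs (fst z) <= Cmod z)%R.
Proof. eapply Rle_trans; [apply Rmax_l|apply Rmax_Cmod]. Qed.

Lemma Cmod_snd (z : C) : (Rabs (snd z) <= Cmod z)%R.
Proof. eapply Rle_trans; [apply Rmax_r|apply Rmax_Cmod]. Qed.

Lemma ccont_eps (h : R -> C) (t : R) :
  ccont h t <->
  forall eps, (0 < eps)%R -> exists d, (0 < d)%R /\ forall s, (Rabs (s - t) < d)%R -> (Cmod (h s - h t) < eps)%R.
Proof.
  split.
  - intros [H1 H2] eps He.
    destruct (eps_continuous _ _ H1 (eps / 2)) as [d1 [Hd1 K1]]; [lra|].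
    destruct (eps_continuous _ _ H2 (eps / 2)) as [d2 [Hd2 K2]]; [lra|].
    exists (Rmin d1 d2); split; [now apply Rmin_pos|].
    intros s Hs. eapply Rle_lt_trans; [apply Cmod_le_sum|]. simpl.
    specialize (K1 s (Rlt_le_trans _ _ _ Hs (Rmin_l _ _))).
    specialize (K2 s (Rlt_le_trans _ _ _ Hs (Rmin_r _ _))).
    unfold Rminus in *. lra.
  - intros H; split; apply continuous_eps; intros eps He;
      destruct (H eps He) as [d [Hd K]]; exists d; split; auto; intros s Hs;
      (eapply Rle_lt_trans; [|apply (K s Hs)]).
    + apply (Cmod_fst (h s - h t)).
    + apply (Cmod_snd (h s - h t)).
Qed.

Lemma ccont_comp (f : C -> C) (h : R -> C) t :
  Ccont f (h t) -> ccont h t -> ccont (fun t => f (h t)) t.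
Proof.
  intros Hf Hh. rewrite ccont_eps in Hh. apply ccont_eps. intros eps He.
  destruct (Hf eps He) as [d [Hd K]]. destruct (Hh d Hd) as [d' [Hd' K']].
  exists d'; split; auto.
Qed.

Lemma ccont_inv (h : R -> C) t : h t <> 0 -> ccont h t -> ccont (fun t => / h t) t.
Proof.
  intros H0 H. apply ccont_comp; auto. eapply is_Cderive_cont, is_Cderive_Cinv, H0.
Qed.

Lemma ccont_div (f h : R -> C) t :
  h t <> 0 -> ccont f t -> ccont h t -> ccont (fun t => f t / h t) t.
Proof. intros. apply ccont_mult; auto. now apply ccont_inv. Qed.

Lemma ccont_pow (f : R -> C) n t : ccont f t -> ccont (fun t => f t ^ n) t.
Proof.
  intros H; induction n; simpl; [apply ccont_const|]. now apply ccont_mult.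
Qed.

Definition Cint (h : R -> C) (a b : R) : C :=
  (RInt (fun t => fst (h t)) a b, RInt (fun t => snd (h t)) a b).

Definition ccont_on (h : R -> C) (a b : R) : Prop :=
  (a <= b)%R /\ forall t, (a <= t <= b)%R -> ccont h t.

Lemma ccont_on_ex_RInt h a b : ccont_on h a b ->
  ex_RInt (fun t => fst (h t)) a b /\ ex_RInt (fun t => snd (h t)) a b.
Proof.
  intros [Hab H]; split; apply (ex_RInt_continuous (V := R_CompleteNormedModule));
    rewrite Rmin_left, Rmax_right by auto; intros z Hz; now apply H.
Qed.

Lemma Cint_ext (f g : R -> C) a b :
  (a <= b)%R -> (forall t, (a <= t <= b)%R -> f t = g t) -> Cint f a b = Cint g a b.
Proof.
  intros Hab H. unfold Cint. f_equal; apply RInt_ext; rewrite Rmin_left, Rmax_right by auto;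
    intros x Hx; rewrite H; auto; lra.
Qed.

Lemma Cint_plus f g a b : ccont_on f a b -> ccont_on g a b ->
  Cint (fun t => f t + g t) a b = Cint f a b + Cint g a b.
Proof.
  intros Hf Hg. destruct (ccont_on_ex_RInt _ _ _ Hf), (ccont_on_ex_RInt _ _ _ Hg).
  unfold Cint, Cplus. simpl. f_equal; now apply (RInt_plus (V := R_CompleteNormedModule)).
Qed.

Lemma Cint_scal c f a b : ccont_on f a b ->
  Cint (fun t => c * f t) a b = c * Cint f a b.
Proof.
  intros Hf. destruct (ccont_on_ex_RInt _ _ _ Hf) as [H1 H2].
  unfold Cint, Cmult. simpl.
  assert (E : forall k u, ex_RInt u a b -> RInt (fun t => (k * u t)%R) a b = (k * RInt u a b)%R)
    by (intros; now apply (RInt_scal (V := R_CompleteNormedModule))).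
  assert (X : forall k u, ex_RInt u a b -> ex_RInt (fun t => (k * u t)%R) a b)
    by (intros; now apply (ex_RInt_scal (V := R_NormedModule))).
  f_equal.
  - rewrite <- (E _ _ H1), <- (E _ _ H2).
    apply (RInt_minus (V := R_CompleteNormedModule)); now apply X.
  - rewrite <- (E _ _ H1), <- (E _ _ H2).
    apply (RInt_plus (V := R_CompleteNormedModule)); now apply X.
Qed.

Lemma Cint_opp f a b : ccont_on f a b -> Cint (fun t => - f t) a b = - Cint f a b.
Proof.
  intros Hf. destruct (ccont_on_ex_RInt _ _ _ Hf) as [H1 H2].
  unfold Cint, Copp. simpl. f_equal; now apply (RInt_opp (V := R_CompleteNormedModule)).
Qed.

Lemma ccont_on_opp f a b : ccont_on f a b -> ccont_on (fun t => - f t) a b.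
Proof. intros [H1 H2]; split; auto. intros; now apply ccont_opp, H2. Qed.

Lemma Cint_minus f g a b : ccont_on f a b -> ccont_on g a b ->
  Cint (fun t => f t - g t) a b = Cint f a b - Cint g a b.
Proof.
  intros Hf Hg. unfold Cminus. rewrite Cint_plus, Cint_opp; auto. now apply ccont_on_opp.
Qed.

Lemma Cint_conj f a b : ccont_on f a b ->
  Cint (fun t => Cconj (f t)) a b = Cconj (Cint f a b).
Proof.
  intros Hf. destruct (ccont_on_ex_RInt _ _ _ Hf) as [H1 H2].
  unfold Cint, Cconj. simpl. f_equal. now apply (RInt_opp (V := R_CompleteNormedModule)).
Qed.

Lemma Cint_const (c : C) a b : Cint (fun _ => c) a b = RtoC (b - a) * c.
Proof.
  unfold Cint. rewrite !RInt_const. destruct c. unfold scal, Cmult, RtoC; simpl.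
  unfold mult; simpl. f_equal; ring.
Qed.

Lemma Cint_Chasles f a b c : ccont_on f a b -> ccont_on f b c ->
  Cint f a b + Cint f b c = Cint f a c.
Proof.
  intros Hf Hg. destruct (ccont_on_ex_RInt _ _ _ Hf), (ccont_on_ex_RInt _ _ _ Hg).
  unfold Cint, Cplus. simpl. f_equal; now apply (RInt_Chasles (V := R_CompleteNormedModule)).
Qed.

(** The factor 2 comes from estimating the two components separately.  It is
    harmless: the bound only serves to show that integrals tend to 0 or stay
    bounded. *)
Lemma Cint_bound f a b M : ccont_on f a b ->
  (forall t, (a <= t <= b)%R -> (Cmod (f t) <= M)%R) ->
  (Cmod (Cint f a b) <= 2 * ((b - a) * M))%R.
Proof.
  intros Hf HM. destruct (ccont_on_ex_RInt _ _ _ Hf) as [H1 H2]. destruct Hf as [Hab _].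
  eapply Rle_trans; [apply Cmod_le_sum|]. unfold Cint; simpl.
  assert (Rabs (RInt (fun t => fst (f t)) a b) <= (b - a) * M)%R.
  { apply abs_RInt_le_const; auto. intros t Ht. eapply Rle_trans; [apply Cmod_fst|auto]. }
  assert (Rabs (RInt (fun t => snd (f t)) a b) <= (b - a) * M)%R.
  { apply abs_RInt_le_const; auto. intros t Ht. eapply Rle_trans; [apply Cmod_snd|auto]. }
  lra.
Qed.

(** * Goursat's theorem for rectangles *)

Lemma nested_intervals (l u : nat -> R) :
  (forall n, l n <= l (S n))%R -> (forall n, u (S n) <= u n)%R ->
  (forall n, l n <= u n)%R -> exists a, forall n, (l n <= a <= u n)%R.
Proof.
  intros Hl Hu Hlu.
  assert (Ml : forall n m, (n <= m)%nat -> (l n <= l m)%R).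
  { induction 1; [lra|]. eapply Rle_trans; eauto. }
  assert (Mu : forall n m, (n <= m)%nat -> (u m <= u n)%R).
  { induction 1; [lra|]. eapply Rle_trans; eauto. }
  assert (B : forall n m, (l n <= u m)%R).
  { intros n m. pose proof (Ml n (max n m) (Nat.le_max_l _ _)).
    pose proof (Mu m (max n m) (Nat.le_max_r _ _)). specialize (Hlu (max n m)). lra. }
  destruct (completeness (fun r => exists n, r = l n)) as [a [Ha1 Ha2]].
  - exists (u 0%nat). intros r [n ->]. apply B.
  - exists (l 0%nat), 0%nat. reflexivity.
  - exists a. intros n; split.
    + apply Ha1. now exists n.
    + apply Ha2. intros r [m ->]. apply B.
Qed.

Definition shift_if (b : bool) (d : R) : R := if b then d else 0%R.

(** Suppose that a property passes from four quarters to the whole, and that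
    every point has a level of subdivision at which the rectangles containing
    the point have the property.  Then the initial rectangle has it: otherwise a
    nested sequence of bad rectangles would shrink to a point.  [P n x y] speaks of the rectangle with lower left corner [(x, y)]
    that is [2 ^ n] times smaller than the initial one. *)
Lemma quadrisection (W H x0 y0 : R) (P : nat -> R -> R -> Prop) :
  (0 <= W)%R -> (0 <= H)%R ->
  (forall n x y, (x0 <= x)%R -> (x + W / 2 ^ n <= x0 + W)%R ->
     (y0 <= y)%R -> (y + H / 2 ^ n <= y0 + H)%R ->
     (forall i j : bool, P (S n) (x + shift_if i (W / 2 ^ S n))%R (y + shift_if j (H / 2 ^ S n))%R) ->
     P n x y) ->
  (forall a b, (x0 <= a <= x0 + W)%R -> (y0 <= b <= y0 + H)%R ->
     exists n : nat, forall x y,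
       (x0 <= x)%R -> (x + W / 2 ^ n <= x0 + W)%R ->
       (y0 <= y)%R -> (y + H / 2 ^ n <= y0 + H)%R ->
       (x <= a <= x + W / 2 ^ n)%R -> (y <= b <= y + H / 2 ^ n)%R -> P n x y) ->
  P 0%nat x0 y0.
Proof.
  intros HW HH Hstep Hloc. apply NNPP. intros Hn.
  set (bad := fun n (p : R * R) =>
    (x0 <= fst p)%R /\ (fst p + W / 2 ^ n <= x0 + W)%R /\
    (y0 <= snd p)%R /\ (snd p + H / 2 ^ n <= y0 + H)%R /\ ~ P n (fst p) (snd p)).
  assert (Hsh : forall n (b : bool) d, (0 <= d)%R ->
     (0 <= shift_if b (d / 2 ^ S n))%R /\ (shift_if b (d / 2 ^ S n) + d / 2 ^ S n <= d / 2 ^ n)%R).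
  { intros n b d Hd. simpl pow.
    assert (E : (d / 2 ^ n = 2 * (d / (2 * 2 ^ n)))%R)
      by (field; apply pow_nonzero; lra).
    assert (0 <= d / (2 * 2 ^ n))%R.
    { apply Rdiv_le_0_compat; auto. apply Rmult_lt_0_compat; [lra|apply pow_lt; lra]. }
    destruct b; simpl; lra. }
  assert (Hnext : forall np : nat * (R * R), exists q : R * R,
    (exists i j, fst q = (fst (snd np) + shift_if i (W / 2 ^ S (fst np)))%R /\
                 snd q = (snd (snd np) + shift_if j (H / 2 ^ S (fst np)))%R) /\
    (bad (fst np) (snd np) -> bad (S (fst np)) q)).
  { intros [n [x y]]; cbv [fst snd].
    destruct (classic (bad n (x, y))) as [Hb|Hb].
    2:{ eexists (_, _). split; [exists true, true; split; reflexivity|]. intros; contradiction. }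
    destruct (classic (exists i j,
      ~ P (S n) (x + shift_if i (W / 2 ^ S n))%R (y + shift_if j (H / 2 ^ S n))%R)) as [(i & j & Hij)|Hno].
    - eexists (_, _). split; [exists i, j; split; reflexivity|]. intros (B1 & B2 & B3 & B4 & _).
      destruct (Hsh n i W HW), (Hsh n j H HH). unfold bad; cbv [fst snd] in *.
      repeat split; auto; lra.
    - exfalso. destruct Hb as (B1 & B2 & B3 & B4 & B5). cbv [fst snd] in *. apply B5, Hstep; auto.
      intros i j. apply NNPP. intros HP. apply Hno. now exists i, j. }
  destruct (choice _ Hnext) as [nxt Hnxt].
  set (s := fix s n := match n with O => (x0, y0) | S m => nxt (m, s m) end).
  assert (HS : forall n, (exists i j, fst (s (S n)) = (fst (s n) + shift_if i (W / 2 ^ S n))%R /\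
                 snd (s (S n)) = (snd (s n) + shift_if j (H / 2 ^ S n))%R)).
  { intros n. exact (proj1 (Hnxt (n, s n))). }
  assert (Inv : forall n, bad n (s n)).
  { induction n as [|n I].
    - unfold bad; simpl; repeat split; auto; lra.
    - exact (proj2 (Hnxt (n, s n)) I). }
  assert (Hpos : forall d n, (0 <= d)%R -> (0 <= d / 2 ^ n)%R).
  { intros d n Hd. apply Rdiv_le_0_compat; auto. apply pow_lt; lra. }
  destruct (nested_intervals (fun n => fst (s n)) (fun n => fst (s n) + W / 2 ^ n)%R) as [a Ha].
  1,2: intros n; destruct (HS n) as (i & j & E1 & E2); rewrite E1; destruct (Hsh n i W HW); lra.
  { intros n. specialize (Hpos W n HW). lra. }
  destruct (nested_intervals (fun n => snd (s n)) (fun n => snd (s n) + H / 2 ^ n)%R) as [b Hb].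
  1,2: intros n; destruct (HS n) as (i & j & E1 & E2); rewrite E2; destruct (Hsh n j H HH); lra.
  { intros n. specialize (Hpos H n HH). lra. }
  destruct (Hloc a b) as [n Hn'].
  { specialize (Ha 0%nat); simpl in Ha. lra. }
  { specialize (Hb 0%nat); simpl in Hb. lra. }
  destruct (Inv n) as (I1 & I2 & I3 & I4 & I5).
  apply I5, Hn'; auto.
Qed.

(** The integral of [G] along the boundary of a rectangle, counterclockwise. *)
Definition rect_int (G : C -> C) (x1 x2 y1 y2 : R) : C :=
  Cint (fun x => G (x, y1)) x1 x2 + Ci * Cint (fun y => G (x2, y)) y1 y2
  - Cint (fun x => G (x, y2)) x1 x2 - Ci * Cint (fun y => G (x1, y)) y1 y2.

Definition Ccont_rect (G : C -> C) (x1 x2 y1 y2 : R) : Prop :=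
  (x1 <= x2)%R /\ (y1 <= y2)%R /\
  forall x y, (x1 <= x <= x2)%R -> (y1 <= y <= y2)%R -> Ccont G (x, y).

Lemma ccont_pair_l (y x : R) : ccont (fun x => (x, y)) x.
Proof. split; simpl; [apply continuous_id|apply continuous_const]. Qed.

Lemma ccont_pair_r (x y : R) : ccont (fun y => (x, y)) y.
Proof. split; simpl; [apply continuous_const|apply continuous_id]. Qed.

Lemma Ccont_rect_hor G x1 x2 y1 y2 a b y :
  Ccont_rect G x1 x2 y1 y2 -> (x1 <= a)%R -> (a <= b)%R -> (b <= x2)%R -> (y1 <= y <= y2)%R ->
  ccont_on (fun x => G (x, y)) a b.
Proof.
  intros (H1 & H2 & H3) ? ? ? ?; split; auto. intros t Ht.
  apply (ccont_comp G (fun x => (x, y))); [apply H3; lra|apply ccont_pair_l].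
Qed.

Lemma Ccont_rect_ver G x1 x2 y1 y2 a b x :
  Ccont_rect G x1 x2 y1 y2 -> (y1 <= a)%R -> (a <= b)%R -> (b <= y2)%R -> (x1 <= x <= x2)%R ->
  ccont_on (fun y => G (x, y)) a b.
Proof.
  intros (H1 & H2 & H3) ? ? ? ?; split; auto. intros t Ht.
  apply (ccont_comp G (fun y => (x, y))); [apply H3; lra|apply ccont_pair_r].
Qed.

Lemma Ccont_rect_sub G x1 x2 y1 y2 a b c d :
  Ccont_rect G x1 x2 y1 y2 -> (x1 <= a <= b)%R -> (b <= x2)%R -> (y1 <= c <= d)%R -> (d <= y2)%R ->
  Ccont_rect G a b c d.
Proof.
  intros (H1 & H2 & H3) ? ? ? ?; repeat split; try lra. intros; apply H3; lra.
Qed.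

Lemma rect_int_split_x G x1 xm x2 y1 y2 :
  Ccont_rect G x1 x2 y1 y2 -> (x1 <= xm <= x2)%R ->
  rect_int G x1 x2 y1 y2 = rect_int G x1 xm y1 y2 + rect_int G xm x2 y1 y2.
Proof.
  intros HG Hm. pose proof HG as (H1 & H2 & _). unfold rect_int.
  rewrite <- (Cint_Chasles (fun x => G (x, y1)) x1 xm x2),
    <- (Cint_Chasles (fun x => G (x, y2)) x1 xm x2);
    try (eapply Ccont_rect_hor; eauto; lra).
  ring.
Qed.

Lemma rect_int_split_y G x1 x2 y1 ym y2 :
  Ccont_rect G x1 x2 y1 y2 -> (y1 <= ym <= y2)%R ->
  rect_int G x1 x2 y1 y2 = rect_int G x1 x2 y1 ym + rect_int G x1 x2 ym y2.
Proof.
  intros HG Hm. pose proof HG as (H1 & H2 & _). unfold rect_int.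
  rewrite <- (Cint_Chasles (fun y => G (x1, y)) y1 ym y2),
    <- (Cint_Chasles (fun y => G (x2, y)) y1 ym y2);
    try (eapply Ccont_rect_ver; eauto; lra).
  ring.
Qed.

Lemma Cint_RtoC a b : (a <= b)%R -> Cint RtoC a b = RtoC ((b * b - a * a) / 2).
Proof.
  intros Hab. unfold Cint, RtoC; simpl. f_equal.
  - apply is_RInt_unique.
    replace ((b * b - a * a) / 2)%R with (minus (b * b / 2)%R (a * a / 2)%R)
      by (unfold minus, plus, opp; simpl; field).
    apply (is_RInt_derive (fun t => (t * t / 2)%R)).
    + intros x _. auto_derive; auto. field.
    + intros x _. apply continuous_id.
  - rewrite RInt_const. unfold scal; simpl; unfold mult; simpl. ring.
Qed.

Lemma Cint_affine (A B : C) a b : (a <= b)%R ->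
  Cint (fun t => A + B * RtoC t) a b = RtoC (b - a) * A + B * RtoC ((b * b - a * a) / 2).
Proof.
  intros Hab.
  assert (HR : forall t, ccont RtoC t) by (intros t; apply (ccont_RtoC (fun t => t)), continuous_id).
  rewrite Cint_plus, Cint_const, Cint_scal, Cint_RtoC; auto; split; auto; intros.
  - apply ccont_const.
  - apply ccont_mult; auto. apply ccont_const.
Qed.

Lemma pair_RtoC (x y : R) : (x, y) = RtoC x + Ci * RtoC y.
Proof. unfold RtoC, Ci, Cplus, Cmult; simpl; f_equal; ring. Qed.

(** An affine function has a primitive.  Directly: the constant term and the
    terms quadratic in the coordinates cancel between opposite sides, and the
    mixed terms cancel between the two pairs of sides. *)
Lemma rect_int_affine (A l z : C) x1 x2 y1 y2 : (x1 <= x2)%R -> (y1 <= y2)%R ->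
  rect_int (fun w => A + l * (w - z)) x1 x2 y1 y2 = 0.
Proof.
  intros Hx Hy. unfold rect_int.
  assert (Eh : forall y, Cint (fun x => A + l * ((x, y) - z)) x1 x2 =
     Cint (fun x => (A + l * (Ci * RtoC y - z)) + l * RtoC x) x1 x2).
  { intros y. apply Cint_ext; auto. intros t _. rewrite pair_RtoC. ring. }
  assert (Ev : forall x, Cint (fun y => A + l * ((x, y) - z)) y1 y2 =
     Cint (fun y => (A + l * (RtoC x - z)) + (l * Ci) * RtoC y) y1 y2).
  { intros x. apply Cint_ext; auto. intros t _. rewrite pair_RtoC. ring. }
  rewrite !Eh, !Ev, !Cint_affine by auto. rewrite !RtoC_minus. ring.
Qed.

Lemma Ccont_affine (A l z w : C) : Ccont (fun w => A + l * (w - z)) w.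
Proof.
  eapply is_Cderive_cont.
  apply (is_Cderive_plus (fun _ => A) (fun w => l * (w - z))); [apply is_Cderive_const|].
  apply (is_Cderive_mult (fun _ => l) (fun w => w - z)); [apply is_Cderive_const|].
  apply (is_Cderive_minus (fun w => w) (fun _ => z)); [apply is_Cderive_id|apply is_Cderive_const].
Qed.

Lemma Ccont_minus (f g : C -> C) z : Ccont f z -> Ccont g z -> Ccont (fun w => f w - g w) z.
Proof.
  intros Hf Hg eps He.
  destruct (Hf (eps / 2)%R) as [d1 [Hd1 K1]]; [lra|].
  destruct (Hg (eps / 2)%R) as [d2 [Hd2 K2]]; [lra|].
  exists (Rmin d1 d2); split; [now apply Rmin_pos|]. intros w Hw.
  specialize (K1 w (Rlt_le_trans _ _ _ Hw (Rmin_l _ _))).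
  specialize (K2 w (Rlt_le_trans _ _ _ Hw (Rmin_r _ _))).
  replace (f w - g w - (f z - g z)) with ((f w - f z) + - (g w - g z)) by ring.
  eapply Rle_lt_trans; [apply Cmod_triangle|]. rewrite Cmod_opp. lra.
Qed.

Lemma rect_int_minus F G x1 x2 y1 y2 :
  Ccont_rect F x1 x2 y1 y2 -> Ccont_rect G x1 x2 y1 y2 ->
  rect_int (fun w => F w - G w) x1 x2 y1 y2 = rect_int F x1 x2 y1 y2 - rect_int G x1 x2 y1 y2.
Proof.
  intros HF HG. pose proof HF as (H1 & H2 & _). unfold rect_int.
  rewrite !Cint_minus;
    try (eapply Ccont_rect_ver; eauto; lra); try (eapply Ccont_rect_hor; eauto; lra).
  ring.
Qed.

Lemma rect_int_bound G x1 x2 y1 y2 M :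
  Ccont_rect G x1 x2 y1 y2 ->
  (forall x y, (x1 <= x <= x2)%R -> (y1 <= y <= y2)%R -> (Cmod (G (x, y)) <= M)%R) ->
  (Cmod (rect_int G x1 x2 y1 y2) <= 4 * ((x2 - x1) + (y2 - y1)) * M)%R.
Proof.
  intros HG HM. pose proof HG as (H1 & H2 & _). unfold rect_int.
  assert (Bh : forall y, (y1 <= y <= y2)%R -> (Cmod (Cint (fun x => G (x, y)) x1 x2) <= 2 * ((x2 - x1) * M))%R).
  { intros y Hy. apply Cint_bound; [eapply Ccont_rect_hor; eauto; lra|]. intros; apply HM; lra. }
  assert (Bv : forall x, (x1 <= x <= x2)%R -> (Cmod (Ci * Cint (fun y => G (x, y)) y1 y2) <= 2 * ((y2 - y1) * M))%R).
  { intros x Hx. rewrite Cmod_mult, Cmod_Ci, Rmult_1_l.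
    apply Cint_bound; [eapply Ccont_rect_ver; eauto; lra|]. intros; apply HM; lra. }
  pose proof (Bh y1 ltac:(lra)). pose proof (Bh y2 ltac:(lra)).
  pose proof (Bv x1 ltac:(lra)). pose proof (Bv x2 ltac:(lra)).
  revert H H0 H3 H4.
  generalize (Cint (fun x => G (x, y1)) x1 x2) (Cint (fun x => G (x, y2)) x1 x2)
    (Ci * Cint (fun y => G (x1, y)) y1 y2) (Ci * Cint (fun y => G (x2, y)) y1 y2).
  intros p q r s H3 H4 H5 H6. unfold Cminus.
  pose proof (Cmod_triangle (p + s + - q) (- r)) as T1.
  pose proof (Cmod_triangle (p + s) (- q)) as T2.
  pose proof (Cmod_triangle p s) as T3. rewrite !Cmod_opp in *.
  nra.
Qed.

(** Near a point of differentiability [G] is affine up to an error of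
    [eps] times the distance, so the boundary integral of a small rectangle is
    at most [eps] times a constant times the square of its size.  This bound is
    additive under quadrisection, hence it holds for the initial rectangle. *)
Theorem goursat (G : C -> C) (x1 x2 y1 y2 : R) :
  (x1 <= x2)%R -> (y1 <= y2)%R ->
  (forall x y, (x1 <= x <= x2)%R -> (y1 <= y <= y2)%R -> ex_Cderive G (x, y)) ->
  rect_int G x1 x2 y1 y2 = 0.
Proof.
  intros Hx Hy HG.
  set (W := (x2 - x1)%R). set (H := (y2 - y1)%R).
  assert (HW : (0 <= W)%R) by (unfold W; lra). assert (HH : (0 <= H)%R) by (unfold H; lra).
  assert (Hc : Ccont_rect G x1 x2 y1 y2).
  { repeat split; auto. intros; now apply ex_Cderive_cont, HG. }
  set (S2 := (4 * ((W + H) * (W + H)))%R).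
  assert (Main : forall eps, (0 < eps)%R -> (Cmod (rect_int G x1 x2 y1 y2) <= eps * S2)%R).
  { intros eps He.
    assert (Q := quadrisection W H x1 y1 (fun n x y =>
      (Cmod (rect_int G x (x + W / 2 ^ n) y (y + H / 2 ^ n)) <= eps * S2 / (2 ^ n * 2 ^ n))%R) HW HH).
    replace x2 with (x1 + W / 2 ^ 0)%R by (unfold W; simpl; field).
    replace y2 with (y1 + H / 2 ^ 0)%R by (unfold H; simpl; field).
    replace (eps * S2)%R with (eps * S2 / (2 ^ 0 * 2 ^ 0))%R by (simpl; field).
    apply Q; clear Q.
    - intros n x y Hx0 Hx1 Hy0 Hy1 Hq.
      assert (H2n : (0 < 2 ^ n)%R) by (apply pow_lt; lra).
      set (w := (W / 2 ^ S n)%R) in *. set (h := (H / 2 ^ S n)%R) in *.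
      assert (Ew : (W / 2 ^ n = w + w)%R) by (unfold w; simpl; field; lra).
      assert (Eh : (H / 2 ^ n = h + h)%R) by (unfold h; simpl; field; lra).
      assert (0 <= w)%R by (apply Rdiv_le_0_compat; auto; apply pow_lt; lra).
      assert (0 <= h)%R by (apply Rdiv_le_0_compat; auto; apply pow_lt; lra).
      rewrite Ew, Eh in *. unfold W, H in Hx1, Hy1.
      rewrite (rect_int_split_x G x (x + w)); [|eapply Ccont_rect_sub; eauto; lra|lra].
      rewrite (rect_int_split_y G x (x + w) y (y + h)); [|eapply Ccont_rect_sub; eauto; lra|lra].
      rewrite (rect_int_split_y G (x + w) (x + (w + w)) y (y + h)); [|eapply Ccont_rect_sub; eauto; lra|lra].
      pose proof (Hq false false) as q1. pose proof (Hq false true) as q2.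
      pose proof (Hq true false) as q3. pose proof (Hq true true) as q4.
      unfold shift_if in *. rewrite ?Rplus_0_r, ?Rplus_assoc in *.
      replace (eps * S2 / (2 ^ n * 2 ^ n))%R with (4 * (eps * S2 / (2 ^ S n * 2 ^ S n)))%R
        by (simpl; field; lra).
      eapply Rle_trans; [apply Cmod_triangle|].
      eapply Rle_trans; [apply Rplus_le_compat; apply Cmod_triangle|]. lra.
    - intros a b Ha Hb. unfold W, H in Ha, Hb.
      destruct (HG a b) as [l Hl]; [lra|lra|].
      rewrite is_Cderive_eps in Hl. destruct (Hl eps He) as [d [Hd Kd]].
      assert (HN : exists n, ((W + H) / 2 ^ n < d)%R).
      { destruct (pow_lt_1_zero (/ 2)%R) with (y := (d / (W + H + 1))%R) as [N HN].
        - rewrite Rabs_pos_eq; lra.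
        - apply Rdiv_lt_0_compat; lra.
        - exists N. specialize (HN N (le_n N)).
          rewrite pow_inv, Rabs_pos_eq in HN by (left; apply Rinv_0_lt_compat, pow_lt; lra).
          assert (H2n : (0 < / 2 ^ N)%R) by (apply Rinv_0_lt_compat, pow_lt; lra).
          assert (/ 2 ^ N * (W + H + 1) < d)%R.
          { replace d with (d / (W + H + 1) * (W + H + 1))%R at 1 by (field; lra).
            apply Rmult_lt_compat_r; lra. }
          unfold Rdiv. nra. }
      destruct HN as [n Hn]. exists n. intros x y Hx0 Hx1 Hy0 Hy1 Hax Hby.
      assert (H2n : (0 < 2 ^ n)%R) by (apply pow_lt; lra).
      set (w := (W / 2 ^ n)%R) in *. set (h := (H / 2 ^ n)%R) in *.
      replace ((W + H) / 2 ^ n)%R with (w + h)%R in Hn by (unfold w, h; field; lra).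
      unfold W in Hx1. unfold H in Hy1.
      assert (Hs : Ccont_rect G x (x + w) y (y + h)) by (eapply Ccont_rect_sub; eauto; lra).
      assert (Ha' : Ccont_rect (fun u => G (a, b) + l * (u - (a, b))) x (x + w) y (y + h)).
      { destruct Hs as (? & ? & ?); repeat split; auto. intros; apply Ccont_affine. }
      replace (rect_int G x (x + w) y (y + h)) with
        (rect_int (fun u => G u - (G (a, b) + l * (u - (a, b)))) x (x + w) y (y + h)).
      2:{ rewrite rect_int_minus by auto. rewrite rect_int_affine by lra. ring. }
      assert (B := rect_int_bound (fun u => G u - (G (a, b) + l * (u - (a, b))))
         x (x + w) y (y + h) (eps * (w + h))).
      replace (eps * S2 / (2 ^ n * 2 ^ n))%R with
        (4 * ((x + w - x) + (y + h - y)) * (eps * (w + h)))%R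
        by (unfold S2, w, h; field; lra).
      apply B.
      + destruct Hs as (? & ? & ?); repeat split; auto. intros; apply Ccont_minus; auto.
        apply Ccont_affine.
      + intros u v Hu Hv.
        assert (D : (Cmod ((u, v) - (a, b)) <= w + h)%R).
        { eapply Rle_trans; [apply Cmod_le_sum|]. simpl. 
          apply Rplus_le_compat; apply Rabs_le; lra. }
        replace (G (u, v) - (G (a, b) + l * ((u, v) - (a, b)))) with
          (G (u, v) - G (a, b) - l * ((u, v) - (a, b))) by ring.
        eapply Rle_trans; [apply Kd; lra|]. apply Rmult_le_compat_l; lra. }
  apply Cmod_eq_0. pose proof (Cmod_ge_0 (rect_int G x1 x2 y1 y2)) as Hp.
  destruct (Rle_lt_or_eq_dec _ _ Hp) as [Hlt|]; auto.
  exfalso. set (m := Cmod _) in *.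
  assert (0 <= S2)%R by (unfold S2; nra).
  specialize (Main (m / (2 * (S2 + 1)))%R ltac:(apply Rdiv_lt_0_compat; lra)).
  assert (m / (2 * (S2 + 1)) * S2 < m)%R; [|lra].
  replace (m / (2 * (S2 + 1)) * S2)%R with (m * (S2 / (2 * (S2 + 1))))%R by (field; lra).
  assert (S2 / (2 * (S2 + 1)) < 1)%R; [|nra].
  apply Rmult_lt_reg_r with (2 * (S2 + 1))%R; [lra|].
  unfold Rdiv. rewrite Rmult_assoc, Rinv_l by lra. lra.
Qed.

(** * The complex exponential *)

Lemma Cexp_plus (z w : C) : Cexp (z + w) = Cexp z * Cexp w.
Proof.
  unfold Cexp, Cplus, Cmult, Re, Im; simpl. rewrite exp_plus, cos_plus, sin_plus.
  f_equal; ring.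
Qed.

Lemma Cexp_0 : Cexp 0 = 1.
Proof. unfold Cexp, RtoC, Re, Im; simpl. rewrite exp_0, cos_0, sin_0. f_equal; ring. Qed.

Lemma Cmod_Cexp (z : C) : Cmod (Cexp z) = exp (Re z).
Proof.
  unfold Cexp, Cmod; simpl.
  replace (_ + _)%R with (exp (Re z) * exp (Re z))%R.
  - apply sqrt_square. left; apply exp_pos.
  - pose proof (sin2_cos2 (Im z)) as H. unfold Rsqr in H. nra.
Qed.

Lemma Cexp_neq_0 (z : C) : Cexp z <> 0.
Proof. apply Cmod_gt_0. rewrite Cmod_Cexp. apply exp_pos. Qed.

Lemma is_derive_eps_0 (f : R -> R) (l : R) :
  is_derive f 0%R l -> forall eps, (0 < eps)%R -> exists d, (0 < d)%R /\
    forall x, (Rabs x < d)%R -> (Rabs (f x - f 0 - l * x) <= eps * Rabs x)%R.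
Proof.
  intros H eps He. apply is_derive_Reals in H. destruct (H eps He) as [d Hd].
  exists d; split; [apply cond_pos|]. intros x Hx.
  destruct (Req_dec x 0) as [->|Hn].
  - rewrite Rmult_0_r, Rminus_diag, Rminus_diag, Rabs_R0. lra.
  - specialize (Hd x Hn Hx). rewrite Rplus_0_l in Hd.
    replace (f x - f 0 - l * x)%R with (((f x - f 0) / x - l) * x)%R by (field; auto).
    rewrite Rabs_mult. apply Rmult_le_compat_r; [apply Rabs_pos|lra].
Qed.

Lemma is_Cderive_Cexp_0 : is_Cderive Cexp 0 1.
Proof.
  apply is_Cderive_eps. intros eps He.
  set (e := Rmin 1 (eps / 8)). assert (He' : (0 < e)%R) by (apply Rmin_pos; lra).
  destruct (is_derive_eps_0 exp 1%R) with (eps := e) as [d1 [Hd1 K1]]; auto.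
  { auto_derive; auto. rewrite exp_0; ring. }
  destruct (is_derive_eps_0 cos 0%R) with (eps := e) as [d2 [Hd2 K2]]; auto.
  { auto_derive; auto. rewrite sin_0; ring. }
  destruct (is_derive_eps_0 sin 1%R) with (eps := e) as [d3 [Hd3 K3]]; auto.
  { auto_derive; auto. rewrite cos_0; ring. }
  rewrite exp_0 in K1. rewrite cos_0 in K2. rewrite sin_0 in K3.
  exists (Rmin (Rmin d1 d2) (Rmin d3 e)); split; [apply Rmin_pos; apply Rmin_pos; assumption|].
  intros w Hw. rewrite Cexp_0. replace (w - 0) with w in * by ring.
  assert (A1 : (Cmod w < d1)%R) by (eapply Rlt_le_trans; [exact Hw|]; eapply Rle_trans; [apply Rmin_l|apply Rmin_l]).
  assert (A2 : (Cmod w < d2)%R) by (eapply Rlt_le_trans; [exact Hw|]; eapply Rle_trans; [apply Rmin_l|apply Rmin_r]).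
  assert (A3 : (Cmod w < d3)%R) by (eapply Rlt_le_trans; [exact Hw|]; eapply Rle_trans; [apply Rmin_r|apply Rmin_l]).
  assert (A4 : (Cmod w < e)%R) by (eapply Rlt_le_trans; [exact Hw|]; eapply Rle_trans; [apply Rmin_r|apply Rmin_r]).
  pose proof (Cmod_fst w) as Bx. pose proof (Cmod_snd w) as By.
  destruct w as [x y]; simpl in Bx, By. set (m := Cmod (x, y)) in *.
  specialize (K1 x ltac:(lra)). specialize (K2 y ltac:(lra)). specialize (K3 y ltac:(lra)).
  assert (He8 : (e <= eps / 8)%R) by apply Rmin_r. assert (He1 : (e <= 1)%R) by apply Rmin_l.
  eapply Rle_trans; [apply Cmod_le_sum|]. unfold Cexp, Re, Im; simpl.
  replace (exp x * cos y + - (1) + - (1 * x - 0 * y))%R with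
    ((exp x - 1 - 1 * x) * cos y + (1 + x) * (cos y - 1 - 0 * y))%R by ring.
  replace (exp x * sin y + - 0 + - (1 * y + 0 * x))%R with
    ((exp x - 1 - 1 * x + x) * sin y + (sin y - 0 - 1 * y))%R by ring.
  assert (C1 : (Rabs (cos y) <= 1)%R) by (apply Rabs_le, COS_bound).
  assert (X1 : (Rabs (1 + x) <= 2)%R).
  { eapply Rle_trans; [apply Rabs_triang|]. rewrite Rabs_R1. lra. }
  assert (X2 : (Rabs (exp x - 1 - 1 * x + x) <= 2 * e)%R).
  { eapply Rle_trans; [apply Rabs_triang|]. pose proof (Rabs_pos x). nra. }
  assert (S1 : (Rabs (sin y) <= 2 * Rabs y)%R).
  { replace (sin y) with ((sin y - 0 - 1 * y) + y)%R by ring.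
    eapply Rle_trans; [apply Rabs_triang|]. pose proof (Rabs_pos y). nra. }
  pose proof (Rabs_pos x). pose proof (Rabs_pos y).
  assert (T1 : (Rabs ((exp x - 1 - 1 * x) * cos y + (1 + x) * (cos y - 1 - 0 * y)) <= 3 * e * m)%R).
  { eapply Rle_trans; [apply Rabs_triang|]. rewrite !Rabs_mult.
    assert (Rabs (exp x - 1 - 1 * x) * Rabs (cos y) <= (e * m) * 1)%R.
    { apply Rmult_le_compat; try apply Rabs_pos; auto. nra. }
    assert (Rabs (1 + x) * Rabs (cos y - 1 - 0 * y) <= 2 * (e * m))%R.
    { apply Rmult_le_compat; try apply Rabs_pos; auto. nra. }
    lra. }
  assert (T2 : (Rabs ((exp x - 1 - 1 * x + x) * sin y + (sin y - 0 - 1 * y)) <= 5 * e * m)%R).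
  { eapply Rle_trans; [apply Rabs_triang|]. rewrite !Rabs_mult.
    assert (Rabs (exp x - 1 - 1 * x + x) * Rabs (sin y) <= 2 * e * (2 * m))%R.
    { apply Rmult_le_compat; try apply Rabs_pos; auto. lra. }
    nra. }
  pose proof (Cmod_ge_0 (x, y)) as Hm0; fold m in Hm0. nra.
Qed.

(** By the addition formula it suffices to differentiate at 0. *)
Lemma is_Cderive_Cexp (z : C) : is_Cderive Cexp z (Cexp z).
Proof.
  apply is_Cderive_eps. intros eps He.
  pose proof is_Cderive_Cexp_0 as H. rewrite is_Cderive_eps in H.
  assert (Hz : (0 < Cmod (Cexp z))%R) by (rewrite Cmod_Cexp; apply exp_pos).
  destruct (H (eps / Cmod (Cexp z))%R) as [d [Hd K]]; [now apply Rdiv_lt_0_compat|].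
  exists d; split; auto. intros w Hw. specialize (K (w - z)).
  replace (w - z - 0) with (w - z) in K by ring. specialize (K Hw).
  replace w with (z + (w - z)) at 1 by ring. rewrite Cexp_plus.
  rewrite Cexp_0 in K.
  replace (Cexp z * Cexp (w - z) - Cexp z - Cexp z * (w - z)) with
    (Cexp z * (Cexp (w - z) - 1 - 1 * (w - z))) by ring.
  rewrite Cmod_mult.
  replace (eps * Cmod (w - z))%R with (Cmod (Cexp z) * (eps / Cmod (Cexp z) * Cmod (w - z)))%R
    by (field; lra).
  apply Rmult_le_compat_l; [lra|exact K].
Qed.

(** * Means over circles *)

Definition cis (t : R) : C := (cos t, sin t).

Lemma Cmod_cis t : Cmod (cis t) = 1%R.
Proof.
  unfold cis, Cmod; simpl. pose proof (sin2_cos2 t) as H. unfold Rsqr in H.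
  replace (_ + _)%R with 1%R by nra. apply sqrt_1.
Qed.

Lemma cis_neq_0 t : cis t <> 0.
Proof. apply Cmod_gt_0. rewrite Cmod_cis. lra. Qed.

Lemma cis_conj t : Cconj (cis t) = / cis t.
Proof.
  assert (H : cis t * Cconj (cis t) = 1).
  { rewrite <- Cmod2_conj, Cmod_cis. unfold RtoC; f_equal; ring. }
  rewrite <- (Cmult_1_l (/ cis t)), <- H. field. apply cis_neq_0.
Qed.

Lemma ccont_cis t : ccont cis t.
Proof. split; simpl; [apply continuous_cos|apply continuous_sin]. Qed.

Lemma Cmod_circle (r t : R) : (0 <= r)%R -> Cmod (RtoC r * cis t) = r.
Proof. intros Hr. rewrite Cmod_mult, Cmod_cis, Cmod_R, Rabs_pos_eq; lra. Qed.

Lemma ccont_circle (r t : R) : ccont (fun t => RtoC r * cis t) t.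
Proof. apply ccont_mult; [apply ccont_const|apply ccont_cis]. Qed.

Lemma Cexp_circle (u t : R) : Cexp (u, t) = RtoC (exp u) * cis t.
Proof. unfold Cexp, cis, RtoC, Cmult, Re, Im; simpl. f_equal; ring. Qed.

Definition cmean (h : R -> C) : C := RtoC (/ (2 * PI)) * Cint h 0 (2 * PI).

Definition ccurve (h : R -> C) : Prop := forall t, ccont h t.

Lemma ccurve_on h : ccurve h -> ccont_on h 0 (2 * PI).
Proof. intros H; split; auto. pose proof PI_RGT_0. lra. Qed.
#[local] Hint Resolve ccurve_on : core.

Lemma cmean_ext f g : (forall t, f t = g t) -> cmean f = cmean g.
Proof.
  intros H. unfold cmean. f_equal. apply Cint_ext; auto. pose proof PI_RGT_0. lra.
Qed.

Lemma cmean_plus f g : ccurve f -> ccurve g -> cmean (fun t => f t + g t) = cmean f + cmean g.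
Proof. intros. unfold cmean. rewrite Cint_plus by auto. ring. Qed.

Lemma cmean_minus f g : ccurve f -> ccurve g -> cmean (fun t => f t - g t) = cmean f - cmean g.
Proof. intros. unfold cmean. rewrite Cint_minus by auto. ring. Qed.

Lemma cmean_scal c f : ccurve f -> cmean (fun t => c * f t) = c * cmean f.
Proof. intros. unfold cmean. rewrite Cint_scal by auto. ring. Qed.

Lemma cmean_conj f : ccurve f -> cmean (fun t => Cconj (f t)) = Cconj (cmean f).
Proof.
  intros. unfold cmean. rewrite Cint_conj by auto.
  unfold Cconj, Cmult, RtoC; simpl. f_equal; ring.
Qed.

Lemma cmean_const c : cmean (fun _ => c) = c.
Proof.
  unfold cmean. rewrite Cint_const, Rminus_0_r, Cmult_assoc, <- RtoC_mult, Rinv_l, Cmult_1_l; auto.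
  pose proof PI_RGT_0. lra.
Qed.

Lemma cmean_bound f M : ccurve f ->
  (forall t, (0 <= t <= 2 * PI)%R -> (Cmod (f t) <= M)%R) -> (Cmod (cmean f) <= 2 * M)%R.
Proof.
  intros Hf HM. pose proof PI_RGT_0. unfold cmean. rewrite Cmod_mult, Cmod_R.
  assert (0 < / (2 * PI))%R by (apply Rinv_0_lt_compat; lra).
  rewrite Rabs_pos_eq by lra.
  pose proof (Cint_bound f 0 (2 * PI) M (ccurve_on f Hf) HM) as B.
  replace (2 * M)%R with (/ (2 * PI) * (2 * ((2 * PI - 0) * M)))%R by (field; lra).
  apply Rmult_le_compat_l; lra.
Qed.

Lemma ccurve_circle (g : C -> C) (r rho : R) :
  (forall z, (Cmod z < r)%R -> Ccont g z) -> (Rabs rho < r)%R ->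
  ccurve (fun t => g (RtoC rho * cis t)).
Proof.
  intros Hg Hr t. apply (ccont_comp g (fun t => RtoC rho * cis t)); [|apply ccont_circle].
  apply Hg. rewrite Cmod_mult, Cmod_cis, Cmod_R. lra.
Qed.

(** Through the exponential the two circles become vertical segments of length
    [2 * PI], and on the horizontal sides of the rectangle between them the
    composite function takes the same values. *)
Lemma circle_mean_annulus (g : C -> C) (r1 r2 : R) :
  (0 < r1)%R -> (r1 <= r2)%R ->
  (forall z, (r1 <= Cmod z <= r2)%R -> ex_Cderive g z) ->
  cmean (fun t => g (RtoC r1 * cis t)) = cmean (fun t => g (RtoC r2 * cis t)).
Proof.
  intros H1 H12 Hg. pose proof PI_RGT_0 as Hpi.
  assert (Hln : (ln r1 <= ln r2)%R).
  { destruct (Rle_lt_or_eq_dec _ _ H12) as [|<-]; [left; apply ln_increasing; auto|lra]. }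
  assert (HG := goursat (fun w => g (Cexp w)) (ln r1) (ln r2) 0 (2 * PI) Hln ltac:(lra)).
  assert (Hd : forall x y, (ln r1 <= x <= ln r2)%R -> (0 <= y <= 2 * PI)%R ->
    ex_Cderive (fun w => g (Cexp w)) (x, y)).
  { intros x y Hx _. destruct (Hg (Cexp (x, y))) as [l Hl].
    - rewrite Cmod_Cexp. simpl.
      rewrite <- (exp_ln r1), <- (exp_ln r2) by lra.
      split; (destruct (Req_dec x (ln r1)) as [->|]; [|]); try (destruct (Req_dec x (ln r2)) as [->|]);
      try lra; try (left; apply exp_increasing; lra).
      destruct (Rle_lt_or_eq_dec _ _ Hln) as [Hlt|<-]; [left; apply exp_increasing; lra|lra].
    - eexists. apply (is_Cderive_comp g Cexp); [exact Hl|apply is_Cderive_Cexp]. }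
  specialize (HG Hd). unfold rect_int in HG.
  assert (E1 : Cint (fun x => g (Cexp (x, 0%R))) (ln r1) (ln r2) =
    Cint (fun x => g (Cexp (x, (2 * PI)%R))) (ln r1) (ln r2)).
  { apply Cint_ext; auto. intros t _. rewrite !Cexp_circle. unfold cis.
    now rewrite cos_2PI, sin_2PI, cos_0, sin_0. }
  rewrite E1 in HG.
  assert (E2 : forall r, (0 < r)%R -> Cint (fun y => g (Cexp (ln r, y))) 0 (2 * PI) =
     Cint (fun t => g (RtoC r * cis t)) 0 (2 * PI)).
  { intros r Hr. apply Cint_ext; [lra|]. intros t _. now rewrite Cexp_circle, exp_ln. }
  rewrite !E2 in HG by lra. unfold cmean. f_equal.
  set (A := Cint _ _ _) in HG. set (B := Cint (fun t => g (RtoC r2 * cis t)) _ _) in *.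
  set (D := Cint (fun t => g (RtoC r1 * cis t)) _ _) in *.
  assert (HBD : Ci * (B - D) = 0) by (rewrite <- HG; ring).
  assert (HCi : Ci <> 0) by (apply Cmod_gt_0; rewrite Cmod_Ci; lra).
  replace D with (B - Ci * (B - D) / Ci) by (field; auto). rewrite HBD. field. auto.
Qed.

Lemma circle_continuity_2d (g : C -> C) (rho t : R) :
  Ccont g (RtoC rho * cis t) ->
  continuity_2d_pt (fun u v => fst (g (RtoC v * cis u))) t rho /\
  continuity_2d_pt (fun u v => snd (g (RtoC v * cis u))) t rho.
Proof.
  intros Hg.
  assert (H : forall eps : posreal,
    locally_2d (fun u v => (Cmod (g (RtoC v * cis u)%C - g (RtoC rho * cis t)%C) < eps)%R) t rho).
  { intros [eps He]. destruct (Hg eps He) as [d [Hd K]].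
    assert (Hc : continuity_2d_pt (fun u v => v * cos u)%R t rho).
    { apply (continuity_2d_pt_mult (fun u v => v) (fun u v => cos u)); [apply continuity_2d_pt_id2|].
      apply continuity_1d_2d_pt_comp; [apply continuity_cos|apply continuity_2d_pt_id1]. }
    assert (Hs : continuity_2d_pt (fun u v => v * sin u)%R t rho).
    { apply (continuity_2d_pt_mult (fun u v => v) (fun u v => sin u)); [apply continuity_2d_pt_id2|].
      apply continuity_1d_2d_pt_comp; [apply continuity_sin|apply continuity_2d_pt_id1]. }
    assert (Hd2 : (0 < d / 2)%R) by lra.
    generalize (locally_2d_and _ _ _ _ (Hc (mkposreal _ Hd2)) (Hs (mkposreal _ Hd2))).
    apply locally_2d_impl, locally_2d_forall. simpl.
    intros u v [Hu Hv]. apply K. eapply Rle_lt_trans; [apply Cmod_le_sum|].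
    simpl. unfold Rminus in *.
    replace (v * cos u + - (0 * sin u) + - (rho * cos t + - (0 * sin t)))%R with (v * cos u + - (rho * cos t))%R by ring.
    replace (v * sin u + 0 * cos u + - (rho * sin t + 0 * cos t))%R with (v * sin u + - (rho * sin t))%R by ring.
    lra. }
  split; intros eps; generalize (H eps); apply locally_2d_impl, locally_2d_forall; intros u v Huv;
    (eapply Rle_lt_trans; [|exact Huv]).
  - apply (Cmod_fst (_ - _)).
  - apply (Cmod_snd (_ - _)).
Qed.

(** Uniform continuity of [g] near the circle of radius [rho]. *)
Lemma circle_mean_continuous (g : C -> C) (r rho : R) :
  (forall z, (Cmod z < r)%R -> Ccont g z) -> (Rabs rho < r)%R ->
  forall eps, (0 < eps)%R -> exists d, (0 < d)%R /\ forall rho', (Rabs (rho' - rho) < d)%R ->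
    (Cmod (cmean (fun t => g (RtoC rho' * cis t)%C) - cmean (fun t => g (RtoC rho * cis t)%C)) < eps)%R.
Proof.
  intros Hg Hr eps He.
  assert (Hc : forall t, Ccont g (RtoC rho * cis t)).
  { intros t. apply Hg. rewrite Cmod_mult, Cmod_cis, Cmod_R. lra. }
  assert (He8 : (0 < eps / 8)%R) by lra.
  destruct (uniform_continuity_2d_1d (fun u v => fst (g (RtoC v * cis u))) 0 (2 * PI) rho
     (fun t _ => proj1 (circle_continuity_2d g rho t (Hc t))) (mkposreal _ He8)) as [[d1 Hd1] K1].
  destruct (uniform_continuity_2d_1d (fun u v => snd (g (RtoC v * cis u))) 0 (2 * PI) rho
     (fun t _ => proj2 (circle_continuity_2d g rho t (Hc t))) (mkposreal _ He8)) as [[d2 Hd2] K2].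
  simpl in K1, K2.
  exists (Rmin (Rmin d1 d2) (r - Rabs rho)); split.
  { repeat apply Rmin_pos; auto. lra. }
  intros rho' Hr'.
  assert (L1 : (Rabs (rho' - rho) < d1)%R) by (eapply Rlt_le_trans; [exact Hr'|]; eapply Rle_trans; [apply Rmin_l|apply Rmin_l]).
  assert (L2 : (Rabs (rho' - rho) < d2)%R) by (eapply Rlt_le_trans; [exact Hr'|]; eapply Rle_trans; [apply Rmin_l|apply Rmin_r]).
  assert (L3 : (Rabs (rho' - rho) < r - Rabs rho)%R) by (eapply Rlt_le_trans; [exact Hr'|apply Rmin_r]).
  assert (Hr2 : (Rabs rho' < r)%R).
  { replace rho' with ((rho' - rho) + rho)%R by ring. eapply Rle_lt_trans; [apply Rabs_triang|]. lra. }
  apply Rabs_def2 in L1. apply Rabs_def2 in L2.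
  unfold cmean.
  replace (RtoC (/ (2 * PI)) * Cint (fun t => g (RtoC rho' * cis t)) 0 (2 * PI) -
     RtoC (/ (2 * PI)) * Cint (fun t => g (RtoC rho * cis t)) 0 (2 * PI)) with
    (RtoC (/ (2 * PI)) * Cint (fun t => g (RtoC rho' * cis t) - g (RtoC rho * cis t)) 0 (2 * PI)).
  2:{ rewrite Cint_minus by (apply ccurve_on; eapply ccurve_circle; eauto). ring. }
  pose proof PI_RGT_0. rewrite Cmod_mult, Cmod_R.
  assert (0 < / (2 * PI))%R by (apply Rinv_0_lt_compat; lra).
  rewrite Rabs_pos_eq by lra.
  assert (B : (Cmod (Cint (fun t => g (RtoC rho' * cis t) - g (RtoC rho * cis t))%C 0 (2 * PI)) <=
     2 * ((2 * PI - 0) * (eps / 4)))%R).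
  { apply Cint_bound.
    - apply ccurve_on. intros t. apply ccont_minus; eapply ccurve_circle; eauto.
    - intros t Ht. eapply Rle_trans; [apply Cmod_le_sum|].
      specialize (K1 t rho t rho' Ht ltac:(lra) Ht ltac:(lra) ltac:(rewrite Rminus_diag, Rabs_R0; lra)).
      specialize (K2 t rho t rho' Ht ltac:(lra) Ht ltac:(lra) ltac:(rewrite Rminus_diag, Rabs_R0; lra)).
      simpl. unfold Rminus in *. lra. }
  eapply Rle_lt_trans; [apply Rmult_le_compat_l; [lra|exact B]|].
  replace (/ (2 * PI) * (2 * ((2 * PI - 0) * (eps / 4))))%R with (eps / 2)%R by (field; lra). lra.
Qed.

(** The mean is constant on every interval of radii that avoids [alpha], by
    [circle_mean_annulus], and it is continuous, so it equals its value at
    radius 0.  The exceptional circle allows the removable singularity in the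
    proof of [cauchy_formula]. *)
Theorem circle_mean (g : C -> C) (r alpha : R) :
  (forall z, (Cmod z < r)%R -> Ccont g z) ->
  (forall z, (0 < Cmod z < r)%R -> Cmod z <> alpha -> ex_Cderive g z) ->
  forall rho, (0 <= rho < r)%R -> cmean (fun t => g (RtoC rho * cis t)) = g 0.
Proof.
  intros Hc Hd rho Hrho.
  set (M := fun rho => cmean (fun t => g (RtoC rho * cis t))).
  assert (HC : forall c, (0 <= c < r)%R -> forall eps, (0 < eps)%R -> exists d, (0 < d)%R /\
    forall c', (Rabs (c' - c) < d)%R -> (Cmod (M c' - M c) < eps)%R).
  { intros c Hcr. apply (circle_mean_continuous g r); auto. rewrite Rabs_pos_eq; lra. }
  assert (HA : forall c1 c2, (0 < c1)%R -> (c1 <= c2)%R -> (c2 < r)%R -> (alpha < c1 \/ c2 < alpha)%R -> M c1 = M c2).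
  { intros c1 c2 ? ? ? ?. apply circle_mean_annulus; auto. intros z Hz. apply Hd; lra. }
  assert (Heq : forall a b : C, (forall eps, (0 < eps)%R -> (Cmod (a - b) < eps)%R) -> a = b).
  { intros a b H. destruct (Req_dec (Cmod (a - b)) 0) as [E|E].
    - apply Cmod_eq_0 in E. replace a with ((a - b) + b) by ring. rewrite E. ring.
    - pose proof (Cmod_ge_0 (a - b)). specialize (H (Cmod (a - b)) ltac:(lra)). lra. }
  (* An interval of radii on which the mean is constant may be closed on the
     left, by continuity, even if its left end is exceptional. *)
  assert (HR : forall c1 c2, (0 <= c1)%R -> (c1 <= c2)%R -> (c2 < r)%R -> (alpha <= c1 \/ c2 < alpha)%R -> M c1 = M c2).
  { intros c1 c2 H1 H2 H3 H4. apply Heq. intros eps He.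
    destruct (HC c1 ltac:(lra) eps He) as [d [Hd0 K]].
    destruct (Req_dec c1 c2) as [<-|Hn]; [replace (M c1 - M c1) with (RtoC 0) by ring; now rewrite Cmod_0|].
    set (c' := Rmin c2 (c1 + d / 2)).
    assert (c' <= c2)%R by apply Rmin_l. assert (c' <= c1 + d / 2)%R by apply Rmin_r.
    assert (c1 < c')%R by (apply Rmin_glb_lt; lra).
    rewrite <- (HA c' c2) by lra. rewrite Cmod_sub_sym. apply K. apply Rabs_def1; lra. }
  (* It may be closed on the right likewise. *)
  assert (HL : forall c1 c2, (0 < c1)%R -> (c1 <= c2)%R -> (c2 < r)%R -> (alpha < c1 \/ c2 <= alpha)%R -> M c1 = M c2).
  { intros c1 c2 H1 H2 H3 H4. apply Heq. intros eps He.
    destruct (HC c2 ltac:(lra) eps He) as [d [Hd0 K]].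
    destruct (Req_dec c1 c2) as [<-|Hn]; [replace (M c1 - M c1) with (RtoC 0) by ring; now rewrite Cmod_0|].
    set (c' := Rmax c1 (c2 - d / 2)).
    assert (c1 <= c')%R by apply Rmax_l. assert (c2 - d / 2 <= c')%R by apply Rmax_r.
    assert (c' < c2)%R by (apply Rmax_lub_lt; lra).
    rewrite (HA c1 c') by lra. apply K. apply Rabs_def1; lra. }
  fold (M rho). transitivity (M 0%R).
  2:{ unfold M. erewrite cmean_ext; [apply cmean_const|]. intros t. now replace (RtoC 0 * cis t) with (RtoC 0) by ring. }
  symmetry. destruct (Rle_lt_dec alpha 0) as [Ha|Ha]; [apply HR; lra|].
  destruct (Rlt_le_dec rho alpha) as [Hb|Hb]; [apply HR; lra|].
  transitivity (M (alpha / 2)%R); [apply HR; lra|].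
  transitivity (M alpha); [apply HL; lra|apply HR; lra].
Qed.

(** * Cauchy's formula *)

(** Differentiability at 0 is left out so that quotients such as [f z / z] are
    covered as soon as they extend continuously; it follows by [holo_derive]. *)
Definition holo_off_0 (r : R) (f : C -> C) : Prop :=
  (forall z, (Cmod z < r)%R -> Ccont f z) /\
  (forall z, (Cmod z < r)%R -> z <> 0 -> ex_Cderive f z).

Lemma is_Cderive_ext_loc (f g : C -> C) (z l : C) (d : R) : (0 < d)%R ->
  (forall w, (Cmod (w - z) < d)%R -> f w = g w) -> is_Cderive f z l -> is_Cderive g z l.
Proof.
  intros Hd E H. rewrite is_Cderive_eps in *. intros eps He.
  destruct (H eps He) as [d' [Hd' K]].
  exists (Rmin d d'); split; [now apply Rmin_pos|]. intros w Hw.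
  rewrite <- !E.
  - apply K. eapply Rlt_le_trans; [exact Hw|apply Rmin_r].
  - replace (z - z) with (RtoC 0) by ring. now rewrite Cmod_0.
  - eapply Rlt_le_trans; [exact Hw|apply Rmin_l].
Qed.

Lemma Ccont_ext_loc (f g : C -> C) (z : C) (d : R) : (0 < d)%R ->
  (forall w, (Cmod (w - z) < d)%R -> f w = g w) -> Ccont f z -> Ccont g z.
Proof.
  intros Hd E H eps He. destruct (H eps He) as [d' [Hd' K]].
  exists (Rmin d d'); split; [now apply Rmin_pos|]. intros w Hw.
  rewrite <- !E.
  - apply K. eapply Rlt_le_trans; [exact Hw|apply Rmin_r].
  - replace (z - z) with (RtoC 0) by ring. now rewrite Cmod_0.
  - eapply Rlt_le_trans; [exact Hw|apply Rmin_l].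
Qed.

Lemma Ccont_mult (f g : C -> C) (z : C) : Ccont f z -> Ccont g z -> Ccont (fun w => f w * g w) z.
Proof.
  intros Hf Hg eps He.
  pose proof (Cmod_ge_0 (f z)). pose proof (Cmod_ge_0 (g z)).
  set (K := (Cmod (f z) + Cmod (g z) + 1)%R). assert (0 < K)%R by (unfold K; lra).
  assert (He2 : (0 < Rmin 1 (eps / K))%R) by (apply Rmin_pos; [lra|apply Rdiv_lt_0_compat; auto]).
  destruct (Hf _ He2) as [d1 [Hd1 K1]]. destruct (Hg _ He2) as [d2 [Hd2 K2]].
  exists (Rmin d1 d2); split; [now apply Rmin_pos|]. intros w Hw.
  specialize (K1 w (Rlt_le_trans _ _ _ Hw (Rmin_l _ _))).
  specialize (K2 w (Rlt_le_trans _ _ _ Hw (Rmin_r _ _))).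
  set (e := Rmin 1 (eps / K)) in *.
  assert (He1 : (e <= 1)%R) by apply Rmin_l.
  assert (HeK : (e * K <= eps)%R).
  { replace eps with (eps / K * K)%R by (field; lra). apply Rmult_le_compat_r; [lra|apply Rmin_r]. }
  replace (f w * g w - f z * g z) with
    ((f w - f z) * (g w - g z) + ((f w - f z) * g z + f z * (g w - g z))) by ring.
  eapply Rle_lt_trans; [apply Cmod_triangle|].
  eapply Rle_lt_trans; [apply Rplus_le_compat_l, Cmod_triangle|]. rewrite !Cmod_mult.
  pose proof (Cmod_ge_0 (f w - f z)). pose proof (Cmod_ge_0 (g w - g z)).
  unfold K in HeK. nra.
Qed.

Lemma Ccont_comp (f g : C -> C) (z : C) : Ccont f (g z) -> Ccont g z -> Ccont (fun w => f (g w)) z.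
Proof.
  intros Hf Hg eps He. destruct (Hf eps He) as [d [Hd K]]. destruct (Hg d Hd) as [d' [Hd' K']].
  exists d'; split; auto.
Qed.

Lemma Ccont_const (c z : C) : Ccont (fun _ => c) z.
Proof. eapply is_Cderive_cont, is_Cderive_const. Qed.

Lemma Ccont_id (z : C) : Ccont (fun w => w) z.
Proof. eapply is_Cderive_cont, is_Cderive_id. Qed.

Lemma Ccont_div (f g : C -> C) (z : C) : g z <> 0 -> Ccont f z -> Ccont g z ->
  Ccont (fun w => f w / g w) z.
Proof.
  intros H0 Hf Hg. apply Ccont_mult; auto. apply Ccont_comp; auto.
  eapply is_Cderive_cont, is_Cderive_Cinv, H0.
Qed.

Lemma circle_sub_neq_0 (rho t : R) (z : C) : (0 < rho)%R -> (Cmod z < rho)%R -> RtoC rho * cis t - z <> 0.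
Proof.
  intros Hr Hz E.
  assert (Ez : z = RtoC rho * cis t) by (replace z with (RtoC rho * cis t - (RtoC rho * cis t - z)) by ring; rewrite E; ring).
  rewrite Ez, Cmod_circle in Hz; lra.
Qed.

(** The kernel is the complex conjugate of [1 / (1 - c * u)] at a point [u] of
    the unit circle, [c] being the conjugate of [z / rho], and this function is
    holomorphic on a larger disk. *)
Lemma cauchy_kernel_mean (rho : R) (z : C) : (0 < rho)%R -> (Cmod z < rho)%R ->
  cmean (fun t => RtoC rho * cis t / (RtoC rho * cis t - z)) = 1.
Proof.
  intros Hr Hz.
  (* [q] is the modulus of [c], and [1 < r' < / q]. *)
  set (q := (Cmod z / rho)%R).
  assert (Hq0 : (0 <= q)%R) by (apply Rdiv_le_0_compat; auto; apply Cmod_ge_0).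
  assert (Hq1 : (q < 1)%R).
  { apply Rmult_lt_reg_r with rho; auto. unfold q, Rdiv. rewrite Rmult_assoc, Rinv_l; lra. }
  set (r' := (2 / (1 + q))%R).
  assert (Hr' : (1 < r')%R).
  { apply Rmult_lt_reg_r with (1 + q)%R; [lra|]. unfold r', Rdiv. rewrite Rmult_assoc, Rinv_l; lra. }
  assert (Hqr : (q * r' < 1)%R).
  { apply Rmult_lt_reg_r with (1 + q)%R; [lra|]. unfold r'.
    replace (q * (2 / (1 + q)) * (1 + q))%R with (2 * q)%R by (field; lra). lra. }
  set (c := Cconj z / RtoC rho).
  assert (Hrho0 : RtoC rho <> 0) by (intros E; apply RtoC_inj in E; lra).
  assert (Hc : Cmod c = q).
  { unfold c, q. rewrite Cmod_div, Cmod_conj, Cmod_R, Rabs_pos_eq; auto. lra. }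
  assert (Hne : forall u, (Cmod u < r')%R -> 1 - c * u <> 0).
  { intros u Hu E.
    assert (Cmod (c * u) = 1)%R by (replace (c * u) with (1 - (1 - c * u)) by ring; rewrite E;
      replace (1 - 0) with (RtoC 1) by ring; apply Cmod_1).
    rewrite Cmod_mult, Hc in H. pose proof (Cmod_ge_0 u). nra. }
  assert (Hd : forall u, (Cmod u < r')%R -> is_Cderive (fun u => / (1 - c * u)) u
     (- (0 - (0 * u + c * 1)) / ((1 - c * u) * (1 - c * u)))).
  { intros u Hu. apply (is_Cderive_inv (fun u => 1 - c * u)); auto.
    apply (is_Cderive_minus (fun _ => 1) (fun u => c * u)); [apply is_Cderive_const|].
    apply (is_Cderive_mult (fun _ => c) (fun u => u)); [apply is_Cderive_const|apply is_Cderive_id]. }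
  assert (HM := circle_mean (fun u => / (1 - c * u)) r' 0
    (fun u Hu => is_Cderive_cont _ _ _ (Hd u Hu))
    (fun u Hu _ => ex_intro _ _ (Hd u (proj2 Hu))) 1%R ltac:(lra)).
  cbv beta in HM.
  replace (/ (1 - c * 0)) with (RtoC 1) in HM by (field; replace (1 - c * 0) with (RtoC 1) by ring;
    intros E; apply RtoC_inj in E; lra).
  replace (RtoC 1) with (Cconj (RtoC 1)) by (unfold Cconj, RtoC; simpl; f_equal; ring).
  rewrite <- HM, <- cmean_conj.
  2:{ apply (ccurve_circle (fun u => / (1 - c * u)) r'); [|rewrite Rabs_R1; lra].
      intros u Hu. eapply is_Cderive_cont; eauto. }
  apply cmean_ext. intros t.
  assert (Hcis := cis_neq_0 t).
  assert (Hn := circle_sub_neq_0 rho t z Hr Hz).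
  assert (Hn2 : 1 - c * (1 * cis t) <> 0).
  { apply Hne. rewrite Cmult_1_l, Cmod_cis. lra. }
  rewrite Cinv_conj by auto. rewrite Cminus_conj, !Cmult_conj, cis_conj.
  unfold c. unfold Cdiv at 2. rewrite Cmult_conj, Cinv_conj, Cconj_conj by auto.
  replace (Cconj (RtoC rho)) with (RtoC rho) by (unfold Cconj, RtoC; simpl; f_equal; ring).
  replace (Cconj 1) with (RtoC 1) by (unfold Cconj, RtoC; simpl; f_equal; ring).
  field. repeat split; auto.
Qed.

(** The function [u * (f u - f z) / (u - z)], extended continuously to [u = z],
    is differentiable off the circle through [z] and vanishes at 0, so its
    circle means are 0. *)
Lemma cauchy_formula (r rho : R) (f : C -> C) (z : C) :
  holo_off_0 r f -> (0 < rho < r)%R -> (Cmod z < rho)%R ->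
  cmean (fun t => f (RtoC rho * cis t) * (RtoC rho * cis t / (RtoC rho * cis t - z))) = f z.
Proof.
  intros [Hc Hd] Hrho Hz.
  destruct (classic (z = 0)) as [->|Hz0].
  { rewrite <- (circle_mean f r 0 Hc) with (rho := rho); [|intros u Hu _; apply Hd; [lra|]|lra].
    - apply cmean_ext. intros t.
      replace (RtoC rho * cis t - 0) with (RtoC rho * cis t) by ring.
      unfold Cdiv. rewrite Cinv_r; [ring|]. apply Cmod_gt_0; rewrite Cmod_circle; lra.
    - apply Cmod_gt_0; lra. }
  destruct (Hd z ltac:(lra) Hz0) as [l Hl].
  (* [l] is the derivative of [f] at [z]. *)
  set (g := fun u => if Req_EM_T (Cmod (u - z)) 0 then z * l else u * (f u - f z) / (u - z)).
  assert (g_ne : forall u, u <> z -> g u = u * (f u - f z) / (u - z)).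
  { intros u Hu. unfold g. destruct (Req_EM_T _ _) as [E|]; auto. exfalso; apply Hu.
    apply Cmod_eq_0 in E. replace u with ((u - z) + z) by ring. rewrite E; ring. }
  assert (g_z : g z = z * l).
  { unfold g. destruct (Req_EM_T _ _) as [E|E]; auto. exfalso; apply E.
    replace (z - z) with (RtoC 0) by ring. apply Cmod_0. }
  assert (near : forall u, u <> z -> forall w, (Cmod (w - u) < Cmod (u - z))%R ->
     w * (f w - f z) / (w - z) = g w).
  { intros u Hu w Hw. symmetry; apply g_ne. intros ->. rewrite Cmod_sub_sym in Hw. lra. }
  assert (sub0 : forall u, u <> z -> u - z <> 0).
  { intros u Hu E. apply Hu. replace u with ((u - z) + z) by ring. rewrite E; ring. }
  assert (gc : forall u, (Cmod u < r)%R -> Ccont g u).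
  { intros u Hu. destruct (classic (u = z)) as [->|Hne].
    - intros eps He. rewrite g_z.
      pose proof (Cmod_ge_0 l). pose proof (Cmod_ge_0 z).
      set (K := (Cmod z + Cmod l + 2)%R). assert (0 < K)%R by (unfold K; lra).
      set (e := Rmin 1 (eps / K)).
      assert (He' : (0 < e)%R) by (apply Rmin_pos; [lra|now apply Rdiv_lt_0_compat]).
      rewrite is_Cderive_eps in Hl. destruct (Hl e He') as [d [Hd0 Kd]].
      exists (Rmin d e); split; [now apply Rmin_pos|]. intros w Hw.
      specialize (Kd w (Rlt_le_trans _ _ _ Hw (Rmin_l _ _))).
      assert (Hwe := Rlt_le_trans _ _ _ Hw (Rmin_r _ _)).
      destruct (classic (w = z)) as [->|Hwz].
      { rewrite g_z. replace (z * l - z * l) with (RtoC 0) by ring. now rewrite Cmod_0. }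
      rewrite g_ne by auto.
      assert (Hm : (0 < Cmod (w - z))%R) by (apply Cmod_gt_0, sub0, Hwz).
      set (q := (f w - f z - l * (w - z)) / (w - z)).
      assert (Hq : (Cmod q <= e)%R).
      { unfold q. rewrite Cmod_div by now apply sub0.
        apply Rmult_le_reg_r with (Cmod (w - z)); auto.
        unfold Rdiv. rewrite Rmult_assoc, Rinv_l, Rmult_1_r by lra. exact Kd. }
      replace (w * (f w - f z) / (w - z) - z * l) with ((w - z) * l + ((w - z) * q + z * q))
        by (unfold q; field; now apply sub0).
      eapply Rle_lt_trans; [apply Cmod_triangle|].
      eapply Rle_lt_trans; [apply Rplus_le_compat_l, Cmod_triangle|]. rewrite !Cmod_mult.
      assert (He1 : (e <= 1)%R) by apply Rmin_l.
      assert (HeK : (e * K <= eps)%R).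
      { replace eps with (eps / K * K)%R by (field; lra). apply Rmult_le_compat_r; [lra|apply Rmin_r]. }
      unfold K in HeK. pose proof (Cmod_ge_0 q). nra.
    - apply (Ccont_ext_loc (fun w => w * (f w - f z) / (w - z)) g u (Cmod (u - z))).
      + apply Cmod_gt_0, sub0, Hne.
      + now apply near.
      + apply Ccont_div; [now apply sub0| |].
        * apply Ccont_mult; [apply Ccont_id|]. apply Ccont_minus; auto. apply Ccont_const.
        * apply Ccont_minus; [apply Ccont_id|apply Ccont_const]. }
  assert (gd : forall u, (0 < Cmod u < r)%R -> Cmod u <> Cmod z -> ex_Cderive g u).
  { intros u Hu Hne'. assert (Hne : u <> z) by (intros ->; auto).
    destruct (Hd u ltac:(lra)) as [lu Hlu]; [apply Cmod_gt_0; lra|].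
    eexists. eapply (is_Cderive_ext_loc (fun w => w * (f w - f z) / (w - z)) g u _ (Cmod (u - z))).
    + apply Cmod_gt_0, sub0, Hne.
    + now apply near.
    + apply (is_Cderive_div (fun w => w * (f w - f z)) (fun w => w - z)); [now apply sub0| |].
      * apply (is_Cderive_mult (fun w => w) (fun w => f w - f z)); [apply is_Cderive_id|].
        apply (is_Cderive_minus f (fun _ => f z)); [exact Hlu|apply is_Cderive_const].
      * apply (is_Cderive_minus (fun w => w) (fun _ => z)); [apply is_Cderive_id|apply is_Cderive_const]. }
  assert (HM := circle_mean g r (Cmod z) gc gd rho ltac:(lra)).
  rewrite (g_ne 0) in HM by auto.
  replace (0 * (f 0 - f z) / (0 - z)) with (RtoC 0) in HM by (unfold Cdiv; ring).
  assert (K1 : ccurve (fun t => g (RtoC rho * cis t))).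
  { apply (ccurve_circle g r); auto. rewrite Rabs_pos_eq; lra. }
  assert (K2 : ccurve (fun t => RtoC rho * cis t / (RtoC rho * cis t - z))).
  { intros t. apply ccont_div; [apply circle_sub_neq_0; lra|apply ccont_circle|].
    apply ccont_minus; [apply ccont_circle|apply ccont_const]. }
  rewrite (cmean_ext _ (fun t => g (RtoC rho * cis t) + f z * (RtoC rho * cis t / (RtoC rho * cis t - z)))).
  - rewrite cmean_plus; [|exact K1|intros t; apply ccont_mult; [apply ccont_const|apply K2]].
    rewrite cmean_scal, cauchy_kernel_mean, HM by (auto; lra). ring.
  - intros t. rewrite g_ne; [field; apply circle_sub_neq_0; lra|].
    intros E. apply (circle_sub_neq_0 rho t z); [lra|lra|]. rewrite E. ring.
Qed.

(** * Cauchy transforms and the second derivative *)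

Lemma ccurve_bounded (phi : R -> C) : ccurve phi ->
  exists M, (0 <= M)%R /\ forall t, (0 <= t <= 2 * PI)%R -> (Cmod (phi t) <= M)%R.
Proof.
  intros H. pose proof PI_RGT_0.
  destruct (continuity_ab_maj (fun t => Cmod (phi t)) 0 (2 * PI)) as [x [Hx _]]; [lra| |].
  - intros t _. apply continuity_pt_filterlim. apply continuous_eps. intros eps He.
    destruct (proj1 (ccont_eps phi t) (H t) eps He) as [d [Hd K]].
    exists d; split; auto. intros s Hs. eapply Rle_lt_trans; [|apply (K s Hs)].
    apply Rabs_le. pose proof (Cmod_sub_ge (phi s) (phi t)). pose proof (Cmod_sub_ge (phi t) (phi s)).
    rewrite (Cmod_sub_sym (phi t)) in H2. lra.
  - exists (Cmod (phi x)); split; auto. apply Cmod_ge_0.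
Qed.

(** Differentiation under the integral sign; a quadratic bound on the
    remainder, uniform on the circle, replaces a domination argument. *)
Lemma is_Cderive_cmean (K : C -> R -> C) (K' : R -> C) (z : C) (d B : R) :
  (0 < d)%R -> (forall w, (Cmod (w - z) < d)%R -> ccurve (K w)) -> ccurve K' ->
  (forall w t, (Cmod (w - z) < d)%R -> (0 <= t <= 2 * PI)%R ->
     (Cmod (K w t - K z t - (w - z) * K' t) <= B * (Cmod (w - z) * Cmod (w - z)))%R) ->
  is_Cderive (fun w => cmean (K w)) z (cmean K').
Proof.
  intros Hd HK HK' HB. apply is_Cderive_eps. intros eps He.
  set (B' := (2 * Rabs B + 1)%R). pose proof (Rabs_pos B). assert (HB' : (0 < B')%R) by (unfold B'; lra).
  exists (Rmin d (eps / B')); split; [apply Rmin_pos; auto; now apply Rdiv_lt_0_compat|].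
  intros w Hw. assert (Hwd := Rlt_le_trans _ _ _ Hw (Rmin_l _ _)).
  assert (Hwe := Rlt_le_trans _ _ _ Hw (Rmin_r _ _)).
  assert (Cz : ccurve (K z)).
  { apply HK. replace (z - z) with (RtoC 0) by ring. now rewrite Cmod_0. }
  assert (Cw := HK w Hwd).
  replace (cmean (K w) - cmean (K z) - cmean K' * (w - z)) with
    (cmean (fun t => K w t - K z t - (w - z) * K' t)).
  2:{ rewrite cmean_minus, cmean_minus, cmean_scal; auto; [ring| |];
      intros t; [apply ccont_minus|apply ccont_mult]; auto. apply ccont_const. }
  pose proof (Cmod_ge_0 (w - z)) as Hm. set (m := Cmod (w - z)) in *.
  eapply Rle_trans.
  - apply (cmean_bound _ (B * (m * m))).
    + intros t. apply ccont_minus; [apply ccont_minus; auto|]. apply ccont_mult; auto. apply ccont_const.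
    + intros t Ht. now apply HB.
  - assert (m * B' <= eps)%R.
    { replace eps with (eps / B' * B')%R by (field; lra). apply Rmult_le_compat_r; lra. }
    unfold B' in *. pose proof (Rle_abs B). nra.
Qed.

Definition cauchy_transform (rho : R) (phi : R -> C) (z : C) : C :=
  cmean (fun t => phi t / (RtoC rho * cis t - z)).

(** The derivative of [cauchy_transform rho phi]. *)
Definition cauchy_transform2 (rho : R) (phi : R -> C) (z : C) : C :=
  cmean (fun t => phi t / ((RtoC rho * cis t - z) * (RtoC rho * cis t - z))).

Lemma ccont_circle_sub (rho : R) (z : C) t : ccont (fun t => RtoC rho * cis t - z) t.
Proof. apply ccont_minus; [apply ccont_circle|apply ccont_const]. Qed.

Lemma ccurve_cauchy_transform (rho : R) (phi : R -> C) (z : C) :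
  (0 < rho)%R -> (Cmod z < rho)%R -> ccurve phi -> ccurve (fun t => phi t / (RtoC rho * cis t - z)).
Proof.
  intros Hr Hz Hp t. apply ccont_div; auto; [now apply circle_sub_neq_0|apply ccont_circle_sub].
Qed.

Lemma ccurve_cauchy_transform2 (rho : R) (phi : R -> C) (z : C) :
  (0 < rho)%R -> (Cmod z < rho)%R -> ccurve phi ->
  ccurve (fun t => phi t / ((RtoC rho * cis t - z) * (RtoC rho * cis t - z))).
Proof.
  intros Hr Hz Hp t. apply ccont_div; auto.
  - apply Cmult_neq_0; now apply circle_sub_neq_0.
  - apply ccont_mult; apply ccont_circle_sub.
Qed.

Lemma Cmod_div_le (a b : C) (M m : R) : (0 < m)%R -> (Cmod a <= M)%R -> (m <= Cmod b)%R ->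
  (Cmod (a / b) <= M / m)%R.
Proof.
  intros Hm Ha Hb. rewrite Cmod_div by (apply Cmod_gt_0; lra).
  pose proof (Cmod_ge_0 a).
  unfold Rdiv. apply Rmult_le_compat; auto.
  - left; apply Rinv_0_lt_compat; lra.
  - apply Rinv_le_contravar; lra.
Qed.

Lemma circle_sub_ge (rho t : R) (z : C) : (0 < rho)%R -> (rho - Cmod z <= Cmod (RtoC rho * cis t - z))%R.
Proof.
  intros Hr. pose proof (Cmod_sub_ge (RtoC rho * cis t) z) as H. rewrite Cmod_circle in H; lra.
Qed.

Lemma is_Cderive_cauchy_transform (rho : R) (phi : R -> C) (z : C) :
  (0 < rho)%R -> (Cmod z < rho)%R -> ccurve phi ->
  is_Cderive (cauchy_transform rho phi) z (cauchy_transform2 rho phi z).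
Proof.
  intros Hr Hz Hp. destruct (ccurve_bounded phi Hp) as [M [HM0 HM]].
  set (m := ((rho - Cmod z) / 2)%R). assert (Hm : (0 < m)%R) by (unfold m; lra).
  assert (Hw' : forall w, (Cmod (w - z) < m)%R -> (Cmod w < rho - m)%R).
  { intros w Hw. pose proof (Cmod_sub_ge w z). unfold m in *. lra. }
  apply (is_Cderive_cmean (fun w t => phi t / (RtoC rho * cis t - w)) _ z m (M / (m * m * m))); auto.
  - intros w Hw. apply ccurve_cauchy_transform; auto. specialize (Hw' w Hw). lra.
  - now apply ccurve_cauchy_transform2.
  - intros w t Hw Ht. specialize (Hw' w Hw).
    set (u := RtoC rho * cis t).
    assert (Hu1 : (m <= Cmod (u - z))%R) by (pose proof (circle_sub_ge rho t z Hr); unfold u, m in *; lra).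
    assert (Hu2 : (m <= Cmod (u - w))%R) by (pose proof (circle_sub_ge rho t w Hr); unfold u in *; lra).
    assert (u - z <> 0) by (apply Cmod_gt_0; lra). assert (u - w <> 0) by (apply Cmod_gt_0; lra).
    replace (phi t / (u - w) - phi t / (u - z) - (w - z) * (phi t / ((u - z) * (u - z)))) with
      ((w - z) * (w - z) * (phi t / ((u - z) * (u - z) * (u - w)))) by (field; auto).
    rewrite !Cmod_mult, (Rmult_comm (M / _)). apply Rmult_le_compat_l.
    + apply Rmult_le_pos; apply Cmod_ge_0.
    + apply Cmod_div_le; [|now apply HM|].
      * clearbody m. repeat apply Rmult_lt_0_compat; auto.
      * clearbody m. rewrite !Cmod_mult. repeat apply Rmult_le_compat; auto; try lra; repeat apply Rmult_le_pos; lra.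
Qed.

Lemma ex_Cderive_cauchy_transform2 (rho : R) (phi : R -> C) (z : C) :
  (0 < rho)%R -> (Cmod z < rho)%R -> ccurve phi -> ex_Cderive (cauchy_transform2 rho phi) z.
Proof.
  intros Hr Hz Hp. destruct (ccurve_bounded phi Hp) as [M [HM0 HM]].
  set (m := ((rho - Cmod z) / 2)%R). assert (Hm : (0 < m)%R) by (unfold m; lra).
  assert (Hw' : forall w, (Cmod (w - z) < m)%R -> (Cmod w < rho - m)%R).
  { intros w Hw. pose proof (Cmod_sub_ge w z). unfold m in *. lra. }
  set (K' := fun t => 2 * phi t / ((RtoC rho * cis t - z) * (RtoC rho * cis t - z) * (RtoC rho * cis t - z))).
  exists (cmean K').
  apply (is_Cderive_cmean (fun w t => phi t / ((RtoC rho * cis t - w) * (RtoC rho * cis t - w))) K' z m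
    (M * (6 * rho) / (m * m * m * (m * m)))); auto.
  - intros w Hw. apply ccurve_cauchy_transform2; auto. specialize (Hw' w Hw). lra.
  - intros t. unfold K'. pose proof (circle_sub_neq_0 rho t z Hr Hz). apply ccont_div.
    + repeat apply Cmult_neq_0; auto.
    + apply ccont_mult; [apply ccont_const|apply Hp].
    + apply ccont_mult; [apply ccont_mult|]; apply ccont_circle_sub.
  - intros w t Hw Ht. specialize (Hw' w Hw). unfold K'.
    pose proof (Cmod_circle rho t ltac:(lra)) as Hu0.
    set (u := RtoC rho * cis t) in *.
    assert (Hu1 : (m <= Cmod (u - z))%R) by (pose proof (circle_sub_ge rho t z Hr); unfold u, m in *; lra).
    assert (Hu2 : (m <= Cmod (u - w))%R) by (pose proof (circle_sub_ge rho t w Hr); unfold u in *; lra).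
    assert (u - z <> 0) by (apply Cmod_gt_0; lra). assert (u - w <> 0) by (apply Cmod_gt_0; lra).
    replace (phi t / ((u - w) * (u - w)) - phi t / ((u - z) * (u - z)) -
      (w - z) * (2 * phi t / ((u - z) * (u - z) * (u - z)))) with
      ((w - z) * (w - z) * (phi t * ((u - z) + 2 * (u - w)) / ((u - z) * (u - z) * (u - z) * ((u - w) * (u - w)))))
      by (field; auto).
    rewrite !Cmod_mult, (Rmult_comm (M * _ / _)). apply Rmult_le_compat_l.
    + apply Rmult_le_pos; apply Cmod_ge_0.
    + apply Cmod_div_le.
      * clearbody m. repeat apply Rmult_lt_0_compat; auto.
      * rewrite Cmod_mult. apply Rmult_le_compat; try apply Cmod_ge_0; [now apply HM|].
        eapply Rle_trans; [apply Cmod_triangle|]. rewrite Cmod_mult, Cmod_R, Rabs_pos_eq by lra.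
        pose proof (Cmod_triangle u (- z)). pose proof (Cmod_triangle u (- w)). rewrite Cmod_opp in *.
        unfold Cminus. lra.
      * clearbody m. rewrite !Cmod_mult. repeat apply Rmult_le_compat; auto; try lra; repeat apply Rmult_le_pos; lra.
Qed.

Lemma ccurve_holo (r rho : R) (f : C -> C) : holo_off_0 r f -> (0 < rho < r)%R ->
  ccurve (fun t => f (RtoC rho * cis t)).
Proof. intros [H _] Hr. apply (ccurve_circle f r); auto. rewrite Rabs_pos_eq; lra. Qed.

Lemma cauchy_formula_transform (r rho : R) (f : C -> C) (z : C) :
  holo_off_0 r f -> (0 < rho < r)%R -> (Cmod z < rho)%R ->
  f z = cauchy_transform rho (fun t => f (RtoC rho * cis t) * (RtoC rho * cis t)) z.
Proof.
  intros Hf Hr Hz. rewrite <- (cauchy_formula r rho f z Hf Hr Hz).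
  apply cmean_ext. intros t. unfold Cdiv. ring.
Qed.

(** On a smaller disk [f] is a Cauchy transform, whose derivative is the
    transform with squared kernel, and this one is differentiable again. *)
Theorem holo_derive (r : R) (f : C -> C) (z : C) :
  holo_off_0 r f -> (Cmod z < r)%R ->
  is_Cderive f z (C_derive f z) /\ ex_Cderive (C_derive f) z.
Proof.
  intros Hf Hz. set (rho := ((Cmod z + r) / 2)%R).
  pose proof (Cmod_ge_0 z). assert (Hr : (0 < rho < r)%R) by (unfold rho; lra).
  assert (Hzr : (Cmod z < rho)%R) by (unfold rho; lra).
  set (phi := fun t => f (RtoC rho * cis t) * (RtoC rho * cis t)).
  assert (Hp : ccurve phi).
  { intros t. apply ccont_mult; [now apply (ccurve_holo r)|apply ccont_circle]. }
  assert (HD : forall w, (Cmod w < rho)%R -> is_Cderive f w (cauchy_transform2 rho phi w)).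
  { intros w Hw. apply (is_Cderive_ext_loc (cauchy_transform rho phi) f w _ (rho - Cmod w)); [lra| |].
    - intros v Hv. symmetry. apply (cauchy_formula_transform r); auto.
      pose proof (Cmod_sub_ge v w). lra.
    - apply is_Cderive_cauchy_transform; auto; lra. }
  assert (HE : forall w, (Cmod w < rho)%R -> C_derive f w = cauchy_transform2 rho phi w).
  { intros w Hw. apply is_C_derive_unique. now apply HD. }
  split.
  - rewrite HE by auto. now apply HD.
  - destruct (ex_Cderive_cauchy_transform2 rho phi z) as [l Hl]; auto; [lra|].
    exists l. apply (is_Cderive_ext_loc (cauchy_transform2 rho phi) _ z l (rho - Cmod z)); auto; [lra|].
    intros w Hw. symmetry. apply HE. pose proof (Cmod_sub_ge w z). lra.
Qed.

(** * Taylor expansions *)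

Definition taylor_coef (rho : R) (f : C -> C) (n : nat) : C :=
  cmean (fun t => f (RtoC rho * cis t) / (RtoC rho * cis t) ^ n).

Definition taylor_tail_density (rho : R) (f : C -> C) (n : nat) (t : R) : C :=
  f (RtoC rho * cis t) / (RtoC rho * cis t) ^ n * (RtoC rho * cis t).

(** The factor of [z ^ n] in the Taylor remainder of order [n]. *)
Definition taylor_tail (rho : R) (f : C -> C) (n : nat) : C -> C := cauchy_transform rho (taylor_tail_density rho f n).

Lemma circle_neq_0 (rho t : R) : (0 < rho)%R -> RtoC rho * cis t <> 0.
Proof. intros. apply Cmod_gt_0. rewrite Cmod_circle; lra. Qed.

Lemma ccurve_taylor_coef (r rho : R) (f : C -> C) n : holo_off_0 r f -> (0 < rho < r)%R ->
  ccurve (fun t => f (RtoC rho * cis t) / (RtoC rho * cis t) ^ n).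
Proof.
  intros Hf Hr t. apply ccont_div.
  - apply Cpow_nz, circle_neq_0. lra.
  - now apply (ccurve_holo r).
  - apply ccont_pow, ccont_circle.
Qed.

Lemma ccurve_taylor_tail_density (r rho : R) (f : C -> C) n : holo_off_0 r f -> (0 < rho < r)%R ->
  ccurve (taylor_tail_density rho f n).
Proof.
  intros Hf Hr t. apply ccont_mult; [now apply (ccurve_taylor_coef r)|apply ccont_circle].
Qed.

Lemma taylor_tail_0 (r rho : R) (f : C -> C) (z : C) :
  holo_off_0 r f -> (0 < rho < r)%R -> (Cmod z < rho)%R -> taylor_tail rho f 0 z = f z.
Proof.
  intros Hf Hr Hz. rewrite (cauchy_formula_transform r rho f z) by auto. apply cmean_ext. intros t.
  unfold taylor_tail_density. simpl. unfold Cdiv. rewrite <- RtoC_inv, Rinv_1 by lra. ring.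
Qed.

(** With [u] on the circle, [u / (u - z) = 1 + z / u * (u / (u - z))]. *)
Lemma taylor_tail_S (r rho : R) (f : C -> C) (z : C) n :
  holo_off_0 r f -> (0 < rho < r)%R -> (Cmod z < rho)%R ->
  taylor_tail rho f n z = taylor_coef rho f n + z * taylor_tail rho f (S n) z.
Proof.
  intros Hf Hr Hz. unfold taylor_tail, cauchy_transform, taylor_coef.
  rewrite <- cmean_scal by (apply ccurve_cauchy_transform; auto; [lra|now apply (ccurve_taylor_tail_density r)]).
  rewrite <- cmean_plus.
  - apply cmean_ext. intros t. unfold taylor_tail_density. simpl.
    pose proof (circle_neq_0 rho t ltac:(lra)).
    pose proof (circle_sub_neq_0 rho t z ltac:(lra) Hz).
    pose proof (Cpow_nz (RtoC rho * cis t) n H).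
    set (u := RtoC rho * cis t) in *. clearbody u. field. auto.
  - now apply (ccurve_taylor_coef r).
  - intros t. apply ccont_mult; [apply ccont_const|].
    apply ccurve_cauchy_transform; auto; [lra|now apply (ccurve_taylor_tail_density r)].
Qed.

Lemma taylor_partial_sum (r rho : R) (f : C -> C) (z : C) n :
  holo_off_0 r f -> (0 < rho < r)%R -> (Cmod z < rho)%R ->
  f z = sum_n (G := C_AbelianMonoid) (fun k => taylor_coef rho f k * z ^ k) n + z ^ S n * taylor_tail rho f (S n) z.
Proof.
  intros Hf Hr Hz. induction n as [|n IH].
  - rewrite sum_O, <- (taylor_tail_0 r rho f z), (taylor_tail_S r) by auto. simpl. ring.
  - rewrite IH, sum_Sn, (taylor_tail_S r rho f z (S n)) by auto.
    change (@plus C_AbelianMonoid) with Cplus. simpl. ring.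
Qed.

Lemma taylor_tail_density_bound (r rho : R) (f : C -> C) : holo_off_0 r f -> (0 < rho < r)%R ->
  exists M, (0 <= M)%R /\ forall n t, (0 <= t <= 2 * PI)%R ->
    (Cmod (taylor_tail_density rho f n t) <= M / rho ^ n)%R.
Proof.
  intros Hf Hr. destruct (ccurve_bounded _ (ccurve_holo r rho f Hf Hr)) as [M [HM0 HM]].
  exists (M * rho)%R; split; [apply Rmult_le_pos; lra|].
  intros n t Ht. unfold taylor_tail_density. pose proof (circle_neq_0 rho t ltac:(lra)).
  rewrite Cmod_mult, Cmod_div, Cmod_pow, Cmod_circle by (try apply Cpow_nz; auto; lra).
  assert (0 < / rho ^ n)%R by (apply Rinv_0_lt_compat, pow_lt; lra).
  replace (M * rho / rho ^ n)%R with (M / rho ^ n * rho)%R by (unfold Rdiv; ring).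
  apply Rmult_le_compat_r; [lra|]. apply Rmult_le_compat_r; [lra|]. now apply HM.
Qed.

Lemma taylor_tail_bound (r rho : R) (f : C -> C) : holo_off_0 r f -> (0 < rho < r)%R ->
  exists M, (0 <= M)%R /\ forall n z, (Cmod z < rho)%R ->
    (Cmod (taylor_tail rho f n z) <= M / rho ^ n / (rho - Cmod z))%R.
Proof.
  intros Hf Hr. destruct (taylor_tail_density_bound r rho f Hf Hr) as [M [HM0 HM]].
  exists (2 * M)%R; split; [lra|]. intros n z Hz.
  replace (2 * M / rho ^ n / (rho - Cmod z))%R with (2 * (M / rho ^ n / (rho - Cmod z)))%R by (unfold Rdiv; ring).
  apply cmean_bound.
  - apply ccurve_cauchy_transform; auto; [lra|now apply (ccurve_taylor_tail_density r)].
  - intros t Ht. apply Cmod_div_le; [lra|now apply HM|apply circle_sub_ge; lra].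
Qed.

Lemma is_series_eps (a : nat -> C) (l : C) :
  (forall eps, (0 < eps)%R -> exists N, forall n, (N <= n)%nat ->
     (Cmod (sum_n (G := C_AbelianMonoid) a n - l) < eps)%R) ->
  is_series (K := C_AbsRing) (V := C_NormedModule) a l.
Proof.
  intros H. apply (filterlim_locally_ball_norm (K := C_AbsRing) (U := C_NormedModule)).
  intros [eps He]. destruct (H eps He) as [N HN]. exists N. intros n Hn.
  unfold ball_norm. exact (HN n Hn).
Qed.

(** The remainder is of the size of a geometric sequence of ratio [Cmod z / rho]. *)
Theorem taylor_series (r rho : R) (f : C -> C) (z : C) :
  holo_off_0 r f -> (0 < rho < r)%R -> (Cmod z < rho)%R ->
  is_series (K := C_AbsRing) (V := C_NormedModule) (fun n => taylor_coef rho f n * z ^ n) (f z).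
Proof.
  intros Hf Hr Hz. destruct (taylor_tail_bound r rho f Hf Hr) as [M [HM0 HM]].
  apply is_series_eps. intros eps He.
  pose proof (Cmod_ge_0 z) as Hz0.
  set (q := (Cmod z / rho)%R).
  assert (Hq0 : (0 <= q)%R) by (apply Rdiv_le_0_compat; lra).
  assert (Hq1 : (q < 1)%R).
  { apply Rmult_lt_reg_r with rho; [lra|]. unfold q, Rdiv. rewrite Rmult_assoc, Rinv_l; lra. }
  set (B := (M / (rho - Cmod z))%R).
  assert (HB : (0 <= B)%R) by (apply Rdiv_le_0_compat; lra).
  destruct (pow_lt_1_zero q) with (y := (eps / (B + 1))%R) as [N HN].
  { rewrite Rabs_pos_eq; auto. }
  { apply Rdiv_lt_0_compat; lra. }
  exists N. intros n Hn.
  rewrite (taylor_partial_sum r rho f z n) by auto.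
  match goal with |- (Cmod (?s - (?s + ?t)) < _)%R => replace (s - (s + t)) with (- t) by ring end.
  rewrite Cmod_opp, Cmod_mult, Cmod_pow.
  specialize (HN (S n) ltac:(lia)). rewrite Rabs_pos_eq in HN by (apply pow_le; auto).
  apply Rle_lt_trans with (q ^ S n * B)%R.
  - replace (q ^ S n * B)%R with (Cmod z ^ S n * (M / rho ^ S n / (rho - Cmod z)))%R.
    + apply Rmult_le_compat_l; [apply pow_le; auto|]. now apply HM.
    + unfold q, B. unfold Rdiv. rewrite Rpow_mult_distr, pow_inv. ring.
  - assert (E : (eps / (B + 1) * (B + 1) = eps)%R) by (field; lra).
    assert (0 < eps / (B + 1))%R by (apply Rdiv_lt_0_compat; lra).
    pose proof (pow_le q (S n) Hq0). set (X := (q ^ S n)%R) in *. nra.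
Qed.

(** * Expansions up to order three *)

Definition poly3 (a0 a1 a2 a3 z : C) : C := a0 + a1 * z + a2 * z ^ 2 + a3 * z ^ 3.

Definition jet3 (f : C -> C) (a0 a1 a2 a3 : C) : Prop :=
  exists K d : R, (0 < d)%R /\ forall z, (Cmod z < d)%R ->
    (Cmod (f z - poly3 a0 a1 a2 a3 z) <= K * Cmod z ^ 4)%R.

Lemma taylor_jet (r rho : R) (f : C -> C) : holo_off_0 r f -> (0 < rho < r)%R ->
  jet3 f (taylor_coef rho f 0) (taylor_coef rho f 1) (taylor_coef rho f 2) (taylor_coef rho f 3).
Proof.
  intros Hf Hr. destruct (taylor_tail_bound r rho f Hf Hr) as [M [HM0 HM]].
  exists (M / rho ^ 4 / (rho / 2))%R, (rho / 2)%R; split; [lra|]. intros z Hz.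
  rewrite <- (taylor_tail_0 r rho f z), (taylor_tail_S r rho f z 0), (taylor_tail_S r rho f z 1), (taylor_tail_S r rho f z 2), (taylor_tail_S r rho f z 3) by (auto; lra).
  unfold poly3.
  match goal with |- (Cmod ?a <= _)%R => replace a with (z ^ 4 * taylor_tail rho f 4 z) by (simpl; ring) end.
  rewrite Cmod_mult, Cmod_pow, Rmult_comm. pose proof (Cmod_ge_0 z).
  apply Rmult_le_compat_r; [apply pow_le; auto|].
  eapply Rle_trans; [apply HM; lra|].
  apply Rmult_le_compat_l.
  - apply Rdiv_le_0_compat; auto. apply pow_lt; lra.
  - apply Rinv_le_contravar; lra.
Qed.

(** Stated for [z * f' z], which is what enters the derivative of [z * f z].  The
    remainder [z ^ 4 * T z] may be differentiated because [T] and its derivative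
    are Cauchy transforms, hence bounded near 0. *)
Lemma taylor_jet_derive (r rho : R) (f : C -> C) : holo_off_0 r f -> (0 < rho < r)%R ->
  jet3 (fun z => z * C_derive f z) 0 (taylor_coef rho f 1) (2 * taylor_coef rho f 2) (3 * taylor_coef rho f 3).
Proof.
  intros Hf Hr. destruct (taylor_tail_bound r rho f Hf Hr) as [M [HM0 HM]].
  destruct (taylor_tail_density_bound r rho f Hf Hr) as [M' [HM0' HM']].
  set (T := taylor_tail rho f 4). set (T' := cauchy_transform2 rho (taylor_tail_density rho f 4)).
  set (B := (M / rho ^ 4 / (rho / 2))%R). set (B' := (2 * (M' / rho ^ 4 / (rho / 2 * (rho / 2))))%R).
  assert (HB : forall z, (Cmod z < rho / 2)%R -> (Cmod (T z) <= B)%R).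
  { intros z Hz. eapply Rle_trans; [apply HM; lra|]. apply Rmult_le_compat_l.
    - apply Rdiv_le_0_compat; auto. apply pow_lt; lra.
    - apply Rinv_le_contravar; lra. }
  assert (HB' : forall z, (Cmod z < rho / 2)%R -> (Cmod (T' z) <= B')%R).
  { intros z Hz. apply cmean_bound.
    - apply ccurve_cauchy_transform2; try lra. now apply (ccurve_taylor_tail_density r).
    - intros t Ht. pose proof (circle_sub_ge rho t z ltac:(lra)).
      apply Cmod_div_le; [apply Rmult_lt_0_compat; lra|now apply HM'|].
      rewrite Cmod_mult. apply Rmult_le_compat; lra. }
  exists (4 * B + rho * B')%R, (rho / 2)%R; split; [lra|]. intros z Hz.
  set (a := taylor_coef rho f).
  assert (HD : is_Cderive f z (a 1%nat + 2 * a 2%nat * z + 3 * a 3%nat * z ^ 2 + 4 * z ^ 3 * T z + z ^ 4 * T' z)).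
  { apply (is_Cderive_ext_loc (fun w => a 0%nat + w * (a 1%nat + w * (a 2%nat + w * (a 3%nat + w * T w)))) f z _ (rho - Cmod z)).
    - lra.
    - intros w Hw. pose proof (Cmod_sub_ge w z).
      rewrite <- (taylor_tail_0 r rho f w), (taylor_tail_S r rho f w 0), (taylor_tail_S r rho f w 1), (taylor_tail_S r rho f w 2), (taylor_tail_S r rho f w 3) by (auto; lra). reflexivity.
    - assert (D4 : is_Cderive T z (T' z)).
      { apply is_Cderive_cauchy_transform; try lra. now apply (ccurve_taylor_tail_density r). }
      assert (step : forall (c : C) (g : C -> C) (l : C), is_Cderive g z l ->
         is_Cderive (fun w => c + w * g w) z (g z + z * l)).
      { intros c g l Hg.
        pose proof (is_Cderive_plus (fun _ => c) (fun w => w * g w) z _ _ (is_Cderive_const c z)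
          (is_Cderive_mult (fun w => w) g z _ _ (is_Cderive_id z) Hg)) as Hs.
        replace (g z + z * l) with (0 + (1 * g z + z * l)) by ring. exact Hs. }
      pose proof (step (a 0%nat) _ _ (step (a 1%nat) _ _ (step (a 2%nat) _ _ (step (a 3%nat) _ _ D4)))) as Hs.
      cbv beta in Hs.
      match type of Hs with is_Cderive _ _ ?l => match goal with |- is_Cderive _ _ ?l' =>
        replace l' with l by (simpl; ring) end end.
      exact Hs. }
  rewrite (is_C_derive_unique _ _ _ HD). unfold poly3. fold a.
  match goal with |- (Cmod ?a <= _)%R => replace a with (z ^ 4 * (4 * T z + z * T' z)) by (simpl; ring) end.
  rewrite Cmod_mult, Cmod_pow, Rmult_comm. pose proof (Cmod_ge_0 z).
  apply Rmult_le_compat_r; [apply pow_le; auto|].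
  eapply Rle_trans; [apply Cmod_triangle|]. rewrite !Cmod_mult, Cmod_R, Rabs_pos_eq by lra.
  specialize (HB z Hz). specialize (HB' z Hz).
  apply Rplus_le_compat; [lra|]. apply Rmult_le_compat; try apply Cmod_ge_0; lra.
Qed.

Lemma jet3_bound (f : C -> C) (a0 a1 a2 a3 : C) : jet3 f a0 a1 a2 a3 ->
  exists K d : R, (0 <= K)%R /\ (0 < d <= 1)%R /\ forall z, (Cmod z < d)%R ->
    (Cmod (f z - poly3 a0 a1 a2 a3 z) <= K * Cmod z ^ 4)%R.
Proof.
  intros (K & d & Hd & H). exists (Rmax K 0), (Rmin d 1).
  split; [apply Rmax_r|]. split; [split; [apply Rmin_pos; lra|apply Rmin_r]|].
  intros z Hz. eapply Rle_trans; [apply H; eapply Rlt_le_trans; [exact Hz|apply Rmin_l]|].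
  apply Rmult_le_compat_r; [apply pow_le, Cmod_ge_0|apply Rmax_l].
Qed.

Lemma jet3_ext_loc (f g : C -> C) (a0 a1 a2 a3 : C) (d : R) : (0 < d)%R ->
  (forall z, (Cmod z < d)%R -> f z = g z) -> jet3 f a0 a1 a2 a3 -> jet3 g a0 a1 a2 a3.
Proof.
  intros Hd E (K & d' & Hd' & H). exists K, (Rmin d d'); split; [now apply Rmin_pos|].
  intros z Hz. rewrite <- E by (eapply Rlt_le_trans; [exact Hz|apply Rmin_l]).
  apply H. eapply Rlt_le_trans; [exact Hz|apply Rmin_r].
Qed.

Lemma jet3_at_0 (f : C -> C) (a0 a1 a2 a3 : C) : jet3 f a0 a1 a2 a3 -> a0 = f 0.
Proof.
  intros (K & d & Hd & H). specialize (H 0). rewrite Cmod_0 in H. specialize (H Hd).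
  unfold poly3 in H. replace (f 0 - _) with (f 0 - a0) in H by (simpl; ring).
  replace (K * 0 ^ 4)%R with 0%R in H by ring.
  pose proof (Cmod_ge_0 (f 0 - a0)).
  assert (E : f 0 - a0 = 0) by (apply Cmod_eq_0; lra).
  replace (f 0) with (f 0 - a0 + a0) by ring. rewrite E; ring.
Qed.

Lemma jet3_poly (a0 a1 a2 a3 : C) : jet3 (poly3 a0 a1 a2 a3) a0 a1 a2 a3.
Proof.
  exists 0%R, 1%R; split; [lra|]. intros z _.
  replace (poly3 a0 a1 a2 a3 z - poly3 a0 a1 a2 a3 z) with (RtoC 0) by ring.
  rewrite Cmod_0. lra.
Qed.

Lemma jet3_plus (f g : C -> C) (a0 a1 a2 a3 b0 b1 b2 b3 : C) :
  jet3 f a0 a1 a2 a3 -> jet3 g b0 b1 b2 b3 ->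
  jet3 (fun z => f z + g z) (a0 + b0) (a1 + b1) (a2 + b2) (a3 + b3).
Proof.
  intros (K & d & Hd & H) (K' & d' & Hd' & H').
  exists (K + K')%R, (Rmin d d'); split; [now apply Rmin_pos|]. intros z Hz.
  specialize (H z (Rlt_le_trans _ _ _ Hz (Rmin_l _ _))).
  specialize (H' z (Rlt_le_trans _ _ _ Hz (Rmin_r _ _))).
  replace (f z + g z - poly3 (a0 + b0) (a1 + b1) (a2 + b2) (a3 + b3) z) with
    ((f z - poly3 a0 a1 a2 a3 z) + (g z - poly3 b0 b1 b2 b3 z)) by (unfold poly3; ring).
  eapply Rle_trans; [apply Cmod_triangle|]. lra.
Qed.

Lemma Cmod_poly3 (a0 a1 a2 a3 z : C) : (Cmod z <= 1)%R ->
  (Cmod (poly3 a0 a1 a2 a3 z) <= Cmod a0 + Cmod a1 + Cmod a2 + Cmod a3)%R.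
Proof.
  intros Hz. unfold poly3. pose proof (Cmod_ge_0 z).
  assert (E : forall a n, (Cmod (a * z ^ n) <= Cmod a)%R).
  { intros a n. rewrite Cmod_mult, Cmod_pow. rewrite <- (Rmult_1_r (Cmod a)) at 2.
    apply Rmult_le_compat_l; [apply Cmod_ge_0|]. rewrite <- (pow1 n). apply pow_incr; lra. }
  eapply Rle_trans; [apply Cmod_triangle|]. apply Rplus_le_compat; [|apply E].
  eapply Rle_trans; [apply Cmod_triangle|]. apply Rplus_le_compat; [|apply E].
  eapply Rle_trans; [apply Cmod_triangle|]. apply Rplus_le_compat; [lra|].
  pose proof (E a1 1%nat) as E1. simpl in E1. now rewrite Cmult_1_r in E1.
Qed.

Lemma jet3_mult (f g : C -> C) (a0 a1 a2 a3 b0 b1 b2 b3 : C) :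
  jet3 f a0 a1 a2 a3 -> jet3 g b0 b1 b2 b3 ->
  jet3 (fun z => f z * g z) (a0 * b0) (a0 * b1 + a1 * b0) (a0 * b2 + a1 * b1 + a2 * b0)
    (a0 * b3 + a1 * b2 + a2 * b1 + a3 * b0).
Proof.
  intros Hf Hg.
  destruct (jet3_bound _ _ _ _ _ Hf) as (K & d & HK & Hd & H).
  destruct (jet3_bound _ _ _ _ _ Hg) as (K' & d' & HK' & Hd' & H').
  set (A := (Cmod a0 + Cmod a1 + Cmod a2 + Cmod a3)%R).
  set (B := (Cmod b0 + Cmod b1 + Cmod b2 + Cmod b3)%R).
  set (c4 := a1 * b3 + a2 * b2 + a3 * b1). set (c5 := a2 * b3 + a3 * b2). set (c6 := a3 * b3).
  exists (A * K' + K * B + K * K' + (Cmod c4 + Cmod c5 + Cmod c6 + Cmod 0))%R, (Rmin d d').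
  split; [apply Rmin_pos; lra|]. intros z Hz.
  assert (Hz1 := Rlt_le_trans _ _ _ Hz (Rmin_l _ _)).
  assert (Hz2 := Rlt_le_trans _ _ _ Hz (Rmin_r _ _)).
  specialize (H z Hz1). specialize (H' z Hz2). clear Hz.
  pose proof (Cmod_poly3 a0 a1 a2 a3 z ltac:(lra)) as HP. fold A in HP.
  pose proof (Cmod_poly3 b0 b1 b2 b3 z ltac:(lra)) as HQ. fold B in HQ.
  pose proof (Cmod_poly3 c4 c5 c6 0 z ltac:(lra)) as HR.
  set (P := poly3 a0 a1 a2 a3 z) in *. set (Q := poly3 b0 b1 b2 b3 z) in *.
  match goal with |- (Cmod ?x <= _)%R => replace x with
    ((P * (g z - Q) + (f z - P) * Q) + ((f z - P) * (g z - Q) + z ^ 4 * poly3 c4 c5 c6 0 z))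
    by (unfold P, Q, poly3, c4, c5, c6; ring) end.
  pose proof (Cmod_ge_0 z) as Hm. 
  assert (Hm4 : (0 <= Cmod z ^ 4)%R) by (apply pow_le; auto).
  assert (Hm41 : (Cmod z ^ 4 <= 1)%R) by (rewrite <- (pow1 4); apply pow_incr; lra).
  eapply Rle_trans; [apply Cmod_triangle|].
  eapply Rle_trans; [apply Rplus_le_compat; apply Cmod_triangle|].
  rewrite !Cmod_mult, Cmod_pow. set (m := (Cmod z ^ 4)%R) in *.
  pose proof (Cmod_ge_0 (f z - P)). pose proof (Cmod_ge_0 (g z - Q)).
  pose proof (Cmod_ge_0 P). pose proof (Cmod_ge_0 Q).
  assert (T1 : (Cmod P * Cmod (g z - Q) <= A * (K' * m))%R) by (apply Rmult_le_compat; auto).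
  assert (T2 : (Cmod (f z - P) * Cmod Q <= K * m * B)%R) by (apply Rmult_le_compat; auto).
  assert (T3 : (Cmod (f z - P) * Cmod (g z - Q) <= K * m * K')%R).
  { apply Rmult_le_compat; auto. nra. }
  assert (T4 : (m * Cmod (poly3 c4 c5 c6 0 z) <= m * (Cmod c4 + Cmod c5 + Cmod c6 + Cmod 0))%R)
    by (apply Rmult_le_compat_l; auto).
  lra.
Qed.

Lemma jet3_ext_coef (f : C -> C) (a0 a1 a2 a3 b0 b1 b2 b3 : C) :
  a0 = b0 -> a1 = b1 -> a2 = b2 -> a3 = b3 -> jet3 f a0 a1 a2 a3 -> jet3 f b0 b1 b2 b3.
Proof. now intros -> -> -> ->. Qed.

Lemma jet3_scal (c : C) (f : C -> C) (a0 a1 a2 a3 : C) :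
  jet3 f a0 a1 a2 a3 -> jet3 (fun z => c * f z) (c * a0) (c * a1) (c * a2) (c * a3).
Proof.
  intros H. pose proof (jet3_mult _ _ _ _ _ _ _ _ _ _ (jet3_poly c 0 0 0) H) as HM.
  eapply jet3_ext_coef; [..|eapply (jet3_ext_loc _ _ _ _ _ _ 1); [lra| |exact HM]]; try ring.
  intros z _. unfold poly3. ring.
Qed.

(** [f (g z)] differs from the polynomial in [g z] by O(g(z)^4), and
    [g z = O(z)]; the polynomial in [g z] is expanded by [jet3_mult]. *)
Lemma jet3_comp (f g : C -> C) (a0 a1 a2 a3 p1 p2 p3 : C) :
  jet3 f a0 a1 a2 a3 -> jet3 g 0 p1 p2 p3 ->
  jet3 (fun z => f (g z)) a0 (a1 * p1) (a1 * p2 + a2 * (p1 * p1))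
    (a1 * p3 + a2 * (2 * p1 * p2) + a3 * (p1 * p1 * p1)).
Proof.
  intros Hf Hg.
  assert (HP : jet3 (fun z => poly3 a0 a1 a2 a3 (g z)) a0 (a1 * p1) (a1 * p2 + a2 * (p1 * p1))
    (a1 * p3 + a2 * (2 * p1 * p2) + a3 * (p1 * p1 * p1))).
  { pose proof (jet3_mult _ _ _ _ _ _ _ _ _ _ Hg Hg) as H2.
    pose proof (jet3_mult _ _ _ _ _ _ _ _ _ _ Hg H2) as H3.
    pose proof (jet3_plus _ _ _ _ _ _ _ _ _ _ (jet3_plus _ _ _ _ _ _ _ _ _ _
      (jet3_plus _ _ _ _ _ _ _ _ _ _ (jet3_poly a0 0 0 0) (jet3_scal a1 _ _ _ _ _ Hg))
      (jet3_scal a2 _ _ _ _ _ H2)) (jet3_scal a3 _ _ _ _ _ H3)) as H4.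
    eapply jet3_ext_coef; [..|eapply (jet3_ext_loc _ _ _ _ _ _ 1); [lra| |exact H4]]; try ring.
    intros z _. unfold poly3. ring. }
  destruct (jet3_bound _ _ _ _ _ Hf) as (K & d & HK & Hd & H).
  destruct (jet3_bound _ _ _ _ _ Hg) as (Kg & dg & HKg & Hdg & H').
  destruct (jet3_bound _ _ _ _ _ HP) as (Kp & dp & HKp & Hdp & Hp).
  set (B := (Cmod p1 + Cmod p2 + Cmod p3 + Kg + 1)%R).
  assert (HB : (1 <= B)%R) by (pose proof (Cmod_ge_0 p1); pose proof (Cmod_ge_0 p2);
    pose proof (Cmod_ge_0 p3); unfold B; lra).
  exists (K * B ^ 4 + Kp)%R, (Rmin (Rmin dg dp) (d / B)); split.
  { apply Rmin_pos; [apply Rmin_pos; lra|apply Rdiv_lt_0_compat; lra]. }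
  intros z Hz. 
  assert (Z1 : (Cmod z < dg)%R) by (eapply Rlt_le_trans; [exact Hz|]; eapply Rle_trans; [apply Rmin_l|apply Rmin_l]).
  assert (Z2 : (Cmod z < dp)%R) by (eapply Rlt_le_trans; [exact Hz|]; eapply Rle_trans; [apply Rmin_l|apply Rmin_r]).
  assert (Z3 : (Cmod z < d / B)%R) by (eapply Rlt_le_trans; [exact Hz|apply Rmin_r]).
  specialize (H' z Z1). specialize (Hp z Z2). pose proof (Cmod_ge_0 z) as Hm.
  assert (Hgz : (Cmod (g z) <= B * Cmod z)%R).
  { replace (g z) with ((g z - poly3 0 p1 p2 p3 z) + z * poly3 p1 p2 p3 0 z) by (unfold poly3; ring).
    eapply Rle_trans; [apply Cmod_triangle|]. rewrite Cmod_mult.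
    pose proof (Cmod_poly3 p1 p2 p3 0 z ltac:(lra)) as HQ. rewrite Cmod_0 in HQ.
    assert (Cmod z ^ 4 <= Cmod z)%R.
    { simpl. assert (Cmod z * (Cmod z * (Cmod z * 1)) <= 1)%R; [|nra].
      replace 1%R with (1 ^ 3)%R at 2 by ring.
      replace (Cmod z * (Cmod z * (Cmod z * 1)))%R with (Cmod z ^ 3)%R by ring. apply pow_incr. lra. }
    unfold B. nra. }
  assert (Hgd : (Cmod (g z) < d)%R).
  { eapply Rle_lt_trans; [exact Hgz|]. replace d with (B * (d / B))%R by (field; lra).
    apply Rmult_lt_compat_l; lra. }
  specialize (H (g z) Hgd).
  match goal with |- (Cmod (?x - ?y) <= _)%R => replace (x - y) with
    ((x - poly3 a0 a1 a2 a3 (g z)) + (poly3 a0 a1 a2 a3 (g z) - y)) by ring end.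
  eapply Rle_trans; [apply Cmod_triangle|].
  assert (K * Cmod (g z) ^ 4 <= K * (B ^ 4 * Cmod z ^ 4))%R.
  { apply Rmult_le_compat_l; auto. rewrite <- Rpow_mult_distr. apply pow_incr.
    split; auto. apply Cmod_ge_0. }
  lra.
Qed.

Lemma small_linear_bound_0 (c : C) (B d : R) : (0 < d)%R ->
  (forall t, (0 < t < d)%R -> (Cmod c <= B * t)%R) -> c = 0.
Proof.
  intros Hd H. apply Cmod_eq_0. pose proof (Cmod_ge_0 c) as Hc.
  destruct (Rle_lt_or_eq_dec _ _ Hc) as [Hlt|]; auto. exfalso.
  set (B' := (Rabs B + 1)%R). pose proof (Rabs_pos B). pose proof (Rle_abs B).
  assert (HB' : (0 < B')%R) by (unfold B'; lra).
  set (t := Rmin (d / 2) (Cmod c / (2 * B'))).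
  assert (Ht0 : (0 < t)%R) by (apply Rmin_pos; [lra|apply Rdiv_lt_0_compat; lra]).
  assert (Ht1 : (t <= d / 2)%R) by apply Rmin_l.
  assert (Ht2 : (t <= Cmod c / (2 * B'))%R) by apply Rmin_r.
  specialize (H t ltac:(lra)).
  assert (t * (2 * B') <= Cmod c)%R.
  { replace (Cmod c) with (Cmod c / (2 * B') * (2 * B'))%R by (field; lra).
    apply Rmult_le_compat_r; lra. }
  unfold B' in *. nra.
Qed.

(** The coefficients vanish one after the other, on dividing by [t] and letting
    the real number [t] tend to 0. *)
Lemma jet3_zero (c0 c1 c2 c3 : C) : jet3 (fun _ => 0) c0 c1 c2 c3 ->
  c0 = 0 /\ c1 = 0 /\ c2 = 0 /\ c3 = 0.
Proof.
  intros H0. pose proof (jet3_at_0 _ _ _ _ _ H0) as E0. subst c0.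
  destruct (jet3_bound _ _ _ _ _ H0) as (K & d & HK & Hd & H).
  assert (Ht : forall t, (0 < t < d)%R -> (Cmod (c1 + c2 * RtoC t + c3 * RtoC t ^ 2) <= K * t ^ 3)%R).
  { intros t Ht. specialize (H (RtoC t)). rewrite Cmod_R, Rabs_pos_eq in H by lra.
    specialize (H ltac:(lra)).
    replace (0 - poly3 0 c1 c2 c3 (RtoC t)) with (- (RtoC t * (c1 + c2 * RtoC t + c3 * RtoC t ^ 2))) in H
      by (unfold poly3; ring).
    rewrite Cmod_opp, Cmod_mult, Cmod_R, Rabs_pos_eq in H by lra.
    apply Rmult_le_reg_l with t; lra. }
  pose proof (Cmod_ge_0 c2). pose proof (Cmod_ge_0 c3).
  assert (Ht' : forall t, (0 < t < d)%R -> (t ^ 2 <= t)%R /\ (t ^ 3 <= t ^ 2)%R) by (intros; split; nra).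
  assert (E1 : c1 = 0).
  { apply (small_linear_bound_0 _ (Cmod c2 + Cmod c3 + K) d); [lra|]. intros t H3.
    specialize (Ht t H3). destruct (Ht' t H3).
    replace c1 with ((c1 + c2 * RtoC t + c3 * RtoC t ^ 2) + - (c2 * RtoC t) + - (c3 * RtoC t ^ 2)) by ring.
    eapply Rle_trans; [apply Cmod_triangle|].
    eapply Rle_trans; [apply Rplus_le_compat_r, Cmod_triangle|].
    rewrite !Cmod_opp, !Cmod_mult, Cmod_pow, Cmod_R, Rabs_pos_eq by lra. nra. }
  subst c1.
  assert (E2 : c2 = 0).
  { apply (small_linear_bound_0 _ (Cmod c3 + K) d); [lra|]. intros t H3.
    specialize (Ht t H3). destruct (Ht' t H3).
    replace (0 + c2 * RtoC t + c3 * RtoC t ^ 2) with (RtoC t * (c2 + c3 * RtoC t)) in Ht by ring.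
    rewrite Cmod_mult, Cmod_R, Rabs_pos_eq in Ht by lra.
    assert (Cmod (c2 + c3 * RtoC t) <= K * t ^ 2)%R by (apply Rmult_le_reg_l with t; lra).
    replace c2 with ((c2 + c3 * RtoC t) + - (c3 * RtoC t)) by ring.
    eapply Rle_trans; [apply Cmod_triangle|].
    rewrite !Cmod_opp, !Cmod_mult, Cmod_R, Rabs_pos_eq by lra. nra. }
  subst c2. repeat split; auto.
  apply (small_linear_bound_0 _ K d); [lra|]. intros t H3. specialize (Ht t H3).
  replace (0 + 0 * RtoC t + c3 * RtoC t ^ 2) with (RtoC t * RtoC t * c3) in Ht by ring.
  rewrite !Cmod_mult, Cmod_R, Rabs_pos_eq in Ht by lra.
  assert (0 < t * t)%R by (apply Rmult_lt_0_compat; lra).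
  apply Rmult_le_reg_l with (t * t)%R; lra.
Qed.

Lemma jet3_unique (f : C -> C) (a0 a1 a2 a3 b0 b1 b2 b3 : C) :
  jet3 f a0 a1 a2 a3 -> jet3 f b0 b1 b2 b3 -> a0 = b0 /\ a1 = b1 /\ a2 = b2 /\ a3 = b3.
Proof.
  intros Ha Hb.
  pose proof (jet3_plus _ _ _ _ _ _ _ _ _ _ Ha (jet3_scal (- (1)) _ _ _ _ _ Hb)) as H.
  assert (HZ : jet3 (fun _ => 0) (a0 + - (1) * b0) (a1 + - (1) * b1) (a2 + - (1) * b2) (a3 + - (1) * b3)).
  { eapply (jet3_ext_loc _ _ _ _ _ _ 1); [lra| |exact H]. intros z _. simpl. ring. }
  destruct (jet3_zero _ _ _ _ HZ) as (E0 & E1 & E2 & E3).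
  assert (E : forall a b : C, a + - (1) * b = 0 -> a = b).
  { intros a b Hab. replace a with (a + - (1) * b + b) by ring. rewrite Hab. ring. }
  repeat split; now apply E.
Qed.

(** The coefficients are found from the differential equation: the expansion of
    [z * C_derive Cexp z] is that of [z * Cexp z]. *)
Lemma jet3_Cexp : jet3 Cexp 1 1 (/ 2) (/ 6).
Proof.
  assert (Hh : holo_off_0 2 Cexp).
  { split; intros z _.
    - eapply is_Cderive_cont, is_Cderive_Cexp.
    - intros _. eexists. apply is_Cderive_Cexp. }
  pose proof (taylor_jet 2 1 Cexp Hh ltac:(lra)) as J.
  pose proof (taylor_jet_derive 2 1 Cexp Hh ltac:(lra)) as J'.
  pose proof (jet3_mult _ _ _ _ _ _ _ _ _ _ (jet3_poly 0 1 0 0) J) as J2.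
  assert (J3 : jet3 (fun z => z * C_derive Cexp z) 0 (taylor_coef 1 Cexp 0) (taylor_coef 1 Cexp 1) (taylor_coef 1 Cexp 2)).
  { eapply jet3_ext_coef; [..|eapply (jet3_ext_loc _ _ _ _ _ _ 1); [lra| |exact J2]]; try ring.
    intros z _. simpl. rewrite (is_C_derive_unique _ _ _ (is_Cderive_Cexp z)). unfold poly3. ring. }
  destruct (jet3_unique _ _ _ _ _ _ _ _ _ J' J3) as (_ & E1 & E2 & E3).
  pose proof (jet3_at_0 _ _ _ _ _ J) as E0. rewrite Cexp_0 in E0.
  set (e0 := taylor_coef 1 Cexp 0) in *. set (e1 := taylor_coef 1 Cexp 1) in *.
  set (e2 := taylor_coef 1 Cexp 2) in *. set (e3 := taylor_coef 1 Cexp 3) in *.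
  clearbody e0 e1 e2 e3.
  assert (F1 : e1 = 1) by (rewrite E1, E0; ring).
  assert (H2 : RtoC 2 <> 0) by (intros E; apply RtoC_inj in E; lra).
  assert (H3 : RtoC 3 <> 0) by (intros E; apply RtoC_inj in E; lra).
  assert (H6 : RtoC 6 <> 0) by (intros E; apply RtoC_inj in E; lra).
  assert (F2 : e2 = / 2).
  { replace e2 with (2 * e2 / 2) by (field; auto). rewrite E2, F1. field; auto. }
  assert (F3 : e3 = / 6).
  { replace e3 with (3 * e3 / 3) by (field; auto). rewrite E3, F2.
    replace (RtoC 6) with (RtoC 2 * RtoC 3) by (rewrite <- RtoC_mult; f_equal; ring). field; auto. }
  now rewrite E0, F1, F2, F3 in J.
Qed.

Lemma is_series_eps_inv (a : nat -> C) (l : C) :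
  is_series (K := C_AbsRing) (V := C_NormedModule) a l ->
  forall eps, (0 < eps)%R -> exists N, forall n, (N <= n)%nat ->
     (Cmod (sum_n (G := C_AbelianMonoid) a n - l) < eps)%R.
Proof.
  intros H eps He.
  pose proof (proj1 (filterlim_locally_ball_norm (K := C_AbsRing) (U := C_NormedModule) _ _) H (mkposreal eps He)) as [N HN].
  exists N. intros n Hn. exact (HN n Hn).
Qed.

Lemma bounded_initial (u : nat -> R) (N : nat) : exists M, (0 <= M)%R /\ forall n, (n < N)%nat -> (u n <= M)%R.
Proof.
  induction N as [|N [M [HM0 HM]]].
  - exists 0%R; split; [lra|]. intros; lia.
  - exists (Rmax M (u N)); split; [eapply Rle_trans; [exact HM0|apply Rmax_l]|].
    intros n Hn. destruct (Nat.eq_dec n N) as [->|]; [apply Rmax_r|].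
    eapply Rle_trans; [apply HM; lia|apply Rmax_l].
Qed.

Lemma series_terms_bounded (a : nat -> C) (l : C) :
  is_series (K := C_AbsRing) (V := C_NormedModule) a l ->
  exists M, (0 <= M)%R /\ forall n, (Cmod (a n) <= M)%R.
Proof.
  intros H. destruct (is_series_eps_inv a l H 1%R Rlt_0_1) as [N HN].
  destruct (bounded_initial (fun n => Cmod (a n)) (S N)) as [M [HM0 HM]].
  exists (M + 2)%R; split; [lra|]. intros n.
  destruct (Nat.le_gt_cases (S N) n) as [Hn|Hn]; [|specialize (HM n Hn); lra].
  destruct n as [|n]; [lia|].
  pose proof (HN n ltac:(lia)) as H1. pose proof (HN (S n) ltac:(lia)) as H2.
  rewrite sum_Sn in H2. change (@plus C_AbelianMonoid) with Cplus in H2.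
  set (s := sum_n a n) in *.
  replace (a (S n)) with ((s + a (S n) - l) + - (s - l)) by ring.
  eapply Rle_trans; [apply Cmod_triangle|]. rewrite Cmod_opp. lra.
Qed.

(** The terms of the series are bounded at a point [w0], so at [w] they are
    dominated by a geometric sequence of ratio [Cmod w / w0 <= 1 / 2]. *)
Lemma jet3_series (L : C -> C) (c : nat -> C) (r : R) : (0 < r)%R ->
  (forall w, (Cmod w < r)%R ->
     is_series (K := C_AbsRing) (V := C_NormedModule) (fun n => c (S n) * w ^ S n) (L w)) ->
  jet3 L 0 (c 1%nat) (c 2%nat) (c 3%nat).
Proof.
  intros Hr H. set (w0 := (r / 2)%R). assert (Hw0 : (0 < w0)%R) by (unfold w0; lra).
  destruct (series_terms_bounded _ _ (H (RtoC w0) ltac:(rewrite Cmod_R, Rabs_pos_eq; unfold w0; lra))) as [M [HM0 HM]].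
  exists (2 * M / w0 ^ 4)%R, (w0 / 2)%R; split; [lra|]. intros w Hw.
  pose proof (Cmod_ge_0 w) as Hm.
  set (q := (Cmod w / w0)%R).
  assert (Hq0 : (0 <= q)%R) by (apply Rdiv_le_0_compat; lra).
  assert (Hq1 : (q <= 1 / 2)%R).
  { apply Rmult_le_reg_r with w0; auto. unfold q, Rdiv. rewrite Rmult_assoc, Rinv_l; lra. }
  set (a := fun n => c (S n) * w ^ S n).
  assert (Ha : forall n, (Cmod (a n) <= M * q ^ S n)%R).
  { intros n. unfold a. specialize (HM n).
    rewrite Cmod_mult, Cmod_pow in *. rewrite Cmod_R, Rabs_pos_eq in HM by lra.
    replace (Cmod w ^ S n)%R with (w0 ^ S n * q ^ S n)%R
      by (rewrite <- Rpow_mult_distr; f_equal; unfold q; field; lra).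
    rewrite <- Rmult_assoc. apply Rmult_le_compat_r; auto. apply pow_le; auto. }
  set (P := poly3 0 (c 1%nat) (c 2%nat) (c 3%nat) w).
  assert (HS : forall m, (Cmod (sum_n (G := C_AbelianMonoid) a (3 + m) - P) <= M * q ^ 4 * (2 - 2 * q ^ S m))%R).
  { induction m as [|m IH].
    - replace (sum_n (G := C_AbelianMonoid) a (3 + 0) - P) with (a 3%nat).
      + eapply Rle_trans; [apply Ha|].
        assert (0 <= M * q ^ 4 * (1 - 2 * q))%R
          by (apply Rmult_le_pos; [apply Rmult_le_pos; auto; apply pow_le; auto|lra]).
        change (S 3) with 4%nat. rewrite pow_1. lra.
      + simpl (3 + 0)%nat. rewrite !sum_Sn, sum_O. change (@plus C_AbelianMonoid) with Cplus.
        unfold a, P, poly3. simpl. ring.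
    - replace (3 + S m)%nat with (S (3 + m)) by lia. rewrite sum_Sn.
      change (@plus C_AbelianMonoid) with Cplus.
      set (s := sum_n a (3 + m)) in *.
      replace (s + a (S (3 + m)) - P) with ((s - P) + a (S (3 + m))) by ring.
      eapply Rle_trans; [apply Cmod_triangle|].
      eapply Rle_trans; [apply Rplus_le_compat; [exact IH|apply Ha]|].
      replace (M * q ^ S (S (3 + m)))%R with (M * q ^ 4 * q ^ S m)%R.
      2:{ replace (S (S (3 + m))) with (4 + S m)%nat by lia. rewrite pow_add. ring. }
      assert (0 <= M * q ^ 4)%R by (apply Rmult_le_pos; auto; apply pow_le; auto).
      assert (0 <= q ^ S m)%R by (apply pow_le; auto).
      change (q ^ S (S m))%R with (q * q ^ S m)%R.
      set (X := (q ^ S m)%R) in *. set (Y := (M * q ^ 4)%R) in *.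
      clearbody X Y. assert (0 <= Y * (X * (1 - 2 * q)))%R by (repeat apply Rmult_le_pos; lra). nra. }
  replace (2 * M / w0 ^ 4 * Cmod w ^ 4)%R with (M * q ^ 4 * 2)%R.
  2:{ unfold q, Rdiv. rewrite Rpow_mult_distr, pow_inv. ring. }
  apply le_epsilon. intros eps He.
  destruct (is_series_eps_inv _ _ (H w ltac:(unfold w0 in *; lra)) eps He) as [N HN].
  specialize (HN (3 + N)%nat ltac:(lia)). specialize (HS N). fold a in HN.
  set (s := sum_n a (3 + N)) in *.
  replace (L w - P) with (- (s - L w) + (s - P)) by ring.
  eapply Rle_trans; [apply Cmod_triangle|]. rewrite Cmod_opp.
  assert (0 <= M * q ^ 4)%R by (apply Rmult_le_pos; auto; apply pow_le; auto).
  assert (0 <= q ^ S N)%R by (apply pow_le; auto). nra.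
Qed.

(** * Coefficients of self-maps of the disk *)

Lemma cmean_Re_le f g : ccurve f -> ccurve g -> (forall t, (Re (f t) <= Re (g t))%R) ->
  (Re (cmean f) <= Re (cmean g))%R.
Proof.
  intros Hf Hg H. pose proof PI_RGT_0.
  assert (E : forall h, Re (cmean h) = (/ (2 * PI) * RInt (fun t => fst (h t)) 0 (2 * PI))%R).
  { intros h. unfold cmean, Cint, Cmult, RtoC, Re; simpl. ring. }
  rewrite !E. apply Rmult_le_compat_l; [left; apply Rinv_0_lt_compat; lra|].
  apply RInt_le; [lra| | |].
  - exact (proj1 (ccont_on_ex_RInt _ _ _ (ccurve_on f Hf))).
  - exact (proj1 (ccont_on_ex_RInt _ _ _ (ccurve_on g Hg))).
  - intros t _. apply H.
Qed.

Lemma cmean_cis_pow (n : nat) : cmean (fun t => cis t ^ S n) = 0.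
Proof.
  assert (D : forall m z, Ccont (fun w => w ^ m) z).
  { induction m; intros z; simpl; [apply Ccont_const|]. apply Ccont_mult; [apply Ccont_id|auto]. }
  assert (Dd : forall m z, ex_Cderive (fun w => w ^ m) z).
  { induction m; intros z; simpl; [eexists; apply is_Cderive_const|].
    destruct (IHm z) as [l Hl]. eexists. apply (is_Cderive_mult (fun w => w)); [apply is_Cderive_id|exact Hl]. }
  rewrite (cmean_ext _ (fun t => (RtoC 1 * cis t) ^ S n)) by (intros; now rewrite Cmult_1_l).
  rewrite (circle_mean (fun w => w ^ S n) 2 0); auto; [simpl; ring|lra].
Qed.

Lemma Re_le_Cmod (z : C) : (Re z <= Cmod z)%R.
Proof. eapply Rle_trans; [apply Rle_abs|apply re_le_Cmod]. Qed.

Lemma mult_conj (z : C) : z * Cconj z = RtoC (Cmod z ^ 2).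
Proof. now rewrite <- Cmod2_conj, RtoC_pow. Qed.

Lemma ccurve_lin (c : C) (f g : R -> C) : ccurve f -> ccurve g -> ccurve (fun t => c * f t + g t).
Proof.
  intros Hf Hg t. apply ccont_plus; [apply ccont_mult; [apply ccont_const|apply Hf]|apply Hg].
Qed.

Lemma cmean_lin (c : C) (f g : R -> C) : ccurve f -> ccurve g ->
  cmean (fun t => c * f t + g t) = c * cmean f + cmean g.
Proof.
  intros Hf Hg. rewrite cmean_plus, cmean_scal; auto.
  intros t. apply ccont_mult; [apply ccont_const|apply Hf].
Qed.

(** Parseval's identity. *)
Lemma cmean_sq_poly2 (q0 q1 q2 : C) :
  cmean (fun t => RtoC (Cmod (q0 + q1 * cis t + q2 * cis t ^ 2) ^ 2)) =
  RtoC (Cmod q0 ^ 2 + Cmod q1 ^ 2 + Cmod q2 ^ 2).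
Proof.
  set (X := fun t => (q1 * Cconj q0 + q2 * Cconj q1) * cis t ^ 1 + q2 * Cconj q0 * cis t ^ 2).
  assert (CX : ccurve X).
  { intros t. apply ccont_plus; (apply ccont_mult; [apply ccont_const|apply ccont_pow, ccont_cis]). }
  assert (Cc : forall n, ccurve (fun t => cis t ^ n)) by (intros n t; apply ccont_pow, ccont_cis).
  assert (MX : cmean X = 0).
  { transitivity ((q1 * Cconj q0 + q2 * Cconj q1) * cmean (fun t => cis t ^ 1) +
      cmean (fun t => q2 * Cconj q0 * cis t ^ 2)).
    - apply (cmean_lin _ _ (fun t => q2 * Cconj q0 * cis t ^ 2)); [apply Cc|].
      intros t. apply ccont_mult; [apply ccont_const|apply Cc].
    - rewrite (cmean_scal _ (fun t => cis t ^ 2) (Cc 2%nat)), !cmean_cis_pow. ring. }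
  rewrite (cmean_ext _ (fun t => RtoC (Cmod q0 ^ 2 + Cmod q1 ^ 2 + Cmod q2 ^ 2) + (X t + Cconj (X t)))).
  - rewrite cmean_plus, cmean_const, cmean_plus, cmean_conj, MX; auto.
    + unfold Cconj, RtoC, Cplus; simpl. f_equal; ring.
    + intros t. now apply ccont_conj.
    + intros t. apply ccont_const.
    + intros t. apply ccont_plus; auto. now apply ccont_conj.
  - intros t. rewrite <- mult_conj, !RtoC_plus, <- !mult_conj. unfold X.
    rewrite !Cplus_conj, !Cmult_conj, !Cpow_conj, !Cplus_conj, !Cmult_conj, !Cconj_conj, cis_conj.
    pose proof (cis_neq_0 t). field. auto.
Qed.

(** The circle mean of [om * e^-it * Q * S^*], where [Q] and [S] are the
    trigonometric polynomials with coefficients [q] and [s], is the left-hand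
    side, because the means of [om] and [om * e^it] vanish.  Pointwise the real
    part is at most [|Q| * |S|], hence at most [(|Q| ^ 2 + |S| ^ 2) / 2]. *)
Lemma toeplitz_contraction (om : R -> C) (b1 b2 b3 : C) :
  ccurve om -> (forall t, (Cmod (om t) <= 1)%R) ->
  cmean om = 0 -> cmean (fun t => om t * cis t) = 0 ->
  cmean (fun t => om t / cis t) = b1 -> cmean (fun t => om t / cis t ^ 2) = b2 ->
  cmean (fun t => om t / cis t ^ 3) = b3 ->
  forall q0 q1 q2 s0 s1 s2 : C,
  (Re (b3 * (q0 * Cconj s2) + b2 * (q0 * Cconj s1 + q1 * Cconj s2) +
       b1 * (q0 * Cconj s0 + q1 * Cconj s1 + q2 * Cconj s2)) <=
   (Cmod q0 ^ 2 + Cmod q1 ^ 2 + Cmod q2 ^ 2 + (Cmod s0 ^ 2 + Cmod s1 ^ 2 + Cmod s2 ^ 2)) / 2)%R.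
Proof.
  intros Hom Hb M0 Mp M1 M2 M3 q0 q1 q2 s0 s1 s2.
  set (Q := fun t => q0 + q1 * cis t + q2 * cis t ^ 2).
  set (S := fun t => s0 + s1 * cis t + s2 * cis t ^ 2).
  set (h := fun t => om t / cis t * (Q t * Cconj (S t))).
  set (k := fun t => RtoC (/ 2) * (RtoC (Cmod (Q t) ^ 2) + RtoC (Cmod (S t) ^ 2))).
  assert (Cp : forall c0 c1 c2, ccurve (fun t => c0 + c1 * cis t + c2 * cis t ^ 2)).
  { intros c0 c1 c2 t. apply ccont_plus; [apply ccont_plus|]; [apply ccont_const| |];
      (apply ccont_mult; [apply ccont_const|]); [apply ccont_cis|apply ccont_pow, ccont_cis]. }
  assert (Csq : forall c0 c1 c2, ccurve (fun t => RtoC (Cmod (c0 + c1 * cis t + c2 * cis t ^ 2) ^ 2))).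
  { intros c0 c1 c2 t. apply ccont_eps. intros eps He.
    assert (HC : ccont (fun t => (c0 + c1 * cis t + c2 * cis t ^ 2) * Cconj (c0 + c1 * cis t + c2 * cis t ^ 2)) t).
    { apply ccont_mult; [apply Cp|]. apply ccont_conj, Cp. }
    destruct (proj1 (ccont_eps _ _) HC eps He) as [d [Hd K]]. exists d; split; auto.
    intros s Hs. rewrite <- !mult_conj. now apply K. }
  assert (Cinvp : forall n, ccurve (fun t => om t / cis t ^ n)).
  { intros n t. apply ccont_div; auto; [apply Cpow_nz, cis_neq_0|apply ccont_pow, ccont_cis]. }
  assert (Ch : ccurve h).
  { intros t. apply ccont_mult.
    - apply ccont_div; auto; [apply cis_neq_0|apply ccont_cis].
    - apply ccont_mult; [apply Cp|apply ccont_conj, Cp]. }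
  assert (Ck : ccurve k).
  { intros t. apply ccont_mult; [apply ccont_const|]. apply ccont_plus; [apply Csq|apply Csq]. }
  assert (Eh : cmean h = b3 * (q0 * Cconj s2) + b2 * (q0 * Cconj s1 + q1 * Cconj s2) +
       b1 * (q0 * Cconj s0 + q1 * Cconj s1 + q2 * Cconj s2)).
  { rewrite (cmean_ext h (fun t => (q0 * Cconj s2) * (om t / cis t ^ 3) +
      ((q0 * Cconj s1 + q1 * Cconj s2) * (om t / cis t ^ 2) +
       ((q0 * Cconj s0 + q1 * Cconj s1 + q2 * Cconj s2) * (om t / cis t) +
        ((q1 * Cconj s0 + q2 * Cconj s1) * om t + (q2 * Cconj s0) * (om t * cis t)))))).
    - assert (C1 : ccurve (fun t => om t / cis t)).
      { intros t. apply ccont_div; auto; [apply cis_neq_0|apply ccont_cis]. }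
      assert (C2 : ccurve (fun t => om t * cis t)).
      { intros t. apply ccont_mult; auto. apply ccont_cis. }
      set (g4 := fun t => (q2 * Cconj s0) * (om t * cis t)).
      assert (C4 : ccurve g4) by (intros t; apply ccont_mult; [apply ccont_const|apply C2]).
      set (g3 := fun t => (q1 * Cconj s0 + q2 * Cconj s1) * om t + g4 t).
      assert (C3 : ccurve g3) by exact (ccurve_lin _ _ _ Hom C4).
      set (g2 := fun t => (q0 * Cconj s0 + q1 * Cconj s1 + q2 * Cconj s2) * (om t / cis t) + g3 t).
      assert (C5 : ccurve g2) by exact (ccurve_lin _ _ _ C1 C3).
      set (g1 := fun t => (q0 * Cconj s1 + q1 * Cconj s2) * (om t / cis t ^ 2) + g2 t).
      assert (C6 : ccurve g1) by exact (ccurve_lin _ _ _ (Cinvp 2%nat) C5).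
      transitivity (q0 * Cconj s2 * cmean (fun t => om t / cis t ^ 3) + cmean g1);
        [exact (cmean_lin _ _ _ (Cinvp 3%nat) C6)|].
      replace (cmean g1) with ((q0 * Cconj s1 + q1 * Cconj s2) * cmean (fun t => om t / cis t ^ 2) + cmean g2)
        by (symmetry; exact (cmean_lin _ _ _ (Cinvp 2%nat) C5)).
      replace (cmean g2) with ((q0 * Cconj s0 + q1 * Cconj s1 + q2 * Cconj s2) * cmean (fun t => om t / cis t) + cmean g3)
        by (symmetry; exact (cmean_lin _ _ _ C1 C3)).
      replace (cmean g3) with ((q1 * Cconj s0 + q2 * Cconj s1) * cmean om + cmean g4)
        by (symmetry; exact (cmean_lin _ _ _ Hom C4)).
      replace (cmean g4) with (q2 * Cconj s0 * cmean (fun t => om t * cis t))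
        by (symmetry; exact (cmean_scal _ _ C2)).
      rewrite M0, Mp, M1, M2, M3. ring.
    - intros t. unfold h, Q, S.
      rewrite !Cplus_conj, !Cmult_conj, !Cpow_conj, cis_conj.
      pose proof (cis_neq_0 t). field. auto. }
  assert (Ek : cmean k = RtoC ((Cmod q0 ^ 2 + Cmod q1 ^ 2 + Cmod q2 ^ 2 + (Cmod s0 ^ 2 + Cmod s1 ^ 2 + Cmod s2 ^ 2)) / 2)).
  { unfold k, Q, S.
    rewrite cmean_scal by (intros t; exact (ccont_plus _ _ t (Csq q0 q1 q2 t) (Csq s0 s1 s2 t))).
    rewrite (cmean_plus _ _ (Csq q0 q1 q2) (Csq s0 s1 s2)), !cmean_sq_poly2.
    rewrite <- RtoC_plus, <- RtoC_mult. f_equal. field. }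
  rewrite <- Eh.
  replace ((Cmod q0 ^ 2 + Cmod q1 ^ 2 + Cmod q2 ^ 2 + (Cmod s0 ^ 2 + Cmod s1 ^ 2 + Cmod s2 ^ 2)) / 2)%R
    with (Re (cmean k)) by (rewrite Ek; reflexivity).
  apply cmean_Re_le; auto. intros t.
  eapply Rle_trans; [apply Re_le_Cmod|].
  unfold h, k. rewrite !Cmod_mult, Cmod_div, Cmod_cis, Cmod_conj by apply cis_neq_0.
  rewrite <- RtoC_plus, <- RtoC_mult. simpl Re.
  specialize (Hb t). pose proof (Cmod_ge_0 (om t)).
  set (x := Cmod (Q t)). set (y := Cmod (S t)).
  assert (0 <= x)%R by apply Cmod_ge_0. assert (0 <= y)%R by apply Cmod_ge_0.
  unfold Rdiv. rewrite Rinv_1, Rmult_1_r.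
  apply Rle_trans with (1 * (x * y))%R; [apply Rmult_le_compat_r; auto; nra|].
  pose proof (pow2_ge_0 (x - y)). nra.
Qed.

Lemma unit_phase_exists (z : C) : exists s : C, Cmod s = 1%R /\ z * Cconj s = RtoC (Cmod z).
Proof.
  destruct (classic (z = 0)) as [->|Hz].
  - exists 1. rewrite Cmod_1, Cmod_0. split; auto. ring.
  - assert (Hm : (0 < Cmod z)%R) by now apply Cmod_gt_0.
    assert (Hm0 : RtoC (Cmod z) <> 0) by (intros E; apply RtoC_inj in E; lra).
    exists (z / RtoC (Cmod z)). split.
    + rewrite Cmod_div, Cmod_R, Rabs_pos_eq by (auto; lra). field. lra.
    + unfold Cdiv. rewrite Cmult_conj, Cinv_conj by auto.
      replace (Cconj (RtoC (Cmod z))) with (RtoC (Cmod z)) by (unfold Cconj, RtoC; simpl; f_equal; ring).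
      rewrite Cmult_assoc, mult_conj. simpl pow. rewrite Rmult_1_r, RtoC_mult. field. auto.
Qed.

(** Let [s] be the phase of the coefficient to be bounded.  The vectors below
    make the terms with [b2] (resp. [b3]) and those with [b1 * Cconj b1]
    positive; the factor [tau = 1 / (1 + Cmod b1)] is the one that minimizes
    the resulting bound on [b3]. *)
Lemma schwarz_coef_bounds (b1 b2 b3 : C) :
  (forall q0 q1 q2 s0 s1 s2 : C,
  (Re (b3 * (q0 * Cconj s2) + b2 * (q0 * Cconj s1 + q1 * Cconj s2) +
       b1 * (q0 * Cconj s0 + q1 * Cconj s1 + q2 * Cconj s2)) <=
   (Cmod q0 ^ 2 + Cmod q1 ^ 2 + Cmod q2 ^ 2 + (Cmod s0 ^ 2 + Cmod s1 ^ 2 + Cmod s2 ^ 2)) / 2)%R) ->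
  (Cmod b2 <= 1 - Cmod b1 ^ 2)%R /\
  (Cmod b3 <= 1 - Cmod b1 ^ 2 - Cmod b2 ^ 2 / (1 + Cmod b1))%R.
Proof.
  intros H. set (x := Cmod b1). set (y := Cmod b2).
  assert (Hx : (0 <= x)%R) by apply Cmod_ge_0.
  assert (C0 : Cconj 0 = 0) by (unfold Cconj, RtoC; simpl; f_equal; ring).
  assert (C1 : Cconj 1 = 1) by (unfold Cconj, RtoC; simpl; f_equal; ring).
  split.
  - destruct (unit_phase_exists b2) as (s & Hs & Es).
    specialize (H 1 (Cconj b1 * s) 0 b1 s 0).
    rewrite !Cmod_mult, Cmod_conj, Cmod_1, Cmod_0, Hs in H. fold x in H.
    match type of H with (Re ?e <= _)%R => replace e with (RtoC (y + 2 * x ^ 2)) in H end.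
    + simpl Re in H. unfold Re, RtoC in H; simpl in H. simpl. nra.
    + rewrite RtoC_plus, RtoC_mult.
      replace (RtoC (x ^ 2)) with (b1 * Cconj b1) by apply mult_conj.
      unfold y. rewrite <- Es, C0.
      assert (Ess : s * Cconj s = 1) by (rewrite mult_conj, Hs; f_equal; ring).
      replace (b1 * (1 * Cconj b1 + Cconj b1 * s * Cconj s + 0 * 0)) with
        (b1 * (Cconj b1 + Cconj b1 * (s * Cconj s))) by ring.
      rewrite Ess. ring.
  - destruct (unit_phase_exists b3) as (s & Hs & Es).
    assert (Ess : s * Cconj s = 1) by (rewrite mult_conj, Hs; f_equal; ring).
    set (tau := (/ (1 + x))%R).
    assert (Htau : (0 < tau)%R) by (apply Rinv_0_lt_compat; lra).
    assert (Htx : (tau * (1 + x) = 1)%R) by (unfold tau; field; lra).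
    assert (Ct : Cconj (RtoC tau) = RtoC tau) by (unfold Cconj, RtoC; simpl; f_equal; ring).
    (* Only the term [b1 * q1 * s1^*] has an unknown phase; it is estimated by
       its modulus. *)
    specialize (H 1 (Cconj b2 * s * RtoC tau) (Cconj b1 * s) b1 (b2 * RtoC tau) s).
    rewrite !Cmod_mult, !Cmod_conj, Cmod_1, Hs, Cmod_R, Rabs_pos_eq in H by lra. fold x y in H.
    match type of H with (Re ?e <= _)%R => replace e with
      (RtoC (Cmod b3 + 2 * tau * y ^ 2 + 2 * x ^ 2) +
        b1 * (Cconj b2 * s * RtoC tau * Cconj (b2 * RtoC tau))) in H end.
    + assert (HR : (- (x * (y ^ 2 * tau ^ 2)) <= Re (b1 * (Cconj b2 * s * RtoC tau * Cconj (b2 * RtoC tau))))%R).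
      { set (e := b1 * _). assert (Cmod e = x * (y ^ 2 * tau ^ 2))%R.
        { unfold e. rewrite !Cmod_mult, !Cmod_conj, Cmod_mult, Hs, Cmod_R, Rabs_pos_eq by lra.
          fold x y. ring. }
        pose proof (re_le_Cmod e). apply Rabs_le_between in H1. lra. }
      set (e := Re (b1 * _)) in HR.
      replace (Re _) with (Cmod b3 + 2 * tau * y ^ 2 + 2 * x ^ 2 + e)%R in H by reflexivity.
      clearbody e.
      replace (y ^ 2 / (1 + x))%R with (y ^ 2 * tau)%R by reflexivity.
      assert (Hk : (x * (y ^ 2 * tau ^ 2) + tau ^ 2 * y ^ 2 = y ^ 2 * tau)%R).
      { replace (x * (y ^ 2 * tau ^ 2) + tau ^ 2 * y ^ 2)%R with (y ^ 2 * tau * (tau * (1 + x)))%R by ring.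
        rewrite Htx. ring. }
      assert (H' : (Cmod b3 + 2 * tau * y ^ 2 + 2 * x ^ 2 + e <= 1 + tau ^ 2 * y ^ 2 + x ^ 2)%R).
      { eapply Rle_trans; [exact H|]. right. field. }
      lra.
    + rewrite !RtoC_plus, !RtoC_mult.
      replace (RtoC (x ^ 2)) with (b1 * Cconj b1) by apply mult_conj.
      replace (RtoC (y ^ 2)) with (b2 * Cconj b2) by apply mult_conj.
      rewrite <- Es. rewrite !Cmult_conj, Ct.
      transitivity (b3 * Cconj s + RtoC tau * (b2 * Cconj b2) * (1 + s * Cconj s) +
         b1 * Cconj b1 * (1 + s * Cconj s) + b1 * (Cconj b2 * s * RtoC tau * (Cconj b2 * RtoC tau))).
      * rewrite Ess. ring.
      * ring.
Qed.

Definition schwarz_functional (b1 b2 b3 : C) : C :=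
  / 2 * b1 * b3 - 3 / 2 * (b1 * b1 * b2) - b2 * b2 + / 12 * (b1 * b1 * b1 * b1).

Lemma Cmod_RtoC_div_pos (a b : R) : (0 <= a)%R -> (0 < b)%R -> Cmod (RtoC a / RtoC b) = (a / b)%R.
Proof.
  intros Ha Hb. rewrite <- RtoC_div by lra. rewrite Cmod_R, Rabs_pos_eq; auto.
  now apply Rdiv_le_0_compat.
Qed.

(** With [x], [y], [z] the three moduli and [u = y ^ 2 / (1 + x)], the terms
    containing [u] add up to [u * (1 + x / 2)], which grows with [y]. *)
Lemma schwarz_functional_bound (b1 b2 b3 : C) :
  (Cmod b2 <= 1 - Cmod b1 ^ 2)%R ->
  (Cmod b3 <= 1 - Cmod b1 ^ 2 - Cmod b2 ^ 2 / (1 + Cmod b1))%R ->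
  (Cmod (schwarz_functional b1 b2 b3) <= 1)%R.
Proof.
  intros H2 H3. unfold schwarz_functional.
  assert (T : (Cmod (/ 2 * b1 * b3 - 3 / 2 * (b1 * b1 * b2) - b2 * b2 + / 12 * (b1 * b1 * b1 * b1)) <=
    / 2 * Cmod b1 * Cmod b3 + 3 / 2 * (Cmod b1 * Cmod b1 * Cmod b2) + Cmod b2 * Cmod b2 +
    / 12 * (Cmod b1 * Cmod b1 * Cmod b1 * Cmod b1))%R).
  { unfold Cminus.
    eapply Rle_trans; [apply Cmod_triangle|]. apply Rplus_le_compat.
    - eapply Rle_trans; [apply Cmod_triangle|]. apply Rplus_le_compat.
      + eapply Rle_trans; [apply Cmod_triangle|]. rewrite Cmod_opp, !Cmod_mult.
        rewrite Cmod_RtoC_div_pos, <- RtoC_inv, Cmod_R, Rabs_pos_eq by lra. lra.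
      + rewrite Cmod_opp, Cmod_mult. lra.
    - rewrite !Cmod_mult, <- RtoC_inv, Cmod_R, Rabs_pos_eq by lra. lra. }
  eapply Rle_trans; [exact T|]. clear T.
  pose proof (Cmod_ge_0 b1) as Hx. pose proof (Cmod_ge_0 b2) as Hy. pose proof (Cmod_ge_0 b3) as Hz.
  revert Hx Hy Hz H2 H3. generalize (Cmod b1) (Cmod b2) (Cmod b3). clear.
  intros x y z Hx Hy Hz H2 H3.
  assert (Hx1 : (x <= 1)%R) by nra.
  set (u := (y ^ 2 / (1 + x))%R) in *.
  assert (Hu : (y ^ 2 = u * (1 + x))%R) by (unfold u; field; lra).
  assert (Hu1 : (u <= (1 - x) * (1 - x ^ 2))%R).
  { apply Rmult_le_reg_r with (1 + x)%R; [lra|]. rewrite <- Hu.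
    replace ((1 - x) * (1 - x ^ 2) * (1 + x))%R with ((1 - x ^ 2) ^ 2)%R by ring.
    apply pow_incr. lra. }
  replace (y * y)%R with (u * (1 + x))%R by (rewrite <- Hu; ring).
  assert (A : (/ 2 * x * z <= / 2 * x * (1 - x ^ 2 - u))%R) by (apply Rmult_le_compat_l; lra).
  assert (B : (3 / 2 * (x * x * y) <= 3 / 2 * (x * x * (1 - x ^ 2)))%R).
  { apply Rmult_le_compat_l; [lra|]. apply Rmult_le_compat_l; [nra|lra]. }
  assert (D : (u * (1 + x / 2) <= (1 - x) * (1 - x ^ 2) * (1 + x / 2))%R)
    by (apply Rmult_le_compat_r; lra).
  assert (E : (/ 2 * x * (1 - x ^ 2) + 3 / 2 * (x * x * (1 - x ^ 2)) + (1 - x) * (1 - x ^ 2) * (1 + x / 2) +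
     / 12 * (x * x * x * x) = 1 - 11 / 12 * (x * x) ^ 2)%R) by field.
  pose proof (pow2_ge_0 (x * x)). lra.
Qed.

(** On the circle of radius [rho] the coefficients [b n] become
    [rho ^ n * b n], and the functional is homogeneous of degree four.  So
    [rho ^ 4] times its modulus is at most 1 for every [rho < 1]. *)
Lemma schwarz_functional_le_1 (W : C -> C) (b0 b1 b2 b3 : C) :
  holo_off_0 1 W -> (forall z, (Cmod z < 1)%R -> (Cmod (W z) <= 1)%R) -> W 0 = 0 ->
  jet3 W b0 b1 b2 b3 -> (Cmod (schwarz_functional b1 b2 b3) <= 1)%R.
Proof.
  intros HW HW1 HW0 HJ.
  assert (Hrho : forall rho, (0 < rho < 1)%R -> (rho ^ 4 * Cmod (schwarz_functional b1 b2 b3) <= 1)%R).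
  { intros rho Hr. set (p := RtoC rho).
    destruct (jet3_unique _ _ _ _ _ _ _ _ _ HJ (taylor_jet 1 rho W HW Hr)) as (_ & E1 & E2 & E3).
    set (om := fun t => W (RtoC rho * cis t)).
    assert (Com : ccurve om) by (apply (ccurve_holo 1); auto).
    assert (Hp : p <> 0) by (intros E; apply RtoC_inj in E; lra).
    assert (Coef : forall n, cmean (fun t => om t / cis t ^ n) = p ^ n * taylor_coef rho W n).
    { intros n. unfold taylor_coef. rewrite <- cmean_scal by (apply (ccurve_taylor_coef 1); auto).
      apply cmean_ext. intros t. unfold om. fold p. pose proof (cis_neq_0 t).
      rewrite Cpow_mult_l. pose proof (Cpow_nz (cis t) n H). pose proof (Cpow_nz p n Hp). field. auto. }
    replace (rho ^ 4 * Cmod (schwarz_functional b1 b2 b3))%R with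
      (Cmod (schwarz_functional (p * b1) (p ^ 2 * b2) (p ^ 3 * b3))).
    2:{ replace (schwarz_functional (p * b1) (p ^ 2 * b2) (p ^ 3 * b3)) with
          (p ^ 4 * schwarz_functional b1 b2 b3) by (unfold schwarz_functional, Cdiv; ring).
        unfold p. rewrite Cmod_mult, Cmod_pow, Cmod_R, Rabs_pos_eq; lra. }
    assert (MW : forall g : C -> C, (forall z, (Cmod z < 1)%R -> Ccont g z) ->
      (forall z, (0 < Cmod z < 1)%R -> Cmod z <> 0%R -> ex_Cderive g z) ->
      cmean (fun t => g (RtoC rho * cis t)) = g 0).
    { intros g H1 H2. apply (circle_mean g 1 0); auto. lra. }
    assert (B : (Cmod (p ^ 2 * b2) <= 1 - Cmod (p * b1) ^ 2)%R /\
      (Cmod (p ^ 3 * b3) <= 1 - Cmod (p * b1) ^ 2 - Cmod (p ^ 2 * b2) ^ 2 / (1 + Cmod (p * b1)))%R).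
    { destruct HW as [HWc HWd].
      apply schwarz_coef_bounds, (toeplitz_contraction om); auto.
      - intros t. apply HW1. rewrite Cmod_circle; lra.
      - unfold om. rewrite MW; auto. intros z Hz _. apply HWd; [lra|]. apply Cmod_gt_0; lra.
      - assert (E : p * cmean (fun t => om t * cis t) = 0).
        { rewrite <- cmean_scal by (intros t; apply ccont_mult; [apply Com|apply ccont_cis]).
          rewrite (cmean_ext _ (fun t => W (RtoC rho * cis t) * (RtoC rho * cis t)))
            by (intros; unfold om, p; ring).
          rewrite (MW (fun z => W z * z)); [ring| |].
          - intros z Hz. apply Ccont_mult; [auto|apply Ccont_id].
          - intros z Hz _. destruct (HWd z) as [l Hl]; [lra|apply Cmod_gt_0; lra|].
            eexists. apply (is_Cderive_mult W (fun z => z)); [exact Hl|apply is_Cderive_id]. }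
        replace (cmean _) with (p * cmean (fun t => om t * cis t) / p) by (field; auto).
        rewrite E. field; auto.
      - rewrite E1. replace (p * taylor_coef rho W 1) with (p ^ 1 * taylor_coef rho W 1) by ring. rewrite <- Coef.
        apply cmean_ext. intros t. simpl. now rewrite Cmult_1_r.
      - rewrite E2. apply Coef.
      - rewrite E3. apply Coef. }
    apply schwarz_functional_bound; tauto. }
  set (E := Cmod (schwarz_functional b1 b2 b3)) in *.
  destruct (Rle_lt_dec E 1) as [|HE]; auto. exfalso.
  (* [h] is so small that [(1 - 4 * h) * E = (1 + E) / 2], which exceeds 1. *)
  set (h := ((E - 1) / (8 * E))%R).
  assert (Hh : (h * (8 * E) = E - 1)%R) by (unfold h; field; lra).
  assert (Hh0 : (0 < h)%R) by (apply Rdiv_lt_0_compat; lra).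
  assert (Hh1 : (h < 1)%R) by nra.
  specialize (Hrho (1 - h)%R ltac:(lra)).
  (* Bernoulli's inequality, applied twice *)
  assert (B2 : (1 - 2 * h <= (1 - h) ^ 2)%R) by (pose proof (pow2_ge_0 h); nra).
  assert (B4 : (1 - 4 * h <= (1 - h) ^ 4)%R).
  { replace ((1 - h) ^ 4)%R with ((1 - h) ^ 2 * (1 - h) ^ 2)%R by ring.
    set (s := ((1 - h) ^ 2)%R) in *. clearbody s. pose proof (pow2_ge_0 (s - 1)). nra. }
  assert ((1 - 4 * h) * E <= (1 - h) ^ 4 * E)%R by (apply Rmult_le_compat_r; lra).
  lra.
Qed.

(** * Functions starlike with respect to symmetric points *)

Definition quot_id (f : C -> C) (z : C) : C := if Req_EM_T (Cmod z) 0 then 1 else f z / z.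

Lemma quot_id_0 (f : C -> C) : quot_id f 0 = 1.
Proof. unfold quot_id. rewrite Cmod_0. now destruct (Req_EM_T 0 0). Qed.

Lemma quot_id_neq (f : C -> C) (z : C) : z <> 0 -> quot_id f z = f z / z.
Proof.
  intros H. unfold quot_id. destruct (Req_EM_T _ _) as [E|]; auto.
  exfalso. apply H. now apply Cmod_eq_0.
Qed.

Lemma quot_id_spec (f : C -> C) : f 0 = 0 -> forall z : C, f z = z * quot_id f z.
Proof.
  intros H z. destruct (classic (z = 0)) as [->|Hz].
  - rewrite H. ring.
  - rewrite quot_id_neq by auto. field. auto.
Qed.

(** The quotient extends continuously to 0 because [f] has derivative 1 there. *)
Lemma quot_id_holo (f : C -> C) : class_A f -> holo_off_0 1 (quot_id f).
Proof.
  intros (Hh & H0 & H1).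
  assert (Hd : forall z, (Cmod z < 1)%R -> z <> 0 -> ex_Cderive (quot_id f) z).
  { intros z Hz Hz0. destruct (Hh z Hz) as [l Hl].
    eexists. eapply (is_Cderive_ext_loc (fun w => f w / w) _ z _ (Cmod z)).
    - now apply Cmod_gt_0.
    - intros w Hw. symmetry. apply quot_id_neq. intros ->.
      replace (0 - z) with (- z) in Hw by ring. rewrite Cmod_opp in Hw. lra.
    - apply (is_Cderive_div f (fun w => w)); auto; [exact Hl|apply is_Cderive_id]. }
  split; auto. intros z Hz. destruct (classic (z = 0)) as [->|Hz0].
  2:{ apply ex_Cderive_cont; auto. }
  assert (HD : is_Cderive f 0 1).
  { rewrite <- H1. apply C_derive_correct; [exact 0|]. apply Hh. rewrite Cmod_0; lra. }
  rewrite is_Cderive_eps in HD. intros eps He.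
  destruct (HD (eps / 2)%R ltac:(lra)) as [d [Hdp K]]. exists d; split; auto.
  intros w Hw. rewrite quot_id_0. destruct (classic (w = 0)) as [->|Hw0].
  - rewrite quot_id_0. replace (1 - 1) with (RtoC 0) by ring. now rewrite Cmod_0.
  - specialize (K w Hw). rewrite H0 in K. rewrite quot_id_neq by auto.
    replace (w - 0) with w in K by ring.
    replace (f w - 0 - 1 * w) with ((f w / w - 1) * w) in K by (field; auto).
    rewrite Cmod_mult in K. assert (0 < Cmod w)%R by now apply Cmod_gt_0.
    apply Rle_lt_trans with (eps / 2)%R; [|lra]. apply Rmult_le_reg_r with (Cmod w); auto.
Qed.

Lemma C_derive_quot_id (f : C -> C) (z : C) : class_A f -> (Cmod z < 1)%R ->
  C_derive f z = quot_id f z + z * C_derive (quot_id f) z.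
Proof.
  intros Hf Hz. apply is_C_derive_unique.
  destruct (holo_derive 1 (quot_id f) z (quot_id_holo f Hf) Hz) as [Hd _].
  apply (is_Cderive_ext_loc (fun w => w * quot_id f w) f z _ 1); [lra| |].
  - intros w _. symmetry. apply quot_id_spec, Hf.
  - replace (quot_id f z) with (1 * quot_id f z) at 1 by ring.
    apply (is_Cderive_mult (fun w => w)); [apply is_Cderive_id|exact Hd].
Qed.

Lemma cayley_lt_1 (p : C) : (0 < Re p)%R -> p + 1 <> 0 /\ (Cmod ((p - 1) / (p + 1)) < 1)%R.
Proof.
  intros Hp.
  assert (H1 : p + 1 <> 0).
  { intros E. apply (f_equal Re) in E. unfold Re in *; simpl in E. lra. }
  split; auto. rewrite Cmod_div by auto.
  assert (Hm : (0 < Cmod (p + 1))%R) by now apply Cmod_gt_0.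
  apply Rmult_lt_reg_r with (Cmod (p + 1)); auto.
  unfold Rdiv. rewrite Rmult_assoc, Rinv_l, Rmult_1_l, Rmult_1_r by lra.
  unfold Cmod. apply sqrt_lt_1_alt.
  split; [apply Rplus_le_le_0_compat; apply pow2_ge_0|].
  destruct p as [x y]; unfold Re in *; simpl in *. lra.
Qed.

(** [W] is the Cayley transform of [f1 / G], where [f1] is the derivative of [f]
    and [G z] is half of [(f z - f (- z)) / z]. *)
Theorem starlike_symmetric_coefs (f : C -> C) : starlike_symmetric f ->
  exists b1 b2 b3 : C, (Cmod (schwarz_functional b1 b2 b3) <= 1)%R /\
    jet3 (quot_id f) 1 b1 (b2 + b1 * b1) (/ 2 * b3 + 3 / 2 * (b1 * b2) + b1 * b1 * b1).
Proof.
  intros [HA HS]. set (k := quot_id f).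
  assert (Hk : holo_off_0 1 k) by now apply quot_id_holo.
  assert (Hkd : forall z, (Cmod z < 1)%R -> is_Cderive k z (C_derive k z) /\ ex_Cderive (C_derive k) z)
    by (intros; now apply (holo_derive 1)).
  set (f1 := fun z => k z + z * C_derive k z).
  set (G := fun z => / 2 * (k z + k (-1 * z))).
  assert (H20 : RtoC 2 <> 0) by (intros E; apply RtoC_inj in E; lra).
  assert (Hpos : forall z, (Cmod z < 1)%R -> G z <> 0 /\ (0 < Re (f1 z / G z))%R).
  { intros z Hz. destruct (classic (z = 0)) as [->|Hz0].
    - assert (EG : G 0 = 1).
      { unfold G. replace (-1 * 0) with (RtoC 0) by ring. unfold k. rewrite quot_id_0. field; auto. }
      rewrite EG. unfold f1. replace (k 0 + 0 * C_derive k 0) with (RtoC 1) by (unfold k; rewrite quot_id_0; ring).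
      replace (1 / 1) with (RtoC 1) by (field; auto). split; [intros E; apply RtoC_inj in E; lra|simpl; lra].
    - destruct (HS z Hz Hz0) as [HN HP].
      assert (EG : f z - f (- z) = 2 * z * G z).
      { rewrite (quot_id_spec f (proj1 (proj2 HA)) z), (quot_id_spec f (proj1 (proj2 HA)) (- z)).
        unfold G. fold k. replace (-1 * z) with (- z) by ring. field; auto. }
      rewrite EG in HN, HP.
      assert (HG : G z <> 0) by (intros E; apply HN; rewrite E; ring).
      split; auto.
      rewrite (C_derive_quot_id f z HA Hz) in HP. fold k in HP. change (k z + z * C_derive k z) with (f1 z) in HP.
      replace (z * f1 z / (2 * z * G z)) with (RtoC (/ 2) * (f1 z / G z)) in HP
        by (rewrite RtoC_inv by lra; field; auto).
      unfold Re, Cmult, RtoC in *. simpl in *. lra. }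
  set (W := fun z => (f1 z - G z) / (f1 z + G z)).
  assert (Hden : forall z, (Cmod z < 1)%R -> f1 z + G z <> 0 /\ (Cmod (W z) < 1)%R).
  { intros z Hz. destruct (Hpos z Hz) as [HG HP]. destruct (cayley_lt_1 _ HP) as [H1 H2].
    assert (E1 : f1 z + G z <> 0).
    { intros E. apply H1. replace (f1 z / G z + 1) with ((f1 z + G z) / G z) by (field; auto).
      rewrite E. field; auto. }
    split; auto. unfold W. replace ((f1 z - G z) / (f1 z + G z)) with ((f1 z / G z - 1) / (f1 z / G z + 1)); auto.
    field; auto. }
  assert (Hf1 : forall z, (Cmod z < 1)%R -> ex_Cderive f1 z).
  { intros z Hz. destruct (Hkd z Hz) as [D1 [l D2]]. eexists.
    apply (is_Cderive_plus k (fun z => z * C_derive k z)); [exact D1|].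
    apply (is_Cderive_mult (fun z => z)); [apply is_Cderive_id|exact D2]. }
  assert (HG1 : forall z, (Cmod z < 1)%R -> ex_Cderive G z).
  { intros z Hz. destruct (Hkd z Hz) as [D1 _].
    destruct (Hkd (-1 * z)) as [D2 _]; [rewrite Cmod_mult, Cmod_R, Rabs_m1; lra|].
    eexists. apply (is_Cderive_mult (fun _ => / 2)); [apply is_Cderive_const|].
    apply (is_Cderive_plus k (fun z => k (-1 * z))); [exact D1|].
    apply (is_Cderive_comp k (fun z => -1 * z)); [exact D2|].
    apply (is_Cderive_mult (fun _ => RtoC (-1)) (fun z => z)); [apply is_Cderive_const|apply is_Cderive_id]. }
  assert (HWd : forall z, (Cmod z < 1)%R -> ex_Cderive W z).
  { intros z Hz. destruct (Hf1 z Hz) as [l1 D1]. destruct (HG1 z Hz) as [l2 D2].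
    eexists. apply (is_Cderive_div (fun z => f1 z - G z) (fun z => f1 z + G z)).
    - now apply Hden.
    - apply (is_Cderive_minus f1 G); eassumption.
    - apply (is_Cderive_plus f1 G); eassumption. }
  assert (HW : holo_off_0 1 W) by (split; intros; [apply ex_Cderive_cont|]; auto).
  assert (Hhalf : (0 < / 2 < 1)%R) by lra.
  pose proof (taylor_jet 1 (/ 2) k Hk Hhalf) as Jk.
  pose proof (taylor_jet_derive 1 (/ 2) k Hk Hhalf) as Jk'.
  pose proof (taylor_jet 1 (/ 2) W HW Hhalf) as JW.
  assert (E0 := jet3_at_0 _ _ _ _ _ Jk). unfold k in E0 at 2. rewrite quot_id_0 in E0.
  revert Jk Jk' JW E0.
  generalize (taylor_coef (/ 2) k 0) (taylor_coef (/ 2) k 1) (taylor_coef (/ 2) k 2) (taylor_coef (/ 2) k 3)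
    (taylor_coef (/ 2) W 0) (taylor_coef (/ 2) W 1) (taylor_coef (/ 2) W 2) (taylor_coef (/ 2) W 3).
  intros a1 a2 a3 a4 b0 b1 b2 b3 Jk Jk' JW ->.
  assert (HW0 : W 0 = 0).
  { unfold W, f1, G. replace (-1 * 0) with (RtoC 0) by ring. unfold k. rewrite quot_id_0. field; auto. }
  assert (E0 := jet3_at_0 _ _ _ _ _ JW). rewrite HW0 in E0. subst b0.
  exists b1, b2, b3. split.
  { apply (schwarz_functional_le_1 W 0); auto. intros z Hz. left. now apply Hden. }
  pose proof (jet3_plus _ _ _ _ _ _ _ _ _ _ Jk Jk') as Jf.
  pose proof (jet3_scal (/ 2) _ _ _ _ _ (jet3_plus _ _ _ _ _ _ _ _ _ _ Jk
    (jet3_comp k _ _ _ _ _ _ _ _ Jk (jet3_poly 0 (-1) 0 0)))) as JG0.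
  assert (JG : jet3 G 1 0 a3 0).
  { eapply jet3_ext_coef; [..|eapply (jet3_ext_loc _ _ _ _ _ _ 1); [lra| |exact JG0]].
    - field; auto.
    - ring.
    - field; auto.
    - ring.
    - intros z _. unfold G, poly3. do 3 f_equal. ring. }
  pose proof (jet3_plus _ _ _ _ _ _ _ _ _ _ Jf (jet3_scal (-1) _ _ _ _ _ JG)) as JN.
  pose proof (jet3_mult _ _ _ _ _ _ _ _ _ _ JW (jet3_plus _ _ _ _ _ _ _ _ _ _ Jf JG)) as JM.
  eapply (jet3_ext_loc _ (fun z => k z + z * C_derive k z + -1 * G z) _ _ _ _ 1) in JM; [|lra|].
  2:{ intros z Hz. simpl. change (k z + z * C_derive k z) with (f1 z). unfold W.
      pose proof (proj1 (Hden z Hz)). field; auto. }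
  destruct (jet3_unique _ _ _ _ _ _ _ _ _ JM JN) as (_ & E1 & E2 & E3).
  assert (D : forall x y : C, 2 * x = 2 * y -> x = y).
  { intros x y E. replace x with (2 * x / 2) by (field; auto). rewrite E. field; auto. }
  assert (F1 : a2 = b1).
  { apply D. transitivity (a2 + a2 + -1 * 0); [ring|]. rewrite <- E1. ring. }
  assert (F2 : a3 = b2 + b1 * b1).
  { apply D. transitivity (a3 + 2 * a3 + -1 * a3); [ring|]. rewrite <- E2, F1. ring. }
  assert (F3 : a4 = / 2 * b3 + 3 / 2 * (b1 * b2) + b1 * b1 * b1).
  { apply D, D. transitivity (a4 + 3 * a4 + -1 * 0); [ring|]. rewrite <- E3, F2, F1. field; auto. }
  now rewrite F1, F2, F3 in Jk.
Qed.

(** * Logarithmic coefficients of the inverse function *)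

(** With [M = Cexp o L] one has [F w = w * M w], and [f (F w) = w] reads
    [M w * quot_id f (w * M w) = 1].  Comparing the first four coefficients
    determines those of [L]. *)
Lemma inverse_log_coefs (f F : C -> C) (Gamma : nat -> C) (a2 a3 a4 : C) :
  f 0 = 0 -> jet3 (quot_id f) 1 a2 a3 a4 -> inverse_near_0 f F -> log_coefficients F Gamma ->
  2 * Gamma 1%nat = - a2 /\ 2 * Gamma 2%nat = 3 / 2 * (a2 * a2) - a3 /\
  2 * Gamma 3%nat = 4 * (a2 * a3) - a4 - 10 / 3 * (a2 * a2 * a2).
Proof.
  intros Hf0 Jk (r1 & Hr1 & _ & HF & _) (r & L & Hr & (_ & HL0 & HE) & Hs).
  assert (H20 : RtoC 2 <> 0) by (intros E; apply RtoC_inj in E; lra).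
  assert (H30 : RtoC 3 <> 0) by (intros E; apply RtoC_inj in E; lra).
  assert (JL : jet3 L (2 * 0) (2 * Gamma 1%nat) (2 * Gamma 2%nat) (2 * Gamma 3%nat)).
  { apply (jet3_ext_loc (fun w => 2 * (L w / 2)) L _ _ _ _ 1); [lra|intros z _; field; auto|].
    apply jet3_scal, (jet3_series _ Gamma r Hr). intros w Hw.
    destruct (Hs w Hw) as (s & H1 & H2). rewrite H2. now replace (2 * s / 2) with s by (field; auto). }
  replace (2 * 0) with (RtoC 0) in JL by ring.
  revert JL. generalize (2 * Gamma 1%nat) (2 * Gamma 2%nat) (2 * Gamma 3%nat). intros l1 l2 l3 JL.
  pose proof (jet3_comp _ _ _ _ _ _ _ _ _ jet3_Cexp JL) as JM.
  pose proof (jet3_mult _ _ _ _ _ _ _ _ _ _ (jet3_poly 0 1 0 0) JM) as JF.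
  eapply jet3_ext_coef with (b0 := RtoC 0) in JF; [|ring|reflexivity|reflexivity|reflexivity].
  pose proof (jet3_mult _ _ _ _ _ _ _ _ _ _ JM (jet3_comp _ _ _ _ _ _ _ _ _ Jk JF)) as J1.
  eapply (jet3_ext_loc _ (poly3 1 0 0 0) _ _ _ _ (Rmin r r1)) in J1; [|now apply Rmin_pos|].
  2:{ intros w Hw. cbv beta.
      replace (poly3 1 0 0 0 w) with (RtoC 1) by (unfold poly3; ring).
      replace (poly3 0 1 0 0 w) with w by (unfold poly3; ring).
      destruct (classic (w = 0)) as [->|Hw0].
      - rewrite HL0, Cexp_0. replace (0 * 1) with (RtoC 0) by ring. rewrite quot_id_0. ring.
      - rewrite HE; [|eapply Rlt_le_trans; [exact Hw|apply Rmin_l]|auto].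
        replace (w * (F w / w)) with (F w) by (field; auto).
        destruct (HF w) as [_ E]; [eapply Rlt_le_trans; [exact Hw|apply Rmin_r]|].
        rewrite (quot_id_spec f Hf0) in E.
        replace (F w / w * quot_id f (F w)) with (F w * quot_id f (F w) / w) by (field; auto).
        rewrite E. field; auto. }
  destruct (jet3_unique _ _ _ _ _ _ _ _ _ J1 (jet3_poly 1 0 0 0)) as (_ & E1 & E2 & E3).
  assert (Z : forall x y c d : C, x = 0 -> y = c + d * x -> y = c) by (intros x y c d -> ->; ring).
  assert (F1 : l1 = - a2).
  { apply (Z _ _ _ 1 E1). ring. }
  assert (H60 : RtoC 6 <> 0) by (intros E; apply RtoC_inj in E; lra).
  assert (Q6 : / RtoC 6 = / 2 * / 3).
  { replace (RtoC 6) with (RtoC 2 * RtoC 3) by (rewrite <- RtoC_mult; f_equal; ring). field; auto. }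
  assert (F2 : l2 = 3 / 2 * (a2 * a2) - a3).
  { apply (Z _ _ _ 1 E2). rewrite F1. field; auto. }
  split; [exact F1|]. split; [exact F2|].
  apply (Z _ _ _ 1 E3). rewrite F1, F2, Q6. field; auto.
Qed.

Lemma hankel_schwarz (Gamma : nat -> C) (b1 b2 b3 : C) :
  let a2 := b1 in let a3 := b2 + b1 * b1 in
  let a4 := / 2 * b3 + 3 / 2 * (b1 * b2) + b1 * b1 * b1 in
  2 * Gamma 1%nat = - a2 -> 2 * Gamma 2%nat = 3 / 2 * (a2 * a2) - a3 ->
  2 * Gamma 3%nat = 4 * (a2 * a3) - a4 - 10 / 3 * (a2 * a2 * a2) ->
  hankel_2_1 Gamma = / 4 * schwarz_functional b1 b2 b3.
Proof.
  intros a2 a3 a4 E1 E2 E3.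
  assert (H20 : RtoC 2 <> 0) by (intros E; apply RtoC_inj in E; lra).
  assert (H30 : RtoC 3 <> 0) by (intros E; apply RtoC_inj in E; lra).
  unfold hankel_2_1, schwarz_functional.
  replace (RtoC 4) with (RtoC 2 * RtoC 2) by (rewrite <- RtoC_mult; f_equal; ring).
  replace (RtoC 12) with (RtoC 2 * RtoC 2 * RtoC 3) by (rewrite <- !RtoC_mult; f_equal; ring).
  replace (Gamma 1%nat * Gamma 3%nat - Gamma 2%nat ^ 2) with
    ((2 * Gamma 1%nat * (2 * Gamma 3%nat) - (2 * Gamma 2%nat) ^ 2) / (2 * 2)) by (field; auto).
  rewrite E1, E2, E3. unfold a2, a3, a4. field; auto.
Qed.

(** * Logarithm and square root on the right half-plane *)

(** By continuity the increment [k] of [phi] is small, so [w - u] is [e * k] up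
    to a small multiple of [k]; this is solved for [k]. *)
Lemma is_Cderive_inverse (E phi : C -> C) (u e : C) (d : R) :
  (0 < d)%R -> (forall w, (Cmod (w - u) < d)%R -> E (phi w) = w) ->
  Ccont phi u -> e <> 0 -> is_Cderive E (phi u) e -> is_Cderive phi u (/ e).
Proof.
  intros Hd HE Hc He HD. apply is_Cderive_eps. intros eps Heps.
  rewrite is_Cderive_eps in HD.
  assert (Hm : (0 < Cmod e)%R) by now apply Cmod_gt_0.
  set (m := Cmod e) in *.
  set (eta := Rmin (m / 2) (eps * (m * m) / 2)).
  assert (Heta : (0 < eta)%R).
  { apply Rmin_pos; [lra|]. apply Rdiv_lt_0_compat; [|lra]. repeat apply Rmult_lt_0_compat; auto. }
  destruct (HD eta Heta) as [d1 [Hd1 K1]]. destruct (Hc d1 Hd1) as [d2 [Hd2 K2]].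
  exists (Rmin d d2); split; [now apply Rmin_pos|]. intros w Hw.
  specialize (K1 _ (K2 w (Rlt_le_trans _ _ _ Hw (Rmin_r _ _)))).
  rewrite (HE w (Rlt_le_trans _ _ _ Hw (Rmin_l _ _))) in K1.
  rewrite (HE u) in K1 by (replace (u - u) with (RtoC 0) by ring; now rewrite Cmod_0).
  set (k := phi w - phi u) in *. set (h := w - u) in *.
  pose proof (Cmod_ge_0 k). pose proof (Cmod_ge_0 h).
  assert (Hk : (m * Cmod k <= 2 * Cmod h)%R).
  { assert (T : (m * Cmod k <= Cmod (h - e * k) + Cmod h)%R).
    { unfold m. rewrite <- Cmod_mult. replace (e * k) with (- (h - e * k) + h) by ring.
      eapply Rle_trans; [apply Cmod_triangle|]. rewrite Cmod_opp.
      replace (h - (- (h - e * k) + h)) with (h - e * k) by ring. lra. }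
    assert (eta * Cmod k <= m / 2 * Cmod k)%R by (apply Rmult_le_compat_r; [auto|apply Rmin_l]).
    lra. }
  replace (k - / e * h) with (- ((h - e * k) / e)) by (field; auto).
  rewrite Cmod_opp, Cmod_div by auto. fold m.
  apply Rmult_le_reg_r with (m * m)%R; [nra|].
  replace (Cmod (h - e * k) / m * (m * m))%R with (Cmod (h - e * k) * m)%R by (field; lra).
  apply Rle_trans with (eta * Cmod k * m)%R; [apply Rmult_le_compat_r; lra|].
  apply Rle_trans with (eta * (2 * Cmod h))%R; [rewrite Rmult_assoc; apply Rmult_le_compat_l; lra|].
  assert (eta <= eps * (m * m) / 2)%R by apply Rmin_r. nra.
Qed.

(** The principal branch; the formula for the argument is valid on the right
    half-plane, the only place where it is used. *)
Definition Clog (u : C) : C := (ln (Cmod u), atan (Im u / Re u)).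

Lemma Re_pos_neq_0 (u : C) : (0 < Re u)%R -> u <> 0.
Proof. intros H E. rewrite E in H. simpl in H. lra. Qed.

Lemma Cexp_Clog (u : C) : (0 < Re u)%R -> Cexp (Clog u) = u.
Proof.
  intros Hu. assert (Hm : (0 < Cmod u)%R) by now apply Cmod_gt_0, Re_pos_neq_0.
  unfold Cexp, Clog. simpl Re. simpl Im. unfold Re at 1, Im at 1. simpl fst. simpl snd.
  rewrite exp_ln, cos_atan, sin_atan by auto.
  assert (E : Cmod u = (Re u * sqrt (1 + Rsqr (Im u / Re u)))%R).
  { rewrite <- (sqrt_pow2 (Re u)) at 1 by lra. rewrite <- sqrt_mult_alt by apply pow2_ge_0.
    unfold Cmod. f_equal. unfold Rsqr, Re, Im in *. simpl. field. lra. }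
  assert (Hs : (0 < sqrt (1 + Rsqr (Im u / Re u)))%R).
  { apply sqrt_lt_R0. pose proof (Rle_0_sqr (Im u / Re u)). lra. }
  rewrite E. unfold Re, Im in *. destruct u as [x y]; simpl in *. f_equal; field; lra.
Qed.

Lemma continuous_Cmod_eps (g : C -> R) (u : C) :
  continuous (T := C_UniformSpace) (U := R_UniformSpace) g u ->
  forall eps, (0 < eps)%R -> exists d, (0 < d)%R /\
    forall w, (Cmod (w - u) < d)%R -> (Rabs (g w - g u) < eps)%R.
Proof.
  intros H eps He.
  destruct (proj1 (filterlim_locally (U := R_UniformSpace) _ _) H (mkposreal eps He)) as [d Hd].
  exists d; split; [apply cond_pos|]. intros w Hw. apply (Hd w). split.
  - eapply Rle_lt_trans; [apply (Cmod_fst (w - u))|exact Hw].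
  - eapply Rle_lt_trans; [apply (Cmod_snd (w - u))|exact Hw].
Qed.

Lemma Ccont_Clog (u : C) : (0 < Re u)%R -> Ccont Clog u.
Proof.
  intros Hu. assert (Hm : (0 < Cmod u)%R) by now apply Cmod_gt_0, Re_pos_neq_0.
  assert (Cf : continuous (T := C_UniformSpace) (U := R_UniformSpace) (fun w : C => fst w) u)
    by (destruct u; apply continuous_fst).
  assert (Cs : continuous (T := C_UniformSpace) (U := R_UniformSpace) (fun w : C => snd w) u)
    by (destruct u; apply continuous_snd).
  assert (C2 : continuous (T := C_UniformSpace) (U := R_UniformSpace) (fun w => atan (snd w / fst w)) u).
  { apply (continuous_comp (fun w : C => (snd w / fst w)%R) atan); [|apply continuous_atan].
    apply (continuous_mult (K := R_AbsRing) (fun w : C => snd w) (fun w : C => (/ fst w)%R)); auto.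
    apply (continuous_comp (fun w : C => fst w) Rinv); auto. apply continuous_Rinv.
    unfold Re in Hu. lra. }
  intros eps He.
  destruct (continuous_Cmod_eps _ _ C2 (eps / 2)) as [d2 [Hd2 K2]]; [lra|].
  destruct (eps_continuous ln (Cmod u) (continuous_ln _ Hm) (eps / 2)) as [d1 [Hd1 K1]]; [lra|].
  exists (Rmin d1 d2); split; [now apply Rmin_pos|]. intros w Hw.
  eapply Rle_lt_trans; [apply Cmod_le_sum|]. simpl.
  specialize (K2 w (Rlt_le_trans _ _ _ Hw (Rmin_r _ _))).
  assert (A : (Rabs (Cmod w - Cmod u) < d1)%R).
  { eapply Rle_lt_trans; [|exact (Rlt_le_trans _ _ _ Hw (Rmin_l _ _))].
    apply Rabs_le. pose proof (Cmod_sub_ge w u). pose proof (Cmod_sub_ge u w).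
    rewrite (Cmod_sub_sym u) in H0. lra. }
  specialize (K1 _ A). unfold Rminus, Re, Im in *. lra.
Qed.

Lemma Re_pos_nbhd (u w : C) : (Cmod (w - u) < Re u)%R -> (0 < Re w)%R.
Proof.
  intros H. pose proof (Rle_lt_trans _ _ _ (re_le_Cmod (w - u)) H) as H1.
  apply Rabs_def2 in H1. unfold Re in *; simpl in H1. lra.
Qed.

Lemma is_Cderive_Clog (u : C) : (0 < Re u)%R -> is_Cderive Clog u (/ u).
Proof.
  intros Hu. apply (is_Cderive_inverse Cexp Clog u u (Re u)); auto.
  - intros w Hw. now apply Cexp_Clog, (Re_pos_nbhd u).
  - now apply Ccont_Clog.
  - now apply Re_pos_neq_0.
  - rewrite <- (Cexp_Clog u) at 2 by auto. apply is_Cderive_Cexp.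
Qed.

Lemma Clog_1 : Clog 1 = 0.
Proof.
  unfold Clog. rewrite Cmod_1, ln_1. simpl. unfold Rdiv. rewrite Rmult_0_l, atan_0. reflexivity.
Qed.

Lemma Cexp_opp (z : C) : Cexp (- z) = / Cexp z.
Proof.
  pose proof (Cexp_neq_0 z) as H.
  assert (E : Cexp z * Cexp (- z) = 1).
  { rewrite <- Cexp_plus. replace (z + - z) with (RtoC 0) by ring. apply Cexp_0. }
  replace (Cexp (- z)) with (Cexp z * Cexp (- z) / Cexp z) by (field; auto).
  rewrite E. field; auto.
Qed.

Definition Csqrt (u : C) : C := Cexp (RtoC (/ 2) * Clog u).

Lemma Csqrt_sqr (u : C) : (0 < Re u)%R -> Csqrt u * Csqrt u = u.
Proof.
  intros Hu. transitivity (Cexp (Clog u)); [|now apply Cexp_Clog].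
  unfold Csqrt. rewrite <- Cexp_plus. f_equal. rewrite RtoC_inv by lra. field.
Qed.

(** The imaginary part of [Clog u] lies between [- PI / 2] and [PI / 2], so half
    of it has positive cosine. *)
Lemma Re_Csqrt (u : C) : (0 < Re (Csqrt u))%R.
Proof.
  pose proof (atan_bound (Im u / Re u)) as Ha. pose proof PI_RGT_0.
  unfold Csqrt, Cexp, Clog. unfold Re, Im in *; simpl in *.
  apply Rmult_lt_0_compat; [apply exp_pos|]. apply cos_gt_0; lra.
Qed.

Lemma Csqrt_unique (u T : C) : (0 < Re u)%R -> (0 < Re T)%R -> T * T = u -> Csqrt u = T.
Proof.
  intros Hu HT E. pose proof (Csqrt_sqr u Hu) as ES. pose proof (Re_Csqrt u) as HS.
  set (S := Csqrt u) in *. clearbody S.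
  assert (H : S + T <> 0).
  { intros Z. apply (f_equal Re) in Z. unfold Re in *; simpl in Z. lra. }
  replace S with ((S * S - T * T) / (S + T) + T) by (field; auto).
  rewrite ES, E. field; auto.
Qed.

Lemma ex_Cderive_Csqrt (u : C) : (0 < Re u)%R -> ex_Cderive Csqrt u.
Proof.
  intros Hu. eexists. apply (is_Cderive_comp Cexp (fun u => RtoC (/ 2) * Clog u)); [apply is_Cderive_Cexp|].
  apply (is_Cderive_mult (fun _ => RtoC (/ 2)) Clog); [apply is_Cderive_const|now apply is_Cderive_Clog].
Qed.

(** * The extremal function *)

Lemma Re_cayley_inv (u : C) : (Cmod u < 1)%R -> 1 - u <> 0 /\ (0 < Re ((1 + u) / (1 - u)))%R.
Proof.
  intros Hu. assert (H1 : 1 - u <> 0).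
  { intros E. replace u with (1 - (1 - u)) in Hu by ring. rewrite E in Hu.
    replace (1 - 0) with (RtoC 1) in Hu by ring. rewrite Cmod_1 in Hu. lra. }
  split; auto. set (p := (1 + u) / (1 - u)).
  assert (H20 : RtoC 2 <> 0) by (intros E; apply RtoC_inj in E; lra).
  assert (Hp : (0 < Cmod (p + 1))%R).
  { apply Cmod_gt_0. replace (p + 1) with (2 / (1 - u)) by (unfold p; field; auto).
    intros E. apply H20. replace (RtoC 2) with (2 / (1 - u) * (1 - u)) by (field; auto). rewrite E. ring. }
  assert (H : (Cmod (p - 1) < Cmod (p + 1))%R).
  { replace (p - 1) with (u * (p + 1)) by (unfold p; field; auto). rewrite Cmod_mult.
    rewrite <- (Rmult_1_l (Cmod (p + 1))) at 2. now apply Rmult_lt_compat_r. }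
  assert (H2 : (Cmod (p - 1) ^ 2 < Cmod (p + 1) ^ 2)%R).
  { pose proof (Cmod_ge_0 (p - 1)). nra. }
  rewrite !Cmod2_alt in H2. clearbody p. destruct p as [x y]; unfold Re, Im in *; simpl in *. nra.
Qed.

Lemma Cmod_sqr_lt_1 (z : C) : (Cmod z < 1)%R -> (Cmod (z ^ 2) < 1)%R.
Proof. intros H. rewrite Cmod_pow. pose proof (Cmod_ge_0 z). simpl. nra. Qed.

Lemma is_Cderive_sqr (z : C) : is_Cderive (fun w => w ^ 2) z (2 * z).
Proof.
  replace (2 * z) with (1 * (z * 1) + z * (1 * 1 + z * 0)) by ring.
  apply (is_Cderive_mult (fun w => w) (fun w => w * 1)); [apply is_Cderive_id|].
  apply (is_Cderive_mult (fun w => w) (fun _ => 1)); [apply is_Cderive_id|apply is_Cderive_const].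
Qed.

Lemma is_Cderive_h1 (z : C) : (Cmod z < 1)%R ->
  is_Cderive h1 z ((1 + z ^ 2) / ((1 - z ^ 2) * (1 - z ^ 2))).
Proof.
  intros Hz. destruct (Re_cayley_inv (z ^ 2) (Cmod_sqr_lt_1 z Hz)) as [H1 _].
  replace ((1 + z ^ 2) / ((1 - z ^ 2) * (1 - z ^ 2))) with
    ((1 * (1 - z ^ 2) - z * (0 - 2 * z)) / ((1 - z ^ 2) * (1 - z ^ 2))) by (unfold Cdiv; ring).
  apply (is_Cderive_div (fun w => w) (fun w => 1 - w ^ 2)); auto; [apply is_Cderive_id|].
  apply (is_Cderive_minus (fun _ => 1) (fun w => w ^ 2)); [apply is_Cderive_const|apply is_Cderive_sqr].
Qed.

Lemma h1_0 : h1 0 = 0.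
Proof. unfold h1, Cdiv. ring. Qed.

Lemma h1_starlike_symmetric : starlike_symmetric h1.
Proof.
  split; [split; [|split]|].
  - intros z Hz. eexists. now apply is_Cderive_h1.
  - apply h1_0.
  - apply is_C_derive_unique.
    replace (RtoC 1) with ((1 + 0 ^ 2) / ((1 - 0 ^ 2) * (1 - 0 ^ 2))).
    + apply is_Cderive_h1. rewrite Cmod_0; lra.
    + replace (1 + 0 ^ 2) with (RtoC 1) by ring. replace (1 - 0 ^ 2) with (RtoC 1) by ring. field; intros E; apply RtoC_inj in E; lra.
  - intros z Hz Hz0. destruct (Re_cayley_inv (z ^ 2) (Cmod_sqr_lt_1 z Hz)) as [H1 H2].
    assert (H20 : RtoC 2 <> 0) by (intros E; apply RtoC_inj in E; lra).
    assert (E : h1 z - h1 (- z) = 2 * z / (1 - z ^ 2)).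
    { unfold h1. replace ((- z) ^ 2) with (z ^ 2) by ring. field; auto. }
    rewrite E, (is_C_derive_unique _ _ _ (is_Cderive_h1 z Hz)). split.
    + intros Z. apply (Cmult_neq_0 2 z H20 Hz0).
      replace (2 * z) with (2 * z / (1 - z ^ 2) * (1 - z ^ 2)) by (field; auto). rewrite Z. ring.
    + replace (z * ((1 + z ^ 2) / ((1 - z ^ 2) * (1 - z ^ 2))) / (2 * z / (1 - z ^ 2))) with
        (RtoC (/ 2) * ((1 + z ^ 2) / (1 - z ^ 2))) by (rewrite RtoC_inv by lra; field; auto).
      set (p := (1 + z ^ 2) / (1 - z ^ 2)) in *. clearbody p. unfold Re in *; simpl. lra.
Qed.

Lemma h1_series (z : C) : (Cmod z < 1)%R ->
  is_series (K := C_AbsRing) (V := C_NormedModule) (fun n : nat => z ^ (2 * n + 1)) (h1 z).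
Proof.
  intros Hz. pose proof (Cmod_sqr_lt_1 z Hz) as Hz2.
  destruct (Re_cayley_inv (z ^ 2) Hz2) as [H1 _].
  assert (HS : forall n, sum_n (G := C_AbelianMonoid) (fun n => z ^ (2 * n + 1)) n - h1 z =
     - (h1 z * (z ^ 2) ^ S n)).
  { induction n as [|n IH].
    - rewrite sum_O. replace (z ^ (2 * 0 + 1)) with z by (simpl; ring).
      unfold h1. field; auto.
    - rewrite sum_Sn. change (@plus C_AbelianMonoid) with Cplus.
      match goal with |- ?s + ?t - _ = _ => replace (s + t - h1 z) with (s - h1 z + t) by ring end.
      rewrite IH. rewrite Cpow_add_r, Cpow_mult_r, Cpow_1_r.
      rewrite (Cpow_S (z ^ 2) (S n)). set (X := (z ^ 2) ^ S n). unfold h1. field; auto. }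
  apply is_series_eps. intros eps He.
  pose proof (Cmod_ge_0 (h1 z)).
  destruct (pow_lt_1_zero (Cmod (z ^ 2))) with (y := (eps / (Cmod (h1 z) + 1))%R) as [N HN].
  { rewrite Rabs_pos_eq; auto. apply Cmod_ge_0. }
  { apply Rdiv_lt_0_compat; lra. }
  exists N. intros n Hn. rewrite HS, Cmod_opp, Cmod_mult, Cmod_pow.
  specialize (HN (S n) ltac:(lia)).
  assert (Hq : (0 <= Cmod (z ^ 2) ^ S n)%R) by apply pow_le, Cmod_ge_0.
  rewrite Rabs_pos_eq in HN by auto. set (X := (Cmod (z ^ 2) ^ S n)%R) in *.
  assert (E : (eps / (Cmod (h1 z) + 1) * (Cmod (h1 z) + 1) = eps)%R) by (field; lra).
  nra.
Qed.

(** The square root of the discriminant of [w * z ^ 2 + z - w = 0], the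
    equation [h1 z = w]. *)
Definition h1_root (w : C) : C := Csqrt (1 + 4 * w ^ 2).
Definition h1_inv (w : C) : C := 2 * w / (1 + h1_root w).
Definition h1_log (w : C) : C := - Clog (/ 2 * (1 + h1_root w)).

Lemma h1_disc_pos (w : C) : (Cmod w < 1 / 2)%R -> (0 < Re (1 + 4 * w ^ 2))%R.
Proof.
  intros Hw. apply (Re_pos_nbhd 1). replace (1 + 4 * w ^ 2 - 1) with (4 * w ^ 2) by ring.
  rewrite Cmod_mult, Cmod_pow, Cmod_R, Rabs_pos_eq by lra. pose proof (Cmod_ge_0 w). simpl. nra.
Qed.

Lemma h1_root_plus_1 (w : C) : 1 + h1_root w <> 0 /\ (0 < Re (/ 2 * (1 + h1_root w)))%R.
Proof.
  pose proof (Re_Csqrt (1 + 4 * w ^ 2)) as H. fold (h1_root w) in H.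
  set (s := h1_root w) in *. clearbody s. split.
  - apply Re_pos_neq_0. unfold Re in *; simpl. lra.
  - rewrite <- RtoC_inv by lra. unfold Re in *; simpl. lra.
Qed.

Lemma h1_root_sqr (w : C) : (Cmod w < 1 / 2)%R -> h1_root w * h1_root w = 1 + 4 * w ^ 2.
Proof. intros Hw. now apply Csqrt_sqr, h1_disc_pos. Qed.

Lemma ex_Cderive_h1_root (w : C) : (Cmod w < 1 / 2)%R -> ex_Cderive h1_root w.
Proof.
  intros Hw. destruct (ex_Cderive_Csqrt _ (h1_disc_pos w Hw)) as [l Hl]. eexists.
  apply (is_Cderive_comp Csqrt (fun w => 1 + 4 * w ^ 2)); [exact Hl|].
  apply (is_Cderive_plus (fun _ => 1) (fun w => 4 * w ^ 2)); [apply is_Cderive_const|].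
  apply (is_Cderive_mult (fun _ => RtoC 4) (fun w => w ^ 2)); [apply is_Cderive_const|apply is_Cderive_sqr].
Qed.

(** With [s] the root of [1 + 4 * w ^ 2], the square of [h1_inv w] is the Cayley
    transform [(s - 1) / (s + 1)], of modulus less than 1.  Conversely, for
    [w = h1 z] the number [(1 + z ^ 2) / (1 - z ^ 2)] is a square root of
    [1 + 4 * w ^ 2] with positive real part. *)
Lemma h1_inverse_near_0 : inverse_near_0 h1 h1_inv.
Proof.
  assert (H20 : RtoC 2 <> 0) by (intros E; apply RtoC_inj in E; lra).
  assert (H40 : RtoC 4 = RtoC 2 * RtoC 2) by (rewrite <- RtoC_mult; f_equal; ring).
  exists (1 / 2)%R. split; [lra|]. split; [|split].
  - intros w Hw. destruct (ex_Cderive_h1_root w Hw) as [l Hl]. eexists.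
    apply (is_Cderive_div (fun w => 2 * w) (fun w => 1 + h1_root w)).
    + apply h1_root_plus_1.
    + apply (is_Cderive_mult (fun _ => RtoC 2) (fun w => w)); [apply is_Cderive_const|apply is_Cderive_id].
    + apply (is_Cderive_plus (fun _ => 1) h1_root); [apply is_Cderive_const|exact Hl].
  - intros w Hw. pose proof (h1_root_sqr w Hw) as ES. destruct (h1_root_plus_1 w) as [H1 _].
    pose proof (Re_Csqrt (1 + 4 * w ^ 2)) as HR. fold (h1_root w) in HR.
    assert (EF : h1_inv w * h1_inv w = (h1_root w - 1) / (h1_root w + 1)).
    { unfold h1_inv.
      replace (2 * w / (1 + h1_root w) * (2 * w / (1 + h1_root w))) with
        ((1 + 4 * w ^ 2 - 1) / ((1 + h1_root w) * (1 + h1_root w))) by (rewrite H40; field; auto).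
      rewrite <- ES. field. rewrite Cplus_comm. auto. }
    split.
    + destruct (cayley_lt_1 _ HR) as [_ H2]. rewrite <- EF, Cmod_mult in H2.
      pose proof (Cmod_ge_0 (h1_inv w)). nra.
    + unfold h1. replace (h1_inv w ^ 2) with (h1_inv w * h1_inv w) by ring. rewrite EF.
      unfold h1_inv. assert (h1_root w + 1 <> 0) by now rewrite Cplus_comm.
      replace (1 - (h1_root w - 1) / (h1_root w + 1)) with (2 / (1 + h1_root w)) by (field; auto).
      field; auto.
  - intros z Hz Hw. destruct (Re_cayley_inv (z ^ 2) (Cmod_sqr_lt_1 z Hz)) as [H1 H2].
    assert (ER : h1_root (h1 z) = (1 + z ^ 2) / (1 - z ^ 2)).
    { apply Csqrt_unique; auto; [now apply h1_disc_pos|]. unfold h1. rewrite H40. field; auto. }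
    unfold h1_inv. rewrite ER. unfold h1.
    replace (1 + (1 + z ^ 2) / (1 - z ^ 2)) with (2 / (1 - z ^ 2)) by (field; auto). field; auto.
Qed.

Lemma h1_root_0 : h1_root 0 = 1.
Proof.
  assert (E : 1 + 4 * 0 ^ 2 = 1) by ring.
  unfold h1_root. rewrite E. apply Csqrt_unique; simpl; try lra. ring.
Qed.

(** [h1_inv w / w] is the inverse of [(1 + s) / 2], which lies in the right
    half-plane. *)
Lemma h1_log_branch (r : R) : (0 < r <= 1 / 2)%R -> log_quotient_branch r h1_inv h1_log.
Proof.
  intros Hr. assert (H20 : RtoC 2 <> 0) by (intros E; apply RtoC_inj in E; lra).
  split; [|split].
  - intros w Hw. destruct (ex_Cderive_h1_root w ltac:(lra)) as [l Hl].
    destruct (h1_root_plus_1 w) as [_ HR]. eexists.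
    apply (is_Cderive_opp (fun w => Clog (/ 2 * (1 + h1_root w)))).
    apply (is_Cderive_comp Clog (fun w => / 2 * (1 + h1_root w))); [now apply is_Cderive_Clog|].
    apply (is_Cderive_mult (fun _ => / 2) (fun w => 1 + h1_root w)); [apply is_Cderive_const|].
    apply (is_Cderive_plus (fun _ => 1) h1_root); [apply is_Cderive_const|exact Hl].
  - unfold h1_log. rewrite h1_root_0. replace (/ 2 * (1 + 1)) with (RtoC 1) by (field; auto).
    rewrite Clog_1. ring.
  - intros w Hw Hw0. destruct (h1_root_plus_1 w) as [H1 HR]. unfold h1_log.
    rewrite Cexp_opp, Cexp_Clog by auto. unfold h1_inv. field; auto.
Qed.

Definition h1_Gamma (n : nat) : C := / 2 * taylor_coef (1 / 4) h1_log n.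

Lemma h1_log_coefficients : log_coefficients h1_inv h1_Gamma.
Proof.
  assert (H20 : RtoC 2 <> 0) by (intros E; apply RtoC_inj in E; lra).
  exists (1 / 4)%R, h1_log. split; [lra|]. split; [apply h1_log_branch; lra|].
  destruct (h1_log_branch (1 / 2) ltac:(lra)) as (HD & H0 & _).
  assert (HH : holo_off_0 (1 / 2) h1_log).
  { split; intros z Hz; [apply ex_Cderive_cont|intros _]; exact (HD z Hz). }
  intros w Hw. exists (h1_log w / 2). split; [|field; auto].
  pose proof (taylor_series (1 / 2) (1 / 4) h1_log w HH ltac:(lra) Hw) as HS.
  pose proof (jet3_at_0 _ _ _ _ _ (taylor_jet (1 / 2) (1 / 4) h1_log HH ltac:(lra))) as E0.
  rewrite H0 in E0.
  apply is_series_eps. intros eps He.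
  destruct (is_series_eps_inv _ _ HS eps He) as [N HN]. exists N. intros n Hn.
  specialize (HN (S n) ltac:(lia)).
  set (c := fun k => taylor_coef (1 / 4) h1_log k * w ^ k) in *.
  assert (ES : forall n, sum_n (G := C_AbelianMonoid) (fun k => h1_Gamma (S k) * w ^ S k) n =
     / 2 * sum_n (G := C_AbelianMonoid) c (S n)).
  { induction n0 as [|m IH].
    - rewrite sum_Sn, !sum_O. change (@plus C_AbelianMonoid) with Cplus. unfold c, h1_Gamma.
      rewrite E0. match goal with |- ?a = ?b => change (@eq C a b) end. ring.
    - rewrite sum_Sn, (sum_Sn c (S m)), IH. change (@plus C_AbelianMonoid) with Cplus.
      unfold c, h1_Gamma. match goal with |- ?a = ?b => change (@eq C a b) end. ring. }
  rewrite ES. set (s := sum_n c (S n)) in *.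
  replace (/ 2 * s - h1_log w / 2) with (RtoC (/ 2) * (s - h1_log w))
    by (rewrite RtoC_inv by lra; field; auto).
  rewrite Cmod_mult, Cmod_R, Rabs_pos_eq by lra. pose proof (Cmod_ge_0 (s - h1_log w)). lra.
Qed.

Lemma h1_jet : jet3 (quot_id h1) 1 0 1 0.
Proof.
  exists (4 / 3)%R, (1 / 2)%R. split; [lra|]. intros z Hz.
  assert (Hz2 : (Cmod (z ^ 2) <= 1 / 4)%R).
  { rewrite Cmod_pow. pose proof (Cmod_ge_0 z). simpl. nra. }
  destruct (Re_cayley_inv (z ^ 2) ltac:(lra)) as [H1 _].
  replace (quot_id h1 z) with (/ (1 - z ^ 2)).
  2:{ destruct (classic (z = 0)) as [->|Hz0].
      - rewrite quot_id_0. replace (1 - 0 ^ 2) with (RtoC 1) by ring. field; intros E; apply RtoC_inj in E; lra.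
      - rewrite quot_id_neq by auto. unfold h1. field; auto. }
  replace (/ (1 - z ^ 2) - poly3 1 0 1 0 z) with (z ^ 4 / (1 - z ^ 2)) by (unfold poly3; field; auto).
  replace (4 / 3 * Cmod z ^ 4)%R with (Cmod z ^ 4 / (3 / 4))%R by field.
  apply Cmod_div_le; [lra|rewrite Cmod_pow; lra|].
  pose proof (Cmod_sub_ge 1 (z ^ 2)) as H. rewrite Cmod_1 in H. lra.
Qed.

Lemma h1_hankel : Cmod (hankel_2_1 h1_Gamma) = (1 / 4)%R.
Proof.
  destruct (inverse_log_coefs h1 h1_inv h1_Gamma 0 1 0 h1_0 h1_jet h1_inverse_near_0 h1_log_coefficients)
    as (E1 & E2 & E3).
  assert (H20 : RtoC 2 <> 0) by (intros E; apply RtoC_inj in E; lra).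
  assert (EH : hankel_2_1 h1_Gamma = RtoC (- (1 / 4))).
  { unfold hankel_2_1.
    replace (h1_Gamma 1%nat * h1_Gamma 3%nat - h1_Gamma 2%nat ^ 2) with
      ((2 * h1_Gamma 1%nat * (2 * h1_Gamma 3%nat) - (2 * h1_Gamma 2%nat) ^ 2) / (2 * 2)) by (field; auto).
    rewrite E1, E2, E3. rewrite RtoC_opp, RtoC_div by lra.
    replace (RtoC 4) with (RtoC 2 * RtoC 2) by (rewrite <- RtoC_mult; f_equal; ring).
    field; auto. }
  rewrite EH, Cmod_R, Rabs_Ropp, Rabs_pos_eq; lra.
Qed.

Theorem theorem2p1 :
  (forall (f F : C -> C) (Gamma : nat -> C),
     starlike_symmetric f ->
     inverse_near_0 f F ->
     log_coefficients F Gamma ->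
     (Cmod (hankel_2_1 Gamma) <= 1 / 4)%R) /\
  starlike_symmetric h1 /\
  (forall z : C, (Cmod z < 1)%R ->
     is_series (K := C_AbsRing) (V := C_NormedModule)
       (fun n : nat => z ^ (2 * n + 1)) (h1 z)) /\
  (exists (F : C -> C) (Gamma : nat -> C),
     inverse_near_0 h1 F /\
     log_coefficients F Gamma /\
     Cmod (hankel_2_1 Gamma) = (1 / 4)%R).
Proof.
  split; [|split; [|split]].
  - intros f F Gamma Hf HF HG.
    destruct (starlike_symmetric_coefs f Hf) as (b1 & b2 & b3 & HB & HJ).
    destruct (inverse_log_coefs f F Gamma _ _ _ (proj1 (proj2 (proj1 Hf))) HJ HF HG) as (E1 & E2 & E3).
    rewrite (hankel_schwarz Gamma b1 b2 b3 E1 E2 E3), <- RtoC_inv by lra.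
    rewrite Cmod_mult, Cmod_R, Rabs_pos_eq by lra. lra.
  - exact h1_starlike_symmetric.
  - exact h1_series.
  - exists h1_inv, h1_Gamma. split; [exact h1_inverse_near_0|].
    split; [exact h1_log_coefficients|exact h1_hankel].
Qed.
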